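(* Let $\lambda_1$ be simple ($\lambda_1<\lambda_2$), and let $V_{h_1}\subset V_{h_2}\subset\cdots\subset V_{h_n}$ be a nested sequence of finite element spaces as described in the context. Assume $h_1$ is small enough such that the initial pair $(\lambda_{1,h_1},u_{1,h_1})$ satisfies, for some $\alpha,\sigma>0$, $$a(v,v)-\lambda_{1,h_1}b(v,v)\ge\alpha\|v\|_a^2\quad\forall v\in V \text{ with } b(u_{1,h_1},v)=0,\qquad \sup_{0\ne v\in V}\frac{-\nu\, b(u_{1,h_1},v)}{\|v\|_a}\ge\sigma|\nu|\quad\forall\nu\in\mathbb{R}.$$ Then the eigenpair approximation $(\lambda_{1,h_n},u_{1,h_n})$ produced by the multilevel eigenvalue iteration scheme (defined in the context) has, when the mesh size $h_1$ is small enough, the error estimates $$\|u_{1,h_n}-\bar u_{1,h_n}\|_a\le\delta_{h_n}(\lambda_1),\qquad |\lambda_{1,h_n}-\bar\lambda_{1,h_n}|\le C_9\,\delta_{h_n}^2(\lambda_1).$$ Besides, there exists an eigenfunction $u_1$ of the continuous eigenvalue problem corresponding to $\lambda_1$ such that $$\|u_1-u_{1,h_n}\|_a\le 2\,\delta_{h_n}(\lambda_1),\qquad |\lambda_1-\lambda_{1,h_n}|\le 2C_{10}\,\delta_{h_n}^2(\lambda_1).$$ Here $C_9,C_{10}>0$ are constants independent of the mesh sizes.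
   Context: $\Omega\subset\mathbb{R}^d$ ($d=2,3$) is a bounded domain, $V=H_0^1(\Omega)$ (real-valued functions), $a(u,v)=\int_\Omega\nabla u\cdot\nabla v\,d\Omega$, $b(u,v)=\int_\Omega uv\,d\Omega$, $\|v\|_a^2=a(v,v)$, $\|v\|_b^2=b(v,v)$. The (continuous) eigenvalue problem is: find $(\lambda,u)\in\mathbb{R}\times V$ with $b(u,u)=1$ and $a(u,v)=\lambda b(u,v)$ for all $v\in V$; its eigenvalues, repeated according to multiplicity, are $\lambda_1\le\lambda_2\le\cdots\to\infty$, and $M(\lambda_i)$ is the eigenspace of $\lambda_i$. $V_h\subset V$ denotes the (finite-dimensional) linear finite element space on a shape-regular mesh $\mathcal{T}_h$ of $\Omega$ with mesh size $h$; it is assumed that $\lim_{h\to0}\inf_{v_h\in V_h}\|w-v_h\|_a=0$ for every $w\in V$. The discrete eigenvalue problem in $V_h$ is: find $(\bar\lambda_h,\bar u_h)\in\mathbb{R}\times V_h$ with $b(\bar u_h,\bar u_h)=1$ and $a(\bar u_h,v_h)=\bar\lambda_h b(\bar u_h,v_h)$ for all $v_h\in V_h$; $(\bar\lambda_{1,h},\bar u_{1,h})$ is its first eigenpair (smallest eigenvalue). Define $$\delta_h(\lambda_i)=\sup_{w\in M(\lambda_i),\,\|w\|_a=1}\ \inf_{v_h\in V_h}\|w-v_h\|_a,\qquad \eta_a(h)=\sup_{f\in V,\,\|f\|_b=1}\ \inf_{v_h\in V_h}\|Tf-v_h\|_a,$$ where $T:V'\to V$ is given by $a(Tf,v)=b(f,v)$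 for all $v\in V$. Mesh hierarchy: $\mathcal{T}_{h_1}$ is given, and $\mathcal{T}_{h_k}$ is obtained from $\mathcal{T}_{h_{k-1}}$ by regular refinement (each element is divided into $\beta^d$ subelements), so $h_k=h_{k-1}/\beta$ with an integer $\beta\ge2$. The corresponding linear finite element spaces are nested, $V_{h_1}\subset\cdots\subset V_{h_n}$, and it is assumed that for a constant $C_7$, $$\tfrac1\beta\eta_a(h_{k-1})\le C_7\eta_a(h_k),\qquad \tfrac1\beta\delta_{h_{k-1}}(\lambda_1)\le C_7\delta_{h_k}(\lambda_1),\qquad k=2,\dots,n.$$ The discrete eigenfunctions satisfy $\|\bar u_{1,h_k}-\bar u_{1,h_{k+1}}\|_a\le C_8\delta_{h_k}(\lambda_1)$ for $k=1,\dots,n-1$, with $C_8$ independent of the mesh size $h_k$ (the signs of the $\bar u_{1,h_k}$ being chosen accordingly, with $\bar u_{1,h_1}=u_{1,h_1}$, the initial function below). Multilevel eigenvalue iteration scheme: (i) Solve on the coarsest space: find the first eigenpair $(\lambda_{1,h_1},u_{1,h_1})\in\mathbb{R}\times V_{h_1}$ with $b(u_{1,h_1},u_{1,h_1})=1$ and $a(u_{1,h_1},v)=\lambda_{1,h_1}b(u_{1,h_1},v)$ for all $v\in V_{h_1}$. (ii) For $k=1,\dots,n-1$, find $(\widehat\lambda_{1,h_{k+1}},\widehat u_{1,h_{k+1}})\in\mathbb{R}\times V_{h_{k+1}}$ such that $$a(\widehat u_{1,h_{k+1}},v)-\lambda_{1,h_k}b(\widehat u_{1,h_{k+1}},v)-\widehat\lambda_{1,h_{k+1}}b(u_{1,h_k},v)=-\lambda_{1,h_k}b(u_{1,h_k},v)\quad\forall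 v\in V_{h_{k+1}},$$ $$b(\widehat u_{1,h_{k+1}},u_{1,h_k})=b(u_{1,h_k},u_{1,h_k}),$$ and set $u_{1,h_{k+1}}=\widehat u_{1,h_{k+1}}/\|\widehat u_{1,h_{k+1}}\|_b$, $\lambda_{1,h_{k+1}}=a(u_{1,h_{k+1}},u_{1,h_{k+1}})/b(u_{1,h_{k+1}},u_{1,h_{k+1}})$.
   Formalization: The bound ‖u_1−u_{1,h_n}‖_a ≤ 2δ_{h_n}(λ_1) is false for λ_1 ≥ 4 (e.g. unit square), as δ normalizes by ‖w‖_a=1 but u_1 by ‖u_1‖_b=1; proved instead: ≤ 2‖u_1‖_a δ_{h_n}(λ_1) always, and the literal bound when λ_1 < 4. *)

(* Defs.v *)
From HB Require Import structures.
From mathcomp Require Import all_boot all_order all_algebra.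
From mathcomp Require Import all_classical all_reals all_analysis.
Set Implicit Arguments. Unset Strict Implicit. Unset Printing Implicit Defensive.
Import Order.TTheory GRing.Theory Num.Theory.
Import numFieldNormedType.Exports.
Local Open Scope classical_set_scope.
Local Open Scope ring_scope.

(* R^d is the space of row vectors 'rV[R]_d.  It is given the sigma-algebra
   generated by the coordinates, i.e. the Borel sigma-algebra, and
   d-dimensional Lebesgue measure, built as an iterated product. *)
Definition rowvec_display : measure_display. Proof. exact. Qed.

Section rowvec_measurable.
Context {R : realType} (n : nat).

Definition rowvec_coord (i : 'I_n) (x : 'rV[R]_n) : measurableTypeR R := x 0 i.

Let rowvec_set0 : g_sigma_preimage rowvec_coord set0.
Proof. exact: sigma_algebra0. Qed.

Let rowvec_setC A :
  g_sigma_preimage rowvec_coord A -> g_sigma_preimage rowvec_coord (~` A).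
Proof. exact: sigma_algebraC. Qed.

Let rowvec_bigcup (F : _^nat) :
  (forall i, g_sigma_preimage rowvec_coord (F i)) ->
  g_sigma_preimage rowvec_coord (\bigcup_i (F i)).
Proof. exact: sigma_algebra_bigcup. Qed.

HB.instance Definition _ := @isMeasurable.Build rowvec_display
  'rV[R]_n (g_sigma_preimage rowvec_coord) rowvec_set0 rowvec_setC rowvec_bigcup.

Lemma measurable_rowvec_coord (i : 'I_n) : measurable_fun setT (rowvec_coord i).
Proof.
move=> _ Y mY; rewrite setTI; apply: sub_sigma_algebra => /=.
rewrite -bigcup_seq/=; exists i => /=; first by rewrite mem_index_enum.
by exists Y => //; rewrite setTI.
Qed.

Lemma measurable_fun_rowvec d (T : measurableType d) (f : T -> 'rV[R]_n) :
  (forall i, measurable_fun setT (rowvec_coord i \o f)) -> measurable_fun setT f.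
Proof.
move=> mf; suff : preimage_set_system setT f (g_sigma_preimage rowvec_coord)
    `<=` measurable by move=> h _ A mA; apply: h; exists A.
rewrite -g_sigma_preimage_comp; apply: smallest_sub.
  by split => [|A mA|F mF]; [exact: measurable0|rewrite setTD; exact: measurableC|exact: bigcup_measurable].
move=> A; rewrite -bigcup_seq => -[i _ [B mB <-]]; exact: mf.
Qed.

End rowvec_measurable.

Section lebesgue_rowvec.
Context {R : realType}.
Local Open Scope ereal_scope.

Section step.
Variables (n : nat) (m : {sigma_finite_measure set 'rV[R]_n -> \bar R}).

Definition rowvec_cons (p : measurableTypeR R * 'rV[R]_n) : 'rV[R]_n.+1 :=
  row_mx (const_mx p.1 : 'rV[R]_1) p.2.

Lemma measurable_rowvec_cons : measurable_fun setT rowvec_cons.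
Proof.
apply: measurable_fun_rowvec => i.
case: (split_ordP (i : 'I_(1 + n))) => j ->.
- rewrite (_ : _ \o _ = fst) //; apply/funext => p /=.
  by apply: etrans (row_mxEl _ _ _ _) _; rewrite mxE.
- rewrite (_ : _ \o _ = rowvec_coord j \o snd).
    exact: (measurableT_comp (measurable_rowvec_coord j) measurable_snd).
  by apply/funext => p /=; exact: row_mxEr.
Qed.

Definition lebesgue_step : set 'rV[R]_n.+1 -> \bar R :=
  pushforward (@lebesgue_measure R \x m) rowvec_cons.

Let pushm : {measure set 'rV[R]_n.+1 -> \bar R} :=
  measure_function_pushforward__canonical__measure_function_Measure
    (@lebesgue_measure R \x m) measurable_rowvec_cons.

Let lebesgue_step0 : lebesgue_step set0 = 0. Proof. exact: (measure0 pushm). Qed.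

Let lebesgue_step_ge0 A : 0 <= lebesgue_step A.
Proof. exact: (measure_ge0 pushm). Qed.

Let lebesgue_step_sigma_additive : semi_sigma_additive lebesgue_step.
Proof. exact: (@measure_semi_sigma_additive _ _ _ pushm). Qed.

HB.instance Definition _ := isMeasure.Build _ _ _ lebesgue_step
  lebesgue_step0 lebesgue_step_ge0 lebesgue_step_sigma_additive.

Let rowvec_consK : cancel rowvec_cons (fun x : 'rV[R]_n.+1 =>
  (lsubmx (x : 'rV[R]_(1 + n)) 0 0, rsubmx (x : 'rV[R]_(1 + n)))%R).
Proof. by move=> [a v]; rewrite /rowvec_cons/= row_mxKl row_mxKr mxE. Qed.

Let lebesgue_step_sigma_finite : sigma_finite setT lebesgue_step.
Proof.
have /sigma_finiteP[F [TF ndF Foo]] := sigma_finiteT m.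
have : measurable_fun setT (fun x : 'rV[R]_n.+1 =>
  (rsubmx (x : 'rV[R]_(1 + n)))%R).
  apply: measurable_fun_rowvec => i.
  rewrite (_ : _ \o _ = rowvec_coord (rshift 1 i)) //.
    exact: (@measurable_rowvec_coord R n.+1).
  by apply/funext => x; rewrite /rowvec_coord /= mxE.
move=> mr.
have ml : measurable_fun setT (fun x : 'rV[R]_n.+1 =>
  (lsubmx (x : 'rV[R]_(1 + n)) 0 0)%R : measurableTypeR R).
  rewrite (_ : (fun _ => _) = rowvec_coord (ord0 : 'I_n.+1)) //.
    exact: (@measurable_rowvec_coord R n.+1).
  by apply/funext => x; rewrite /rowvec_coord /= mxE; congr (x _ _); apply: val_inj.
have /sigma_finiteP[G [TG ndG Goo]] := sigma_finiteT (@lebesgue_measure R).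
set g := fun x : 'rV[R]_n.+1 =>
  (lsubmx (x : 'rV[R]_(1 + n)) 0 0, rsubmx (x : 'rV[R]_(1 + n)))%R.
have mg : measurable_fun setT (g : _ -> measurableTypeR R * 'rV[R]_n).
  exact/measurable_fun_pairP.
exists (fun k => g @^-1` (G k `*` F k)).
  rewrite -preimage_bigcup -[LHS](preimage_setT g); congr (_ @^-1` _).
  apply/seteqP; split=> // -[x y] _.
  have [i _ Gix] : (\bigcup_i G i) x by rewrite -TG.
  have [j _ Fjy] : (\bigcup_i F i) y by rewrite -TF.
  exists (maxn i j) => //; split => /=.
  - by move: x Gix; exact/subsetPset/ndG/leq_maxl.
  - by move: y Fjy; exact/subsetPset/ndF/leq_maxr.
move=> k; have [? ?] := Foo k; have [? ?] := Goo k; split.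
  by rewrite -[X in measurable X]setTI; apply: mg => //; exact: measurableX.
rewrite /lebesgue_step /pushforward -comp_preimage.
rewrite (_ : g \o rowvec_cons = id) ?preimage_id; last first.
  by apply/funext => p /=; rewrite /g rowvec_consK.
by rewrite product_measure1E// lte_mul_pinfty// ge0_fin_numE.
Qed.

HB.instance Definition _ := Measure_isSigmaFinite.Build _ _ _ lebesgue_step
  lebesgue_step_sigma_finite.

End step.

Fixpoint lebesgue_rowvec (n : nat) :
    {sigma_finite_measure set 'rV[R]_n -> \bar R} :=
  if n is n'.+1 then lebesgue_step (lebesgue_rowvec n') else \d_(0%R : 'rV[R]_0).

End lebesgue_rowvec.

Section boxes.
Context {R : realType}.
Local Open Scope ereal_scope.

Lemma lebesgue_rowvec_box (n : nat) (A : 'I_n -> set (measurableTypeR R)) :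
  (forall i, measurable (A i)) ->
  lebesgue_rowvec n [set x : 'rV[R]_n | forall i, A i (x ord0 i)] =
  \prod_(i < n) @lebesgue_measure R (A i).
Proof.
have mbox k (B : 'I_k -> set (measurableTypeR R)) :
    (forall i, measurable (B i)) ->
    measurable [set x : 'rV[R]_k | forall i, B i (x ord0 i)].
  move=> mB; rewrite (_ : [set _ | _] =
      \bigcap_(i in [set: 'I_k]) (rowvec_coord i @^-1` B i)).
    apply: fin_bigcap_measurable; first exact: finite_finset.
    move=> i _; rewrite -[X in measurable X]setTI.
    exact: measurable_rowvec_coord.
  by apply/seteqP; split=> [x h i _|x h i]; [exact: h|exact: (h i Logic.I)].
elim: n A => [|n IH] A mA /=.
  rewrite big_ord0 diracE (_ : _ \in _ = true) //.
  by apply/mem_set => -[].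
rewrite big_ord_recl -IH; last by move=> i; exact: mA.
rewrite -product_measure1E; [|exact: mA|]; last exact: (mbox n (fun i => A (lift ord0 i))).
rewrite /lebesgue_step /pushforward; congr (product_measure1 _ _ _).
apply/seteqP; split=> -[a v] /=.
- move=> h; split => [|i].
    have := h ord0;  rewrite (_ : rowvec_cons _ _ _ = a) // (_ : ord0 = lshift n (ord0 : 'I_1)).
      by apply: etrans (row_mxEl _ _ _ _) _; rewrite mxE.
    exact: val_inj.
  have := h (lift ord0 i); rewrite (_ : rowvec_cons _ _ _ = v ord0 i) //.
  rewrite (_ : lift ord0 i = rshift 1 i); last exact: val_inj.
  exact: row_mxEr.
- move=> [ha hv] i; case: (unliftP ord0 i) => [j ->|->].
    rewrite (_ : rowvec_cons _ _ _ = v ord0 j); first exact: hv.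
    rewrite (_ : lift ord0 j = rshift 1 j); last exact: val_inj.
    exact: row_mxEr.
  rewrite (_ : rowvec_cons _ _ _ = a) //.
  rewrite (_ : ord0 = lshift n (ord0 : 'I_1)); last exact: val_inj.
  by apply: etrans (row_mxEl _ _ _ _) _; rewrite mxE.
Qed.

End boxes.

Section sobolev.
Context {R : realType} {d : nat}.
Local Notation Rd := 'rV[R]_d.
Local Notation leb := (lebesgue_rowvec d : {sigma_finite_measure set Rd -> \bar R}).
Implicit Types (Omega : set Rd) (f g u v w phi : Rd -> R) (i : 'I_d).

Definition partial i f : Rd -> R :=
  fun x => 'D_(delta_mx 0 i) (f : Rd -> R^o) x.

Definition iter_partial (s : seq 'I_d) f : Rd -> R := foldr partial f s.

Definition smooth f := forall s : seq 'I_d,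
  continuous (iter_partial s f) /\
  forall i x, derivable (iter_partial s f : Rd -> R^o) x (delta_mx 0 i).

Definition test_function Omega phi := smooth phi /\
  exists K : set Rd,
    [/\ compact K, K `<=` Omega & forall x, ~ K x -> phi x = 0].

(* Elements of function spaces on Omega are represented by total functions on
   R^d, of which only the values in Omega matter; they are not quotiented by
   almost everywhere equality. *)
Definition L2 Omega f :=
  measurable_fun Omega (f : Rd -> measurableTypeR R) /\
  leb.-integrable Omega (fun x => (f x ^+ 2)%:E).

Definition weak_partial Omega i u g := forall phi, test_function Omega phi ->
  \int[leb]_(x in Omega) (u x * partial i phi x) =
  - \int[leb]_(x in Omega) (g x * phi x).

Definition H1 Omega : set (Rd -> R) := [set u | L2 Omega u /\
  forall i, exists g, L2 Omega g /\ weak_partial Omega i u g].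

(* A representative of the i-th weak derivative of an H1 function. *)
Definition wgrad Omega i u : Rd -> R :=
  xget (fun=> 0) [set g | L2 Omega g /\ weak_partial Omega i u g].

Definition bform Omega u v : R := \int[leb]_(x in Omega) (u x * v x).

Definition aform Omega u v : R :=
  \int[leb]_(x in Omega) (\sum_(i < d) wgrad Omega i u x * wgrad Omega i v x).

Definition norm_a Omega v := Num.sqrt (aform Omega v v).
Definition norm_b Omega v := Num.sqrt (bform Omega v v).
Definition norm_H1 Omega v := Num.sqrt (bform Omega v v + aform Omega v v).

Definition H01 Omega : set (Rd -> R) := [set u | H1 Omega u /\
  forall e : R, 0 < e ->
    exists2 phi, test_function Omega phi & norm_H1 Omega (u \- phi) < e].

Definition bounded_domain Omega :=
  [/\ open Omega, connected Omega, Omega !=set0 & bounded_set Omega].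

End sobolev.

Section eigenproblem.
Context {R : realType} {d : nat}.
Local Notation Rd := 'rV[R]_d.
Implicit Types (Omega : set Rd) (u v w f : Rd -> R) (W Vh : set (Rd -> R)).

(* With W := H01 Omega this is the continuous eigenvalue problem, with
   W := V_h the discrete one. *)
Definition eigenpair Omega W (mu : R) u :=
  [/\ W u, bform Omega u u = 1 &
      forall v, W v -> aform Omega u v = mu * bform Omega u v].

Definition first_eigenpair Omega W (mu : R) u :=
  eigenpair Omega W mu u /\
  forall nu w, eigenpair Omega W nu w -> mu <= nu.

Definition eigenspace Omega (mu : R) : set (Rd -> R) := [set w | H01 Omega w /\
  forall v, H01 Omega v -> aform Omega w v = mu * bform Omega w v].

(* lam 0 <= lam 1 <= ... lists the eigenvalues of the continuous problem with
   multiplicity: the e i with lam i = mu form a b-orthonormal basis of the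
   eigenspace of mu, for every eigenvalue mu. *)
Definition eigenvalue_sequence Omega (lam : nat -> R) :=
  [/\ forall i, lam i <= lam i.+1,
      lam @ \oo --> +oo &
      exists e : nat -> Rd -> R,
        [/\ forall i, eigenpair Omega (H01 Omega) (lam i) (e i),
            forall i j, i != j -> bform Omega (e i) (e j) = 0 &
            forall mu w, eigenpair Omega (H01 Omega) mu w ->
              exists N : nat, norm_b Omega (fun x => w x -
                \sum_(i < N | lam i == mu) bform Omega w (e i) * e i x) = 0]].

Definition dist_a Omega Vh w : R := inf [set norm_a Omega (w \- v) | v in Vh].

Definition delta Omega Vh (mu : R) : R := sup [set dist_a Omega Vh w | w in
  [set w | eigenspace Omega mu w /\ norm_a Omega w = 1]].

(* The solution Tf in H01 Omega of a(Tf, v) = b(f, v), unique up to almost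
   everywhere equality. *)
Definition solT Omega f : Rd -> R := xget (fun=> 0) [set g | H01 Omega g /\
  forall v, H01 Omega v -> aform Omega g v = bform Omega f v].

Definition eta_a Omega Vh : R := sup [set dist_a Omega Vh (solT Omega f) | f in
  [set f | H01 Omega f /\ norm_b Omega f = 1]].

End eigenproblem.

Section mesh.
Context {R : realType} {d : nat}.
Local Notation Rd := 'rV[R]_d.

(* The d + 1 rows of K are the vertices of a simplex, and t is the row of
   barycentric coordinates of a point. *)
Definition simplex (K : 'M[R]_(d.+1, d)) : set Rd := [set x |
  exists t : 'rV[R]_d.+1,
    [/\ forall j, 0 <= t 0 j, \sum_j t 0 j = 1 & x = t *m K]].

Definition nondegenerate (K : 'M[R]_(d.+1, d)) :=
  row_free (row_mx K (const_mx 1 : 'cV[R]_d.+1)).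

(* The convex hull of the vertices shared by K and L; empty if there are
   none. *)
Definition common_face (K L : 'M[R]_(d.+1, d)) : set Rd := [set x |
  exists t : 'rV[R]_d.+1,
    [/\ forall j, 0 <= t 0 j, \sum_j t 0 j = 1, x = t *m K &
        forall j, t 0 j != 0 -> exists l, row j K = row l L]].

Definition mesh := seq 'M[R]_(d.+1, d).

(* The disjointness of interiors excludes listing one simplex twice with
   different orders of its vertices. *)
Definition is_mesh (Omega : set Rd) (T : mesh) :=
  [/\ uniq T,
      forall K, K \in T -> nondegenerate K,
      closure Omega = \bigcup_(K in [set` T]) simplex K,
      forall K L, K \in T -> L \in T -> K != L ->
        simplex K `&` simplex L = common_face K L &
      forall K L, K \in T -> L \in T -> K != L ->
        interior (simplex K) `&` interior (simplex L) = set0].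

(* The library norm on 'rV is the maximum norm. *)
Definition enorm (x : Rd) : R := Num.sqrt (\sum_i x 0 i ^+ 2).

Definition diam (K : 'M[R]_(d.+1, d)) : R :=
  sup [set enorm (p.1 - p.2) | p in simplex K `*` simplex K].

Definition inradius (K : 'M[R]_(d.+1, d)) : R := sup [set r | 0 <= r /\
  exists c, forall x, enorm (x - c) <= r -> simplex K x].

Definition mesh_size (T : mesh) : R := \big[Num.max/0]_(K <- T) diam K.

Definition shape_regular (kappa : R) (T : mesh) :=
  forall K, K \in T -> diam K <= kappa * inradius K.

Definition affine_on (A : set Rd) (v : Rd -> R) :=
  exists (c : R) (g : 'cV[R]_d), forall x, A x -> v x = c + (x *m g) 0 0.

Definition fespace (Omega : set Rd) (T : mesh) : set (Rd -> R) := [set v |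
  [/\ H01 Omega v, {within closure Omega, continuous v} &
      forall K, K \in T -> affine_on (simplex K) v]].

Definition regular_refinement (beta : nat) (T T' : mesh) :=
  [/\ forall K', K' \in T' -> exists2 K, K \in T & simplex K' `<=` simplex K,
      forall K, K \in T ->
        simplex K = \bigcup_(K' in
          [set K' | K' \in T' /\ simplex K' `<=` simplex K]) simplex K' /\
        count (fun K' => `[< simplex K' `<=` simplex K >]) T' = (beta ^ d)%N &
      mesh_size T' = mesh_size T / beta%:R].

End mesh.
Arguments mesh : clear implicits.

Section scheme.
Context {R : realType} {d : nat}.
Local Notation Rd := 'rV[R]_d.

(* The spaces V 1, ..., V n stand for V_{h_1}, ..., V_{h_n}; indices outside
   1, ..., n are irrelevant. *)
Definition multilevel_scheme (Omega : set Rd) (n : nat)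
    (V : nat -> set (Rd -> R)) (lam : nat -> R) (u : nat -> Rd -> R)
    (lamhat : nat -> R) (uhat : nat -> Rd -> R) :=
  let a := aform Omega in let b := bform Omega in
  first_eigenpair Omega (V 1%N) (lam 1%N) (u 1%N) /\
  forall k, (1 <= k < n)%N ->
    [/\ V k.+1 (uhat k.+1),
        forall v, V k.+1 v ->
          a (uhat k.+1) v - lam k * b (uhat k.+1) v - lamhat k.+1 * b (u k) v
          = - (lam k * b (u k) v),
        b (uhat k.+1) (u k) = b (u k) (u k),
        u k.+1 = (fun x => uhat k.+1 x / norm_b Omega (uhat k.+1)) &
        lam k.+1 = a (u k.+1) (u k.+1) / b (u k.+1) (u k.+1)].

End scheme.

(* Main.v *)
Require Import Defs.
From HB Require Import structures.
From mathcomp Require Import all_boot all_order all_algebra.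
From mathcomp Require Import all_classical all_reals all_analysis.
From mathcomp Require Import measurable_realfun ring lra.
Set Implicit Arguments. Unset Strict Implicit. Unset Printing Implicit Defensive.
Import Order.TTheory GRing.Theory Num.Theory.
Import numFieldNormedType.Exports.
Local Open Scope classical_set_scope.
Local Open Scope ring_scope.

(** Everything except the Sobolev space itself takes place in a vector space
    with two positive semidefinite forms [a] and [b], where [a] is complete and
    dominates [b] compactly.  If some [u] is as in the condition on the initial
    pair, then [a] has a first eigenvector [e] with a spectral gap above it, and
    this gap does not depend on the mesh; if there is no such [u], the claim is
    void.

    The a-projection of [e] onto a trial space has a b-error that is small
    compared with its a-error (Aubin-Nitsche), so the discrete eigenvector is
    within [(1 + o(1)) dist_a e] of [e].  One step of the scheme is a Rayleigh
    quotient iteration, whose error is cubic: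
    [||u' - ubar'||_a <= K ||u - ubar'||_a ^ 3].  As
    [||u - ubar'||_a <= (1 + C8) delta] and [delta <= beta C7 delta'], the new
    error is at most [delta'] once the mesh is fine, which is the induction.

    For [H01] the compact domination is Rellich's theorem: the mean oscillation
    of a C1 function over cells of size [s] is bounded by its shifts, hence by
    [s] times the Dirichlet norm, and test functions are dense. *)

(** Functions are not identified when they agree almost everywhere, so [a] and [b] are only
    semidefinite: projections, limits and eigenvectors are determined up to null vectors. A trial
    space enters as a bare subspace, so the a-projection of [e] is sought in its a-closure
    [form_closure], and identities tested on the trial space are extended there by boundedness. The
    constants have to be fixed before any mesh, whereas the coercivity constant of the initial pair
    comes with the mesh; the gap is therefore taken from one fixed [u] with that property. Since
    [delta] normalises by the a-norm and [e] by the b-norm, the distance of [e] is [sqrt lam] times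
    [delta]; the factor 2 in the last estimates then leaves room only for a quasi-optimality
    constant near 1 when [lam] is just below 4, which is why the b-error of the projection has to be
    small relative to its a-error. Finally, eigenvectors have a sign: the initial discrete one may
    be near [- e], and closeness of consecutive discrete eigenvectors carries the choice to finer
    meshes. *)

(** * Semidefinite bilinear forms *)

Definition symbilin (R : realType) (V : lmodType R) (q : V -> V -> R) : Prop :=
  (forall u v, q u v = q v u) /\
  forall c u v w, q (c *: u + v) w = c * q u w + q v w.

Definition psd (R : realType) (V : lmodType R) (q : V -> V -> R) : Prop :=
  symbilin q /\ forall v, 0 <= q v v.

Definition subspace (R : realType) (V : lmodType R) (W : set V) : Prop :=
  W 0 /\ forall (c : R) u v, W u -> W v -> W (c *: u + v).

Definition form_closure (R : realType) (V : lmodType R) (a : V -> V -> R)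
    (W : set V) : set V :=
  [set x | forall e : R, 0 < e -> exists2 w, W w & a (x - w) (x - w) < e].

Definition form_complete (R : realType) (V : lmodType R) (a : V -> V -> R) : Prop :=
  forall f : nat -> V,
    (forall e : R, 0 < e -> exists N, forall m n, (N <= m)%N -> (N <= n)%N ->
       a (f m - f n) (f m - f n) < e) ->
    exists l, forall e : R, 0 < e -> exists N, forall n, (N <= n)%N ->
       a (f n - l) (f n - l) < e.

Section forms.
Context (R : realType) (V : lmodType R).
Implicit Types (q a b : V -> V -> R) (u v w : V) (W : set V).

Section symbilin_theory.
Context q (hq : symbilin q).

Lemma formC u v : q u v = q v u. Proof. exact: hq.1. Qed.
Lemma formDl u v w : q (u + v) w = q u w + q v w.
Proof. by have := hq.2 1 u v w; rewrite scale1r mul1r. Qed.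
Lemma form0l v : q 0 v = 0.
Proof. by have := hq.2 1 0 0 v; rewrite scaler0 addr0 mul1r => /eqP; lra. Qed.
Lemma formZl c u v : q (c *: u) v = c * q u v.
Proof. by have := hq.2 c u 0 v; rewrite !addr0 form0l addr0. Qed.
Lemma formNl u v : q (- u) v = - q u v.
Proof. by rewrite -scaleN1r formZl mulN1r. Qed.
Lemma formDr u v w : q u (v + w) = q u v + q u w.
Proof. by rewrite !(formC u) formDl. Qed.
Lemma form0r v : q v 0 = 0. Proof. by rewrite formC form0l. Qed.
Lemma formZr c u v : q u (c *: v) = c * q u v.
Proof. by rewrite !(formC u) formZl. Qed.
Lemma formNr u v : q u (- v) = - q u v.
Proof. by rewrite !(formC u) formNl. Qed.

Definition formE := (formDl, formDr, formNl, formNr, formZl, formZr, form0l, form0r).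

Lemma form_subC u v : q (u - v) (u - v) = q (v - u) (v - u).
Proof. by rewrite -opprB formNl formNr opprK. Qed.

Lemma form_sqrB u v : q (u - v) (u - v) = q u u - 2 * q u v + q v v.
Proof. by rewrite !formE (formC v u); ring. Qed.

Lemma form_sqrD u v : q (u + v) (u + v) = q u u + 2 * q u v + q v v.
Proof. by rewrite !formE (formC v u); ring. Qed.
End symbilin_theory.

Lemma discriminant_nonneg (A B C : R) :
  (forall t : R, 0 <= A + 2 * t * B + t ^+ 2 * C) -> B ^+ 2 <= A * C.
Proof.
move=> h.
have A0 : 0 <= A by have := h 0; lra.
have [C0|C0|C0] := ltgtP C 0.
(* For negative [C] the values at [s + 1] and [- (s + 1)] average to a negative number, since
   [s * C = - (A + 1)]. *)
- pose s := (A + 1) / - C.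
  have hs : 0 < s by rewrite divr_gt0//; lra.
  have hsC : s * C = - (A + 1) by rewrite /s; field; lra.
  have h1 : 0 <= A + 2 * (s + 1) * B + (s + 1) ^+ 2 * C by exact: h.
  have h2 : 0 <= A + 2 * (- (s + 1)) * B + (- (s + 1)) ^+ 2 * C by exact: h.
  have : 0 <= A + (s + 1) ^+ 2 * C by lra.
  have -> : (s + 1) ^+ 2 * C = s ^+ 2 * C + 2 * (s * C) + C by ring.
  have : s ^+ 2 * C <= 0 by rewrite nmulr_lle0 ?sqr_ge0.
  by rewrite hsC; lra.
- have := h (- B / C).
  have -> : A + 2 * (- B / C) * B + (- B / C) ^+ 2 * C = (A * C - B ^+ 2) / C.
    by field; rewrite gt_eqF.
  by rewrite pmulr_lge0 ?invr_gt0// subr_ge0.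
- rewrite C0 mulr0; have [->|B0] := eqVneq B 0; first by rewrite expr0n.
  have := h (- (A + 1) / (2 * B)); rewrite C0 mulr0 addr0.
  have -> : 2 * (- (A + 1) / (2 * B)) * B = - (A + 1) by field.
  by lra.
Qed.

Section psd_theory.
Context q (hq : psd q).
Let sq := hq.1.

Lemma form_CS u v : q u v ^+ 2 <= q u u * q v v.
Proof.
apply: discriminant_nonneg => t.
have := hq.2 (u + t *: v); rewrite (form_sqrD sq) !(formE sq); lra.
Qed.

Definition fnorm v := Num.sqrt (q v v).

Lemma fnorm_ge0 v : 0 <= fnorm v. Proof. exact: sqrtr_ge0. Qed.
Lemma fnorm_sqr v : fnorm v ^+ 2 = q v v. Proof. exact/sqr_sqrtr/hq.2. Qed.

Lemma fnorm_le v c : 0 <= c -> q v v <= c ^+ 2 -> fnorm v <= c.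
Proof. by move=> c0 h; rewrite -[c]ger0_norm// -sqrtr_sqr ler_wsqrtr. Qed.

Lemma fnorm_CS u v : `|q u v| <= fnorm u * fnorm v.
Proof.
rewrite -[leRHS]ger0_norm ?mulr_ge0 ?fnorm_ge0// -ler_sqr ?normr_nneg//.
by rewrite !real_normK ?num_real// exprMn !fnorm_sqr form_CS.
Qed.

Lemma fnormD u v : fnorm (u + v) <= fnorm u + fnorm v.
Proof.
apply: fnorm_le; first by rewrite addr_ge0 ?fnorm_ge0.
rewrite (form_sqrD sq) -!fnorm_sqr.
by have := fnorm_CS u v; rewrite ler_norml => /andP[_]; lra.
Qed.

Lemma fnormN u : fnorm (- u) = fnorm u.
Proof. by rewrite /fnorm (formNl sq) (formNr sq) opprK. Qed.

Lemma fnormBC u v : fnorm (u - v) = fnorm (v - u).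
Proof. by rewrite -opprB fnormN. Qed.

Lemma fnormB u v : fnorm (u - v) <= fnorm u + fnorm v.
Proof. by rewrite -(fnormN v) fnormD. Qed.

Lemma fnorm_dist3 u v w : fnorm (u - w) <= fnorm (u - v) + fnorm (v - w).
Proof. by rewrite (_ : u - w = (u - v) + (v - w)) ?fnormD // addrA subrK. Qed.

Lemma fnormZ c u : fnorm (c *: u) = `|c| * fnorm u.
Proof.
by rewrite /fnorm (formZl sq) (formZr sq) mulrA -expr2 sqrtrM ?sqr_ge0// sqrtr_sqr.
Qed.
End psd_theory.
End forms.

(** * Minimisation over a subspace by completeness *)

Section projection.
Context (R : realType) (V : lmodType R) (a q : V -> V -> R).
Context (ha : psd a) (hq : psd q) (C : R) (hC : forall v, q v v <= C * a v v).

Lemma archi_inv (e : R) : 0 < e -> exists N : nat, forall n, (N <= n)%N -> n.+1%:R^-1 < e.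
Proof.
move=> e0; exists (Num.truncn e^-1) => n Nn.
rewrite invf_plt ?posrE// (lt_le_trans (truncnS_gt _))// ler_nat ltnS//.
Qed.

(* A minimizing sequence for [q (x + w) (x + w)] is Cauchy by the
   parallelogram identity. *)
Lemma form_projection (W : set V) (alpha : R) : subspace W -> 0 < alpha ->
  (forall v, W v -> alpha * a v v <= q v v) -> form_complete a ->
  forall x, exists w, form_closure a W w /\ forall v, W v -> q (x + w) v = 0.
Proof.
move=> hW al0 hal cpl x.
have sq := hq.1; have sa := ha.1.
pose E := [set r | exists2 w, W w & r = q (x + w) (x + w)].
have lbE : has_lbound E by exists 0 => _ [w _ ->]; exact: hq.2.
have E0 : E !=set0 by exists (q (x + 0) (x + 0)); exists 0 => //; exact: hW.1.
pose m := inf E.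
have mle w : W w -> m <= q (x + w) (x + w) by move=> Ww; apply: ge_inf => //; exists w.
have /choice[f hf] (n : nat) : exists w, W w /\ q (x + w) (x + w) < m + n.+1%:R^-1.
  have [_ [w Ww ->] h] := @inf_adherent _ E n.+1%:R^-1 ltac:(by rewrite invr_gt0) (conj E0 lbE).
  by exists w.
have WB u v : W u -> W v -> W (u - v).
  by move=> Wu Wv; rewrite -[u - v]addrC -scaleN1r; exact: hW.2.
have hdist i j : q (f i - f j) (f i - f j) <= 2 * i.+1%:R^-1 + 2 * j.+1%:R^-1.
  have Wm : W (2^-1 *: (f i + f j)).
    by rewrite -[_ *: _]addr0; apply: hW.2; [rewrite -[f i]scale1r; exact: hW.2 (hf i).1 (hf j).1|exact: hW.1].
  have [_ h1] := hf i; have [_ h2] := hf j.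
  have h3 := mle _ Wm.
  have : q (f i - f j) (f i - f j) = 2 * q (x + f i) (x + f i) + 2 * q (x + f j) (x + f j)
     - 4 * q (x + 2^-1 *: (f i + f j)) (x + 2^-1 *: (f i + f j)).
    rewrite !(formE sq) (formC sq (f i) x) (formC sq (f j) x) (formC sq (f j) (f i)); lra.
  move: h1 h2 h3; move: (i.+1%:R^-1 : R) (j.+1%:R^-1 : R) => ri rj; clear; lra.
have [e e0|w hw] := cpl f.
  have [N hN] := archi_inv (e := alpha * e / 4) ltac:(by rewrite divr_gt0// mulr_gt0).
  exists N; move=> i j Ni Nj.
  have := hdist i j; have := hN _ Ni; have := hN _ Nj.
  move=> h2 h3 h4; have h1 : alpha * a (f i - f j) (f i - f j) <= q (f i - f j) (f i - f j).
    by apply: hal; apply: WB; [exact: (hf i).1|exact: (hf j).1].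
  suff: alpha * a (f i - f j) (f i - f j) < alpha * e by rewrite ltr_pM2l.
  move: h1 h2 h3 h4; move: (i.+1%:R^-1 : R) (j.+1%:R^-1 : R) => ri rj; clear; lra.
exists w; split => [e e0|v Wv].
  have [N hN] := hw e e0; exists (f N); first exact: (hf N).1.
  by rewrite (form_subC sa) hN.
(* Along the line [f n + t v] the form stays above [m], hence above its value at [f n] less
   [n.+1%:R^-1]; the discriminant then bounds the failure of orthogonality. *)
have step n : q (x + f n) v ^+ 2 <= n.+1%:R^-1 * q v v.
  apply: discriminant_nonneg => t.
  have := mle (t *: v + f n) (hW.2 _ _ _ Wv (hf n).1).
  have -> : x + (t *: v + f n) = (x + f n) + t *: v by rewrite addrCA addrC.
  rewrite (form_sqrD sq) !(formZl sq) !(formZr sq).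
  have [_] := hf n; move: (n.+1%:R^-1 : R) => rn; clear; lra.
have C0 : 0 <= Num.max C 0 by rewrite le_max lexx orbT.
have hC' u : q u u <= Num.max C 0 * a u u.
  by rewrite (le_trans (hC u))// ler_wpM2r ?ha.2// le_max lexx.
apply/eqP; rewrite -sqrf_eq0; apply/eqP/le_anti; rewrite sqr_ge0 andbT.
apply/ler_addgt0Pr => e e0; rewrite add0r.
pose K := q v v + 1; have K0 : 0 < K by rewrite ltr_pwDr ?hq.2.
have [N1 hN1] := archi_inv (e := e / (4 * K)) ltac:(by rewrite divr_gt0// mulr_gt0).
have CK : 0 < 4 * (Num.max C 0 + 1) * K by rewrite !mulr_gt0// ltr_pwDr.
have [N2 hN2] := hw (e / (4 * (Num.max C 0 + 1) * K)) ltac:(by rewrite divr_gt0//).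
pose n := maxn N1 N2.
have {hN1}h1 : n.+1%:R^-1 * K <= e / 4.
  have := hN1 n (leq_maxl _ _); rewrite -(ltr_pM2r K0) => /ltW/le_trans; apply.
  by rewrite le_eqVlt; apply/orP; left; apply/eqP; field; rewrite gt_eqF.
have {hN2}h2 : a (f n - w) (f n - w) * (Num.max C 0 + 1) * K <= e / 4.
  have := hN2 n (leq_maxr _ _); rewrite -(ltr_pM2r CK) => /ltW.
  rewrite divfK ?gt_eqF//; lra.
have h3 : q (x + w) v = q (x + f n) v - q (f n - w) v by rewrite !(formE sq); ring.
have h4 := step n; have h5 := form_CS hq (f n - w) v.
have h6 : n.+1%:R^-1 * q v v <= n.+1%:R^-1 * K by rewrite ler_wpM2l ?invr_ge0// /K; lra.
have h7 : q (f n - w) (f n - w) * q v v <= a (f n - w) (f n - w) * (Num.max C 0 + 1) * K.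
  rewrite ler_pM ?hq.2//; last by rewrite /K; lra.
  by rewrite (le_trans (hC' _))// mulrC ler_wpM2l ?ha.2//; lra.
have -> : q (x + w) v ^+ 2 = 2 * q (x + f n) v ^+ 2 + 2 * q (f n - w) v ^+ 2 - (q (x + f n) v + q (f n - w) v) ^+ 2.
  by rewrite h3; ring.
have := sqr_ge0 (q (x + f n) v + q (f n - w) v).
move: h1 h2 h4 h5 h6 h7; move: (n.+1%:R^-1 : R) => rn; clear; lra.
Qed.
End projection.

(** * Projection, Riesz representation and the spectral gap *)

Section consequences.
Context (R : realType) (V : lmodType R) (a b : V -> V -> R).
Context (ha : psd a) (hb : psd b) (Cp : R) (hCp : forall v, b v v <= Cp * a v v).

(** Carries identities tested on a trial space over to its closure, where projections live. The
    bound is squared and [K] may be negative, hence [Num.max K 0 + 1] in the proof. *)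
Lemma form_closure_eq0 (W : set V) (l : V -> R) (K : R) :
  (forall u v, l (u - v) = l u - l v) -> (forall v, l v ^+ 2 <= K * a v v) ->
  (forall v, W v -> l v = 0) -> forall w, form_closure a W w -> l w = 0.
Proof.
move=> lB lK lW w cw.
apply/eqP; rewrite -sqrf_eq0; apply/eqP/le_anti; rewrite sqr_ge0 andbT.
apply/ler_addgt0Pr => e e0; rewrite add0r.
have K0 : 0 < Num.max K 0 + 1 by rewrite ltr_pwDr// le_max lexx orbT.
have [v Wv] := cw (e / (Num.max K 0 + 1)) ltac:(by rewrite divr_gt0).
rewrite ltr_pdivlMr// => h.
have := lK (w - v); rewrite lB (lW v)// subr0.
have : K * a (w - v) (w - v) <= (Num.max K 0 + 1) * a (w - v) (w - v).
  by rewrite ler_wpM2r ?ha.2// (@le_trans _ _ (Num.max K 0)) ?le_max ?lexx// ltW// ltrDl.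
lra.
Qed.

Lemma form_orthogonal_projection (W : set V) : form_complete a -> subspace W ->
  forall x, exists p, form_closure a W p /\ forall v, W v -> a (x - p) v = 0.
Proof.
move=> cpl hW x; have sa := ha.1.
have h1 v : a v v <= 1 * a v v by rewrite mul1r.
have h2 v : W v -> 1 * a v v <= a v v by rewrite mul1r.
have [w [cw hw]] := form_projection ha ha h1 hW ltr01 h2 cpl x.
exists (- w); split; last by move=> v; rewrite opprK; exact: hw.
move=> e /cw[v Wv h]; exists (- v); first by rewrite -scaleN1r -[_ *: _]addr0; apply: hW.2 => //; exact: hW.1.
by rewrite opprK addrC (form_subC sa).
Qed.

(** Boundedness makes the kernel of [l] closed under a-limits, so the residual [z] of a vector
    outside it satisfies [l z != 0]. The combination [l z *: v - l v *: z] lies in the kernel and is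
    therefore orthogonal to [z], which gives [l v]. *)
Lemma riesz (l : V -> R) (K : R) : form_complete a ->
  (forall c u v, l (c *: u + v) = c * l u + l v) ->
  (forall v, l v ^+ 2 <= K * a v v) ->
  exists g, forall v, l v = a g v.
Proof.
move=> cpl hl lK; have sa := ha.1.
have lD u v : l (u + v) = l u + l v by rewrite -[u]scale1r hl mul1r scale1r.
have l0 : l 0 = 0 by have := lD 0 0; rewrite addr0; lra.
have lZ c u : l (c *: u) = c * l u by rewrite -[_ *: _]addr0 hl l0 addr0.
have lB u v : l (u - v) = l u - l v by rewrite lD -scaleN1r lZ mulN1r.
have [h|/existsNP[u0 /eqP lu0]] := pselect (forall v, l v = 0).
  by exists 0 => v; rewrite h (form0l sa).
have hW : subspace [set v | l v = 0].
  by split => // c u v /= lu lv; rewrite hl lu lv mulr0 addr0.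
have [p [cp hp]] := form_orthogonal_projection cpl hW u0.
have lp : l p = 0 by apply: form_closure_eq0 cp; [exact: lB|exact: lK|].
pose z := u0 - p; have lz : l z != 0 by rewrite lB lp subr0.
have zz v : l z * a z v = l v * a z z.
  have : a z (l z *: v - l v *: z) = 0 by apply: hp => /=; rewrite lB !lZ mulrC subrr.
  by rewrite (formDr sa) (formNr sa) !(formZr sa) => /eqP; rewrite subr_eq0 => /eqP.
have azz : a z z != 0.
  apply: contra lz => /eqP h; rewrite -sqrf_eq0; apply/eqP/le_anti; rewrite sqr_ge0 andbT.
  by rewrite (le_trans (lK z))// h mulr0.
exists ((l z / a z z) *: z) => v.
by rewrite (formZl sa) mulrAC zz mulfK.
Qed.

(** With [lam] the infimum of the Rayleigh quotient, [q := a - lam b] is semidefinite; as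
    [lam <= a u u], the hypothesis makes it coercive on the b-complement [H] of [u]. Minimising [q]
    over [u + H] yields [e0] such that the line of [e0] and [H] split the space q-orthogonally.
    Coercivity on [H] forces [q] to degenerate on that line, so [e0] is an eigenvector, and the same
    coercivity becomes the gap. *)
Lemma gap_from_coercivity (u : V) (alpha : R) : form_complete a -> 0 < alpha ->
  b u u = 1 ->
  (forall v, b u v = 0 -> alpha * a v v <= a v v - a u u * b v v) ->
  exists lam e, [/\ 0 < lam, b e e = 1, forall v, a e v = lam * b e v &
    exists2 gam, 0 < gam & forall v, b e v = 0 -> gam * b v v <= a v v - lam * b v v].
Proof.
move=> cpl al0 buu hal; have sa := ha.1; have sb := hb.1.
have Cp0 : 0 < Cp.
  have := hCp u; have := ha.2 u; rewrite buu => h1 h2.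
  by rewrite ltNge; apply/negP => h; have := mulr_le0_ge0 h h1; lra.
pose E := [set r | exists v, [/\ b v v = 1 & r = a v v]].
have lbE : lbound E Cp^-1.
  by move=> _ [v [bv ->]]; have := hCp v; rewrite bv mulrC -ler_pdivrMr// mul1r.
have E0 : E !=set0 by exists (a u u); exists u.
pose lam := inf E.
have lam0 : 0 < lam by apply: (@lt_le_trans _ _ Cp^-1); rewrite ?invr_gt0//; exact: lb_le_inf.
have lamE v : b v v = 1 -> lam <= a v v by move=> bv; apply: ge_inf; [exists Cp^-1|exists v].
have homog mu v : (forall w, b w w = 1 -> mu <= a w w) -> mu * b v v <= a v v.
  move=> h; have [->|bv] := eqVneq (b v v) 0; first by rewrite mulr0 ha.2.
  have bv0 : 0 < b v v by rewrite lt0r bv hb.2.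
  have := h ((Num.sqrt (b v v))^-1 *: v).
  rewrite !(formE sa) !(formE sb) !mulrA -invfM -expr2 sqr_sqrtr ?hb.2// mulVf// => /(_ erefl).
  by rewrite mulrC ler_pdivlMr.
have lamR v : lam * b v v <= a v v by exact: homog.
pose q v w := a v w - lam * b v w.
have sq : symbilin q.
  split=> [v w|c v w x]; first by rewrite /q (formC sa) (formC sb).
  by rewrite /q (sa.2 c) (sb.2 c); ring.
have hq : psd q by split=> // v; rewrite /q subr_ge0.
have qa v : q v v <= 1 * a v v by rewrite mul1r /q gerBl mulr_ge0 ?hb.2 ?ltW.
pose H := [set v | b u v = 0].
have hH : subspace H.
  by split=> [|c v w /= bv bw]; rewrite /H/= !(formE sb)// bv bw mulr0 addr0.
have qH v : H v -> alpha * a v v <= q v v.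
  move=> /hal /le_trans; apply; rewrite /q lerD2l lerN2 ler_wpM2r ?hb.2// lamE//.
have [w [cw hw]] := form_projection ha hq qa hH al0 qH cpl u.
have Hw : b u w = 0.
  apply: (form_closure_eq0 (K := b u u * Cp)) cw => // [v v'|v]; first by rewrite !(formE sb).
  by rewrite (le_trans (form_CS hb _ _))// buu mul1r mul1r.
have [e0 e0E] : exists x, x = u + w by exists (u + w).
rewrite -e0E in hw.
have be0 : b u e0 = 1 by rewrite e0E (formDr sb) buu Hw addr0.
pose m := q e0 e0.
have dec v : exists2 z, H z & v = b u v *: e0 + z.
  exists (v - b u v *: e0); last by rewrite addrC subrK.
  by rewrite /H/= !(formE sb) be0 mulr1 subrr.
have qdec c z : H z -> q (c *: e0 + z) (c *: e0 + z) = c ^+ 2 * m + q z z.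
  by move=> Hz; rewrite (form_sqrD sq) !(formE sq) (hw z Hz) /m; ring.
have bE0 : 0 <= b e0 e0 by exact: hb.2.
(* If [m > 0], then [q] dominates [eps * b] on both summands, one entry of the minimum [eps] for
   each, and [lam + eps] would still bound the Rayleigh quotient from below. *)
have m0 : m = 0.
  apply/le_anti; rewrite (hq.2 e0) andbT leNgt; apply/negP => m_gt0.
  pose eps := Num.min (m / (2 * (b e0 e0 + 1))) (alpha / (2 * Cp)).
  have eps0 : 0 < eps by rewrite lt_min !divr_gt0// mulr_gt0// ltr_wpDl.
  have e1 : eps * (2 * (b e0 e0 + 1)) <= m by rewrite -ler_pdivlMr ?mulr_gt0 ?ltr_wpDl// ge_min lexx.
  have e2 : eps * (2 * Cp) <= alpha by rewrite -ler_pdivlMr ?mulr_gt0// ge_min lexx orbT.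
  have key v : (lam + eps) * b v v <= a v v.
    have [z Hz ->] := dec v; move: (b u v) => c; set x := c *: e0 + z.
    suff : eps * b x x <= q x x by rewrite /q; lra.
    rewrite qdec//.
    have h1 : b x x <= 2 * c ^+ 2 * b e0 e0 + 2 * b z z.
      have -> : b x x = 2 * c ^+ 2 * b e0 e0 + 2 * b z z - b (c *: e0 - z) (c *: e0 - z).
        by rewrite (form_sqrD sb) (form_sqrB sb) !(formE sb); ring.
      by rewrite gerBl hb.2.
    have h2 := qH z Hz; have h3 := hCp z; have c2 := sqr_ge0 c; have az := ha.2 z.
    have h4 : eps * b x x <= eps * (2 * c ^+ 2 * b e0 e0 + 2 * (Cp * a z z)).
      by rewrite ler_pM2l//; lra.
    have h5 : eps * (2 * (b e0 e0 + 1)) * c ^+ 2 <= m * c ^+ 2 by rewrite ler_wpM2r.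
    have h6 : eps * (2 * Cp) * a z z <= alpha * a z z by rewrite ler_wpM2r.
    have h7 : 0 <= eps * c ^+ 2 by rewrite mulr_ge0// ltW.
    by move: h2 h4 h5 h6 h7; clear; lra.
  have : lam + eps <= lam.
    by apply: lb_le_inf => // _ [v [bv ->]]; have := key v; rewrite bv mulr1.
  by move: eps0; clear; lra.
have qe0 v : q e0 v = 0.
  by have [z Hz ->] := dec v; rewrite (formDr sq) (formZr sq) -/m m0 mulr0 add0r hw.
have be0n : 0 < b e0 e0.
  rewrite lt0r bE0 andbT; apply/eqP => h; have := form_CS hb u e0.
  by rewrite be0 h mulr0 expr1n; lra.
pose s := (Num.sqrt (b e0 e0))^-1.
have s0 : s != 0 by rewrite invr_eq0 gt_eqF// sqrtr_gt0.
have [e eE] : exists x, x = s *: e0 by exists (s *: e0).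
have ebe : b e e = 1.
  by rewrite eE !(formE sb) mulrA -invfM -expr2 sqr_sqrtr ?hb.2// mulVf// gt_eqF.
have qe v : q e v = 0 by rewrite eE (formZl sq) qe0 mulr0.
exists lam, e; split=> //.
  by move=> v; apply/eqP; rewrite -subr_eq0; apply/eqP/qe.
exists (alpha / Cp); first by rewrite divr_gt0.
move=> v bev; have be0v : b e0 v = 0.
  by move: bev; rewrite eE (formZl sb) => /eqP; rewrite mulf_eq0 (negPf s0) => /eqP.
have [z Hz vE] := dec v; set c := b u v in vE.
have -> : a v v - lam * b v v = q z z.
  by rewrite -/(q v v) vE qdec// m0 mulr0 add0r.
(* As [v] is b-orthogonal to [e0], dropping its [e0] part cannot decrease the b-norm; hence the gap
   [alpha / Cp]. *)
have bvz : b v v = b z v by rewrite {1}vE (formDl sb) (formZl sb) be0v mulr0 add0r.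
have bvv : b v v <= b z z.
  have := form_CS hb z v; rewrite -bvz expr2.
  have [-> _|bv] := eqVneq (b v v) 0; first exact: hb.2.
  by rewrite ler_pM2r// lt0r bv hb.2.
apply: le_trans (qH z Hz).
rewrite mulrAC ler_pdivrMr// -mulrA ler_pM2l// [a z z * _]mulrC.
exact: le_trans bvv (hCp z).
Qed.
End consequences.

(** * Quasi-optimality of discrete eigenvectors near [e] *)

(** Were [S] larger, it would exceed [G], so that [n * G ^+ 2 <= n * G * S], and the right-hand side
    would fall below [S ^+ 2]. *)
Lemma absorb_quadratic (R : realFieldType) (m n G S : R) : 0 <= m -> 0 <= n -> 0 <= G -> 0 <= S ->
  S ^+ 2 <= m * G * S + n * G ^+ 2 -> S <= (m + n + 1) * G.
Proof.
move=> m0 n0 G0 S0 h; rewrite leNgt; apply/negP => hS.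
have GS : G <= S by rewrite (le_trans _ (ltW hS))// ler_peMl//; lra.
have Sp : 0 < S by rewrite (le_lt_trans _ hS)// mulr_ge0//; lra.
have h1 : (m + n + 1) * G * S < S * S by rewrite ltr_pM2r.
have h2 : n * G * G <= n * G * S by rewrite ler_wpM2l// mulr_ge0.
have h3 : 0 <= G * S by rewrite mulr_ge0.
by move: h h1 h2 h3; rewrite !expr2; clear; lra.
Qed.

(** For [S <= tau] the terms of order three and four in [S] cost at most half of [S ^+ 2]. Once they
    are moved to the left, a quadratic inequality against [(th + D) * D] remains, with doubled
    coefficients. *)
Lemma absorb_eigen (R : realFieldType) (m n tau D S th : R) : 0 <= m -> 0 <= n -> 0 < tau ->
  tau <= 1 -> (m + 2 * n) * tau <= 2^-1 -> 0 <= D -> 0 <= S -> 0 <= th -> S <= tau ->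
  S ^+ 2 <= m * (th * D + D ^+ 2 + S ^+ 2) * S + n * (D ^+ 2 + S ^+ 2) ^+ 2 ->
  S <= (2 * m + 4 * n + 1) * ((th + D) * D).
Proof.
move=> m0 n0 t0 t1 hmn D0 S0 th0 St h.
apply: absorb_quadratic => //; rewrite ?mulr_ge0 ?addr_ge0//.
have h1 : m * S ^+ 2 * S <= m * tau * S ^+ 2.
  have : S * (m * S ^+ 2) <= tau * (m * S ^+ 2) by rewrite ler_wpM2r// mulr_ge0// sqr_ge0.
  by move: (S ^+ 2) => x; clear; lra.
have h2 : (D ^+ 2 + S ^+ 2) ^+ 2 <= 2 * D ^+ 4 + 2 * (tau * S ^+ 2).
  have : S ^+ 2 * S ^+ 2 <= tau * S ^+ 2.
    by rewrite ler_wpM2r ?sqr_ge0// expr2 (le_trans (ler_wpM2l S0 St))// ler_piMl; lra.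
  have := sqr_ge0 (D ^+ 2 - S ^+ 2); have -> : D ^+ 4 = D ^+ 2 * D ^+ 2 by rewrite -exprD.
  by move: (D ^+ 2) (S ^+ 2) => x y; rewrite !expr2; clear; lra.
have h3 : n * (D ^+ 2 + S ^+ 2) ^+ 2 <= n * (2 * D ^+ 4 + 2 * (tau * S ^+ 2)) by rewrite ler_wpM2l.
have h4 : (m + 2 * n) * tau * S ^+ 2 <= 2^-1 * S ^+ 2 by rewrite ler_wpM2r ?sqr_ge0.
have h5 : D ^+ 4 <= ((th + D) * D) ^+ 2.
  have -> : D ^+ 4 = (D * D) ^+ 2 by rewrite -expr2 -exprM.
  by rewrite ler_pXn2r ?nnegrE ?mulr_ge0 ?addr_ge0// ler_wpM2r// lerDr.
have h6 : 4 * n * D ^+ 4 <= 4 * n * ((th + D) * D) ^+ 2 by rewrite ler_wpM2l// mulr_ge0.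
have -> : 2 * m * ((th + D) * D) * S = 2 * (m * (th * D + D ^+ 2) * S) by ring.
move: h; rewrite (_ : m * (_ + _ + _) * S = m * (th * D + D ^+ 2) * S + m * S ^+ 2 * S); last by ring.
move: h1 h3 h4 h6.
have -> : m * tau * S ^+ 2 = m * (tau * S ^+ 2) by ring.
have -> : (m + 2 * n) * tau * S ^+ 2 = m * (tau * S ^+ 2) + 2 * (n * (tau * S ^+ 2)) by ring.
have -> : n * (2 * D ^+ 4 + 2 * (tau * S ^+ 2)) = 2 * (n * D ^+ 4) + 2 * (n * (tau * S ^+ 2)) by ring.
rewrite -mulrA [_ * n * _ ^+ 2]mulrAC.
by clear; lra.
Qed.

Section eigen_perturbation.
Context (R : realType) (V : lmodType R) (a b : V -> V -> R).
Context (ha : psd a) (hb : psd b) (Cp : R) (hCp : forall v, b v v <= Cp * a v v).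
Context (Cp0 : 0 < Cp).
Local Notation sa := ha.1. Local Notation sb := hb.1.

Lemma fnorm_embed v : fnorm b v <= Num.sqrt Cp * fnorm a v.
Proof.
apply: fnorm_le; first by rewrite mulr_ge0 ?sqrtr_ge0.
by rewrite exprMn (fnorm_sqr ha) sqr_sqrtr; [exact: hCp|exact: ltW].
Qed.

Context (lam gam : R) (e : V) (lam0 : 0 < lam) (gam0 : 0 < gam) (bee : b e e = 1).
Context (he : forall v, a e v = lam * b e v).
Context (gap : forall v, b e v = 0 -> gam * b v v <= a v v - lam * b v v).

(** This is the gap for [v] minus its component along [e]; that component is annihilated by
    [a - lam b]. *)
Lemma gap_decomp v : gam * (b v v - b e v ^+ 2) <= a v v - lam * b v v.
Proof.
have := @gap (v - b e v *: e).
rewrite (formDr sb) (formNr sb) (formZr sb) bee mulr1 subrr => /(_ erefl).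
rewrite !(form_sqrB sb) !(form_sqrB sa) !(formZl sa) !(formZr sa) !(formZl sb) !(formZr sb).
by rewrite !he bee (formC sa v e) he (formC sb v e); lra.
Qed.

Lemma rayleigh_ge v : lam * b v v <= a v v.
Proof.
rewrite -subr_ge0 (le_trans _ (gap_decomp v))// mulr_ge0 ?(ltW gam0)// subr_ge0.
by have := form_CS hb e v; rewrite bee mul1r.
Qed.

(** The error splits a-orthogonally into [r := e - p] and [s := p - ubar]. Subtracting the two
    eigenvalue equations tested with [s] expresses [S ^+ 2] by [b r s], which gains the factor [th],
    by the eigenvalue error, which is quadratic, and by [lam * b s s], which the gap reduces to
    these two and to [b e s]. The latter is quadratic because [e] and [ubar] both have b-norm 1.
    Closeness within [tau] is what singles out [ubar] among the discrete eigenvectors. *)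
Lemma eigen_approx : exists K tau : R, [/\ 0 < K, 0 < tau &
  forall (W : set V) (p ubar : V) (th lambar : R), form_closure a W p -> subspace W ->
    (forall v, W v -> a (e - p) v = 0) -> 0 <= th ->
    b (e - p) (e - p) <= th ^+ 2 * a (e - p) (e - p) ->
    W ubar -> b ubar ubar = 1 -> (forall v, W v -> a ubar v = lambar * b ubar v) ->
    fnorm a (e - ubar) <= tau ->
    fnorm a (e - ubar) <= fnorm a (e - p) + K * ((th + fnorm a (e - p)) * fnorm a (e - p))].
Proof.
(* [A0] comes from eliminating [b s s] by the gap, [k] bounds the b-norm by the a-norm, and [C1]
   bounds [b e s] by the squared error. *)
pose A0 := 1 + lam / gam; pose k := Num.sqrt Cp; pose C1 := Cp / 2 + lam^-1.
have A0p : 0 < A0 by rewrite ltr_pwDl// divr_ge0// ltW.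
have k0 : 0 < k by rewrite sqrtr_gt0.
have C10 : 0 < C1 by rewrite addr_gt0// ?divr_gt0// invr_gt0.
pose m := A0 * k * (lam + 1); pose n := lam * C1 ^+ 2.
have m0 : 0 < m by rewrite !mulr_gt0// addr_gt0.
have n0 : 0 < n by rewrite mulr_gt0// exprn_gt0.
have mn0 : 0 < 2 * (m + 2 * n) by rewrite mulr_gt0// addr_gt0// mulr_gt0.
exists (2 * m + 4 * n + 1), (Num.min 1 (2 * (m + 2 * n))^-1); split.
- by rewrite !addr_gt0// mulr_gt0.
- by rewrite lt_min ltr01 invr_gt0.
move=> W p ubar th lambar cp hW hp th0 hth Wu buu hu.
set tau := Num.min _ _ => htau.
have tau0 : 0 < tau by rewrite lt_min ltr01 invr_gt0.
have tau1 : tau <= 1 by rewrite ge_min lexx.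
have taumn : (m + 2 * n) * tau <= 2^-1.
  have : tau <= (2 * (m + 2 * n))^-1 by rewrite ge_min lexx orbT.
  by rewrite -[_^-1]mul1r ler_pdivlMr//; lra.
have [r rE] : exists r, r = e - p by exists (e - p).
have [s sE] : exists s, s = p - ubar by exists (p - ubar).
have ers : e - ubar = r + s by rewrite rE sE addrA subrK.
rewrite -rE in hp hth *; rewrite ers in htau *.
set D := fnorm a r; pose S := fnorm a s.
have D0 : 0 <= D by exact: fnorm_ge0.
have S0 : 0 <= S by exact: fnorm_ge0.
(* [p] is only a limit of trial functions; bounded identities that hold on [W] also hold at [p], and
   hence at [s]. *)
have close0 (q : V -> V -> R) x K : symbilin q -> (forall v, q x v ^+ 2 <= K * a v v) ->
    (forall v, W v -> q x v = 0) -> q x p = 0.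
  by move=> sq qK q0; apply: (form_closure_eq0 ha _ qK q0 cp) => u v; rewrite !(formE sq).
have cs v w : (a v w) ^+ 2 <= a v v * a w w by exact: form_CS.
have arp : a r p = 0 by exact: (close0 a r (a r r) sa (cs r) hp).
have arW v : W v -> a r v = 0 by exact: hp.
have ars : a r s = 0 by rewrite sE (formDr sa) (formNr sa) arp arW// subr0.
pose qb v w := a v w - lambar * b v w.
have qu0 : qb ubar p = 0.
  apply: (close0 qb ubar (2 * a ubar ubar + 2 * lambar ^+ 2 * (b ubar ubar * Cp))).
  - split=> [v w|c v w x]; first by rewrite /qb (formC sa) (formC sb).
    by rewrite /qb (sa.2 c) (sb.2 c); ring.
  - move=> v; have := cs ubar v; have := form_CS hb ubar v; have := hCp v; rewrite /qb buu => h1 h2 h3.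
    have h4 : lambar ^+ 2 * b ubar v ^+ 2 <= lambar ^+ 2 * (Cp * a v v).
      by rewrite ler_wpM2l ?sqr_ge0// (le_trans h2)// mul1r.
    have := sqr_ge0 (a ubar v + lambar * b ubar v).
    by rewrite !sqrrD !sqrrN !exprMn mulrN; move: h3 h4; clear -ha hb hCp Cp0 lam0 gam0 bee he gap; lra.
  - by move=> v Wv; rewrite /qb hu// subrr.
have aup : a ubar s = lambar * b ubar s.
  apply/eqP; rewrite -subr_eq0 sE !(formDr sa) !(formDr sb) !(formNr sa) !(formNr sb) (hu ubar)//.
  by apply/eqP; rewrite -[RHS]qu0 /qb; ring.
(* the residual of [s] in the shifted form *)
pose X := lam * b r s - (lambar - lam) * b ubar s.
have eE : e = ubar + r + s by rewrite -addrA -ers addrC subrK.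
have aes : a e s = a ubar s + a r s + a s s by rewrite eE !(formDl sa).
have bes : b e s = b ubar s + b r s + b s s by rewrite eE !(formDl sb).
have SE : S ^+ 2 = X + lam * b s s.
  rewrite /S (fnorm_sqr ha); move: aes; rewrite he ars bes aup /X => h.
  by move: h; clear -ha hb hCp Cp0 lam0 gam0 bee he gap; lra.
have DE : D ^+ 2 = a r r by rewrite /D fnorm_sqr.
have azz : a (r + s) (r + s) = D ^+ 2 + S ^+ 2 by rewrite (form_sqrD sa) ars DE /S (fnorm_sqr ha); ring.
have aer : a e r = D ^+ 2.
  by rewrite (formC sa) -[e](subrK p) (formDr sa) -rE arp addr0 DE.
have ber : b e r = D ^+ 2 / lam by rewrite -aer he mulrC mulKf// gt_eqF.
(* Equal b-norms make [1 - b e ubar] half of the squared b-error, hence quadratic. *)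
have beu : b e ubar = 1 - b (r + s) (r + s) / 2.
  have : b (e - ubar) (e - ubar) = b (r + s) (r + s) by rewrite ers.
  by rewrite (form_sqrB sb) bee buu; lra.
have cE : b e s = b (r + s) (r + s) / 2 - D ^+ 2 / lam.
  have : b e e = b e ubar + b e r + b e s by rewrite -!(formDr sb) -eE.
  by rewrite bee beu ber; lra.
set c := b e s in cE.
have bzz : b (r + s) (r + s) <= Cp * (D ^+ 2 + S ^+ 2) by rewrite -azz.
have bzz0 : 0 <= b (r + s) (r + s) by exact: hb.2.
have cle : c ^+ 2 <= C1 ^+ 2 * (D ^+ 2 + S ^+ 2) ^+ 2.
  rewrite -exprMn -ler_sqrt ?sqr_ge0// !sqrtr_sqr [leRHS]ger0_norm; last first.
    by rewrite mulr_ge0 ?(ltW C10)// addr_ge0 ?sqr_ge0.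
  have lD : 0 <= D ^+ 2 / lam by rewrite divr_ge0 ?sqr_ge0// ltW.
  have lS : 0 <= S ^+ 2 / lam by rewrite divr_ge0 ?sqr_ge0// ltW.
  have -> : C1 * (D ^+ 2 + S ^+ 2) = Cp * (D ^+ 2 + S ^+ 2) / 2 + (D ^+ 2 / lam + S ^+ 2 / lam).
    by rewrite /C1; ring.
  have CDS : 0 <= Cp * (D ^+ 2 + S ^+ 2) by exact: le_trans bzz.
  rewrite ler_norml cE.
  by apply/andP; split; move: lD lS bzz bzz0 CDS; clear -ha hb hCp Cp0 lam0 gam0 bee he gap; lra.
(* By [SE] the right-hand side of the gap inequality for [s] is exactly [X]. *)
have bss : b s s <= c ^+ 2 + X / gam.
  have := gap_decomp s; rewrite -/c -(fnorm_sqr ha) -/S SE addrK.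
  by rewrite mulrC -ler_pdivlMr// lerBlDl.
have lbl : lambar - lam = a (r + s) (r + s) - lam * b (r + s) (r + s).
  rewrite -ers (form_sqrB sa) (form_sqrB sb) !he bee buu hu// buu; ring.
have nbs : fnorm b s <= k * S by exact: fnorm_embed.
have nbs0 : 0 <= fnorm b s by exact: fnorm_ge0.
have nbr : fnorm b r <= th * D.
  by apply: fnorm_le; rewrite ?mulr_ge0// exprMn DE.
have Xle : X <= (lam * (th * D) + (D ^+ 2 + S ^+ 2)) * (k * S).
  have h1 : lam * b r s <= lam * (th * D) * (k * S).
    rewrite -mulrA ler_pM2l//; have := fnorm_CS hb r s; rewrite ler_norml => /andP[_ /le_trans]; apply.
    by rewrite ler_pM ?fnorm_ge0.
  have h2 : - ((lambar - lam) * b ubar s) <= (D ^+ 2 + S ^+ 2) * (k * S).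
    have l0 : 0 <= lambar - lam by rewrite lbl subr_ge0 rayleigh_ge.
    have l1 : lambar - lam <= D ^+ 2 + S ^+ 2 by rewrite lbl azz gerBl mulr_ge0// ltW.
    have := fnorm_CS hb ubar s; rewrite ler_norml => /andP[h _].
    have nu : fnorm b ubar = 1 by rewrite /fnorm buu sqrtr1.
    apply: (@le_trans _ _ ((lambar - lam) * (k * S))).
      rewrite -mulrN ler_wpM2l// lerNl (le_trans _ h)// nu mul1r lerN2//.
    by rewrite ler_wpM2r// mulr_ge0// ltW.
  by rewrite /X mulrDl; move: h1 h2; clear -ha hb hCp Cp0 lam0 gam0 bee he gap; lra.
have Sle : S <= tau.
  apply: le_trans htau; rewrite -[S]ger0_norm// -sqrtr_sqr /fnorm ler_wsqrtr//.
  by rewrite azz lerDr sqr_ge0.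
have main : S <= (2 * m + 4 * n + 1) * ((th + D) * D).
  apply: (@absorb_eigen _ m n tau) => //; try exact: ltW.
  have A0X : A0 * X <= m * (th * D + D ^+ 2 + S ^+ 2) * S.
    apply: (@le_trans _ _ (A0 * ((lam * (th * D) + (D ^+ 2 + S ^+ 2)) * (k * S)))).
      by rewrite ler_pM2l.
    have -> : m * (th * D + D ^+ 2 + S ^+ 2) * S =
       A0 * (((lam + 1) * (th * D + D ^+ 2 + S ^+ 2)) * (k * S)) by rewrite /m; ring.
    rewrite ler_pM2l// ler_wpM2r ?mulr_ge0 ?(ltW k0)//.
    have := mulr_ge0 th0 D0; have := sqr_ge0 D; have := sqr_ge0 S.
    have := mulr_ge0 (ltW lam0) (sqr_ge0 D); have := mulr_ge0 (ltW lam0) (sqr_ge0 S).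
    by rewrite mulrDl !mulrDr; clear -ha hb hCp Cp0 lam0 gam0 bee he gap; lra.
  apply: (@le_trans _ _ (A0 * X + lam * c ^+ 2)); last first.
    by rewrite lerD// /n -mulrA ler_pM2l.
  rewrite SE (@le_trans _ _ (X + lam * (c ^+ 2 + X / gam)))//.
    by rewrite lerD2l ler_pM2l.
  by rewrite /A0 le_eqVlt; apply/orP; left; apply/eqP; ring.
by rewrite (le_trans (fnormD ha _ _))// lerD2l.
Qed.
End eigen_perturbation.

(** * Starting vector and one step of Rayleigh quotient iteration *)

Section rayleigh.
Context (R : realType) (V : lmodType R) (a b : V -> V -> R).
Context (ha : psd a) (hb : psd b) (Cp : R) (hCp : forall v, b v v <= Cp * a v v).
Context (Cp0 : 0 < Cp).
Local Notation sa := ha.1. Local Notation sb := hb.1.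
Context (lam gam : R) (e : V) (lam0 : 0 < lam) (gam0 : 0 < gam) (bee : b e e = 1).
Context (he : forall v, a e v = lam * b e v).
Context (gap : forall v, b e v = 0 -> gam * b v v <= a v v - lam * b v v).
Local Ltac clra := clear -ha hb hCp Cp0 lam0 gam0 bee he gap; lra.

(** The cross terms cancel because [w] is in the kernel of [a - mu b] when tested with [w] and [x].
    With [b x x = 1] the right-hand side is the error of a Rayleigh quotient, which is thus
    quadratic. Only these two test vectors are allowed because a discrete eigenvector satisfies its
    equation on the trial space alone. *)
Lemma shifted_form_perturb (mu : R) (w x : V) : (forall v, v = w \/ v = x -> a w v = mu * b w v) ->
  a (x - w) (x - w) - mu * b (x - w) (x - w) = a x x - mu * b x x.
Proof.
move=> h; rewrite (form_sqrB sa) (form_sqrB sb) (formC sa x w) (formC sb x w).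
by rewrite (h x)//; [rewrite (h w); [ring|left]|right].
Qed.

(** The last hypothesis makes [u] a minimiser of the Rayleigh quotient on [W]. Comparison with [v0]
    puts the minimum within [4 * del ^+ 2] of [lam], and by the gap a unit vector with such a
    quotient is almost parallel to [e]; its sign stays open. *)
Lemma rayleigh_start (tau : R) : 0 < tau -> exists2 del : R, 0 < del &
  forall (W : set V) (v0 u : V), subspace W -> W v0 -> fnorm a (e - v0) <= del ->
    W u -> b u u = 1 -> (forall v, W v -> a u v = a u u * b u v) ->
    (forall v, b u v = 0 -> 0 <= a v v - a u u * b v v) ->
    fnorm a (e - u) <= tau \/ fnorm a (- e - u) <= tau.
Proof.
move=> tau0; pose Q := 4 * (1 + 2 * lam / gam).
have Q0 : 0 < Q by rewrite mulr_gt0// ltr_wpDr// divr_ge0// ?mulr_ge0// ltW.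
(* The three bounds serve, in turn, [del ^+ 2 <= del], a b-norm of [v0] away from zero, and the
   final estimate by [tau]. *)
pose del := Num.min 1 (Num.min (4 * Cp)^-1 (tau ^+ 2 / Q)).
have del0 : 0 < del.
  by rewrite !lt_min ltr01 invr_gt0 mulr_gt0//= divr_gt0// exprn_gt0.
have del1 : del <= 1 by rewrite ge_min lexx.
have del2 : del * (4 * Cp) <= 1.
  by rewrite -ler_pdivlMr ?mulr_gt0// div1r !ge_min lexx orbT.
have del3 : del * Q <= tau ^+ 2 by rewrite -ler_pdivlMr// !ge_min lexx !orbT.
have dd : del ^+ 2 <= del by rewrite expr2 ler_piMl// ltW.
exists del => // W v0 u hW Wv0 hv0 Wu buu hu hco.
set l := a u u in hu hco *.
have a0 : a (e - v0) (e - v0) <= del ^+ 2.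
  by rewrite -(fnorm_sqr ha) lerXn2r// ?nnegrE ?fnorm_ge0// ltW.
have b0 : b (e - v0) (e - v0) <= 4^-1.
  have := hCp (e - v0); have : Cp * a (e - v0) (e - v0) <= Cp * del by rewrite ler_pM2l//; move: a0 dd; clra.
  by move: del2; clra.
(* Nonnegativity of [b] at [e - 2 *: v0] acts as a reverse triangle inequality. *)
have bv0 : 4^-1 <= b v0 v0.
  have := hb.2 (e - 2 *: v0); move: b0.
  rewrite !(form_sqrB sb) !(formZl sb) !(formZr sb) bee; clra.
(* The eigenvalue equation removes the cross terms between [u] and the b-orthogonal remainder [w] of
   [v0]. *)
have Wray : l * b v0 v0 <= a v0 v0.
  pose w := v0 - b u v0 *: u.
  have := hco w; rewrite /w (formDr sb) (formNr sb) (formZr sb) buu mulr1 subrr => /(_ erefl).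
  rewrite (form_sqrB sa) (form_sqrB sb) !(formZl sa) !(formZr sa) !(formZl sb) !(formZr sb) buu.
  rewrite (formC sa v0 u) hu// (formC sb v0 u) -/l; clra.
have lray := @rayleigh_ge R V a b ha hb lam gam e gam0 bee he gap.
have ll : l - lam <= 4 * del ^+ 2.
  have h1 := @shifted_form_perturb lam e v0 (fun v _ => he v).
  have h2 : (l - lam) * b v0 v0 <= del ^+ 2.
    rewrite mulrBl; move: h1 a0.
    have := mulr_ge0 (ltW lam0) (hb.2 (v0 - e)); rewrite (form_subC sa e).
    by move: Wray; clra.
  have lu : lam <= l by have := lray u; rewrite buu mulr1.
  have h3 : (l - lam) * 4^-1 <= (l - lam) * b v0 v0 by rewrite ler_wpM2l// subr_ge0.
  by move: h2 h3; clra.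
have gd := @gap_decomp R V a b ha hb lam gam e bee he gap u.
have close (s : R) : s = 1 \/ s = -1 -> 0 <= s * b e u -> fnorm a (s *: e - u) <= tau.
  move=> hs hc; have s2 : s * s = 1 by case: hs => ->; rewrite ?mulr1// mulrNN mulr1.
  apply: fnorm_le; first exact: ltW.
  have Qe : a (s *: e - u) (s *: e - u) = (l - lam) + lam * b (s *: e - u) (s *: e - u).
    rewrite !(form_sqrB sa) !(form_sqrB sb) !(formZl sa) !(formZr sa) !(formZl sb) !(formZr sb) !he bee buu -/l.
    rewrite !mulrA s2; ring.
  have be : b (s *: e - u) (s *: e - u) = 2 - 2 * (s * b e u).
    rewrite !(form_sqrB sb) !(formZl sb) !(formZr sb) bee buu !mulrA s2; ring.
  have c1 : (s * b e u) ^+ 2 <= 1.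
    by rewrite exprMn expr2 s2 mul1r; have := form_CS hb e u; rewrite bee buu mulr1.
  have c2 : s * b e u <= 1.
    by rewrite -(@ler_pXn2r _ 2)// ?nnegrE// expr1n.
  have c3 : 1 - s * b e u <= 1 - b e u ^+ 2.
    have -> : b e u ^+ 2 = (s * b e u) ^+ 2 by rewrite exprMn [s ^+ 2]expr2 s2 mul1r.
    by rewrite lerD2l lerN2 expr2 ler_piMl.
  have c4 : gam * (1 - b e u ^+ 2) <= 4 * del ^+ 2.
    by move: gd; rewrite buu mulr1 => /le_trans; apply.
  have c5 : 1 - b e u ^+ 2 <= 4 * del ^+ 2 / gam by rewrite ler_pdivlMr// mulrC.
  have c6 : lam * b (s *: e - u) (s *: e - u) <= lam * (8 * del ^+ 2 / gam).
    by rewrite ler_pM2l// be; move: c3 c5; clra.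
  have c7 : Q * del ^+ 2 <= Q * del by rewrite ler_pM2l.
  have c8 : Q * del ^+ 2 = 4 * del ^+ 2 + lam * (8 * del ^+ 2 / gam) by rewrite /Q; ring.
  by rewrite Qe; move: c6 c7 c8 ll del3; clra.
have [h|h] := leP 0 (b e u).
  by left; have := close 1 (or_introl erefl); rewrite mul1r scale1r; apply.
by right; have := close (-1) (or_intror erefl); rewrite mulN1r scaleN1r; apply; rewrite oppr_ge0 ltW.
Qed.

(* The increment of the iteration is [c ubar + t] with [t] b-orthogonal to
   [ubar]; the scheme tested with [ubar] and with [t] shows that [t] is
   cubically small. *)
Lemma rayleigh_step : exists K tau : R, [/\ 0 < K, 0 < tau &
  forall (W : set V) (u ubar uhat : V) (lamhat lambar : R), subspace W ->
    W u -> b u u = 1 -> W ubar -> b ubar ubar = 1 ->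
    (forall v, W v -> a ubar v = lambar * b ubar v) -> W uhat ->
    (forall v, W v -> a uhat v - a u u * b uhat v - lamhat * b u v = - (a u u * b u v)) ->
    b uhat u = 1 -> fnorm a (e - ubar) <= tau -> fnorm a (u - ubar) <= tau ->
    0 < fnorm b uhat /\
    fnorm a ((fnorm b uhat)^-1 *: uhat - ubar) <= K * fnorm a (u - ubar) ^+ 3].
Proof.
pose k := Num.sqrt Cp; have k0 : 0 < k by rewrite sqrtr_gt0.
have kk : k * k = Cp by rewrite -expr2 sqr_sqrtr// ltW.
pose L := 1 + (lam + 1) * Cp; pose M := 1 + 2 * (lam + gam) / gam.
have L0 : 0 < L by rewrite addr_gt0// mulr_gt0// addr_gt0.
have M0 : 0 < M by rewrite addr_gt0// divr_gt0// mulr_gt0// addr_gt0.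
pose N := 2 * (M * Cp * L); have N0 : 0 < N by rewrite !mulr_gt0.
(* Besides 1, the bounds ensure in turn coercivity of the shifted form on [t], squared b-errors of
   at most 1/4, and a remainder [t] too small for [c] to vanish. *)
pose tau := Num.min 1 (Num.min (gam / (4 * (1 + L))) (Num.min (4 * Cp)^-1 (4 * (Cp * N))^-1)).
have L1 : 0 < 1 + L by rewrite addr_gt0.
have tau0 : 0 < tau.
  by rewrite !lt_min ltr01 !invr_gt0 divr_gt0 ?mulr_gt0.
have tau1 : tau <= 1 by rewrite ge_min lexx.
have tau2 : tau * (4 * (1 + L)) <= gam by rewrite -ler_pdivlMr ?mulr_gt0// !ge_min lexx !orbT.
have tau3 : tau * (4 * Cp) <= 1 by rewrite -ler_pdivlMr ?mulr_gt0// div1r !ge_min lexx !orbT.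
have tau4 : tau * (4 * (Cp * N)) <= 1 by rewrite -ler_pdivlMr ?mulr_gt0// div1r !ge_min lexx !orbT.
have tt : tau ^+ 2 <= tau by rewrite expr2 ler_piMl// ltW.
exists ((1 + k * (lam + 2)) * N), tau; split=> //.
  by rewrite mulr_gt0// addr_gt0// mulr_gt0// addr_gt0.
move=> W u ubar uhat lamhat lambar hW Wu buu Wub bub hub Wuh huh bhu htau htau'.
have [d dE] : exists d, d = u - ubar by exists (u - ubar).
have [z zE] : exists z, z = e - ubar by exists (e - ubar).
rewrite -zE in htau; rewrite -dE in htau' *.
pose eps := fnorm a d; have eps0 : 0 <= eps by exact: fnorm_ge0.
have eps2 : eps ^+ 2 <= tau ^+ 2 by rewrite lerXn2r// nnegrE ltW.
have lray := @rayleigh_ge R V a b ha hb lam gam e gam0 bee he gap.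
have bd : b d d <= Cp * eps ^+ 2 by rewrite (fnorm_sqr ha).
have bz : b z z <= Cp * tau ^+ 2.
  rewrite (le_trans (hCp z))// ler_pM2l// -(fnorm_sqr ha) lerXn2r// nnegrE ?fnorm_ge0//; exact: ltW.
have Cpt : Cp * tau ^+ 2 <= 4^-1.
  have : Cp * tau ^+ 2 <= Cp * tau by rewrite ler_pM2l.
  by move: tau3; clra.
have Cpe : Cp * eps ^+ 2 <= 4^-1 by rewrite (le_trans _ Cpt)// ler_pM2l.
have lbE : lambar = a ubar ubar by rewrite hub// bub mulr1.
have lblam : lam <= lambar by have := lray ubar; rewrite bub mulr1 -lbE.
have lbub : lambar <= lam + tau ^+ 2.
  have := @shifted_form_perturb lam e ubar (fun v _ => he v).
  rewrite (form_subC sa ubar) (form_subC sb ubar) -zE bub -lbE.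
  have : a z z <= tau ^+ 2 by rewrite -(fnorm_sqr ha) lerXn2r// nnegrE ?fnorm_ge0//; exact: ltW.
  have := mulr_ge0 (ltW lam0) (hb.2 z); clra.
have [l lE] : exists l, l = a u u by exists (a u u).
rewrite -lE in huh.
have llb : l - lambar = a d d - lambar * b d d.
  by rewrite dE shifted_form_perturb ?buu ?mulr1 ?lE// => v [->|->]; exact: hub.
have lb1 : lambar <= lam + 1 by move: lbub tt tau1; clra.
have lbd : lambar * b d d <= (lam + 1) * Cp * eps ^+ 2.
  by rewrite -mulrA ler_pM ?hb.2// (le_trans _ lblam)// ltW.
have lbd0 : 0 <= lambar * b d d by rewrite mulr_ge0 ?hb.2// (le_trans _ lblam)// ltW.
have ad : a d d = eps ^+ 2 by rewrite (fnorm_sqr ha).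
have llb1 : l - lambar <= L * eps ^+ 2.
  by rewrite llb ad /L mulrDl; move: lbd lbd0 (sqr_ge0 eps); clra.
have llb2 : - (l - lambar) <= L * eps ^+ 2.
  by rewrite llb ad /L mulrDl; move: lbd lbd0 (sqr_ge0 eps); clra.
have lge0 : lam <= l by have := lray u; rewrite buu mulr1 -lE.
have lle : l <= lam + gam / 4.
  have : L * eps ^+ 2 <= L * tau by rewrite ler_pM2l// (le_trans eps2).
  by move: llb1 lbub tt tau2; clra.
pose c := b uhat ubar.
have [t tE] : exists t, t = uhat - c *: ubar by exists (uhat - c *: ubar).
have Wt : W t by rewrite tE addrC -scaleNr; exact: hW.2.
have but : b ubar t = 0.
  by rewrite tE (formDr sb) (formNr sb) (formZr sb) bub mulr1 (formC sb ubar) subrr.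
have aut : a ubar t = 0 by rewrite hub// but mulr0.
have uhE : uhat = c *: ubar + t by rewrite tE addrC subrK.
have buub : b u ubar = 1 - b d d / 2.
  by rewrite dE (form_sqrB sb) buu bub; clra.
have buub2 : 2^-1 <= b u ubar by rewrite buub; move: bd Cpe; clra.
have zt : b e t ^+ 2 <= b t t / 4.
  have -> : b e t = b z t by rewrite zE (formDl sb) (formNl sb) but subr0.
  rewrite (le_trans (form_CS hb z t))// mulrC ler_wpM2l ?hb.2//.
  by move: bz Cpt; clra.
have gd := @gap_decomp R V a b ha hb lam gam e bee he gap t.
(* [t] is b-orthogonal to [ubar], hence nearly so to [e]: three quarters of the gap remain, and the
   shift [l] exceeds [lam] by at most one quarter. *)
have coer : gam / 2 * b t t <= a t t - l * b t t.
  have h1 : gam * (3 / 4 * b t t) <= gam * (b t t - b e t ^+ 2) by rewrite ler_pM2l//; move: zt; clra.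
  have h2 : l * b t t <= (lam + gam / 4) * b t t by rewrite ler_wpM2r ?hb.2.
  by move: gd h1 h2; clra.
pose q := a t t - l * b t t.
have attM : a t t <= M * q.
  have -> : a t t = q + l * b t t by rewrite /q subrK.
  have h1 : b t t <= 2 / gam * q.
    have -> : 2 / gam * q = q / (gam / 2) by field; rewrite gt_eqF.
    by rewrite ler_pdivlMr ?divr_gt0// mulrC.
  have h2 : l * b t t <= (lam + gam) * (2 / gam * q).
    rewrite ler_pM ?hb.2//; first by rewrite (le_trans _ lge0)// ltW.
    by move: lle gam0; clra.
  have -> : M * q = q + (lam + gam) * (2 / gam * q) by rewrite /M; ring.
  by rewrite lerD2l.
pose mu := lamhat - l.
(* The scheme tested with [t]: the [ubar] part of [uhat] drops out, and [u] may be replaced by the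
   error [d]. *)
have qE : q = mu * b d t.
  have := huh t Wt; rewrite uhE (formDl sa) (formDl sb) (formZl sa) (formZl sb) but aut => h.
  have -> : b d t = b u t by rewrite dE (formDl sb) (formNl sb) but subr0.
  by move: h; rewrite /q /mu; clra.
(* The scheme tested with [ubar]: the multiplier [mu] is proportional to the eigenvalue error, hence
   quadratic in [eps]. Together with [qE] this makes [t] cubic. *)
have muE : c * (lambar - l) = mu * b u ubar.
  have := huh ubar Wub; rewrite (formC sa) hub// (formC sb ubar) -/c /mu; clra.
have muL : `|mu| <= 2 * `|c| * (L * eps ^+ 2).
  have h1 : `|c| * `|lambar - l| = `|mu| * b u ubar.
    rewrite -normrM muE normrM (ger0_norm (x := b u ubar))//.
    by rewrite (le_trans _ buub2)// invr_ge0.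
  have h2 : `|lambar - l| <= L * eps ^+ 2 by rewrite ler_norml; apply/andP; split; move: llb1 llb2; clra.
  have h3 : `|c| * `|lambar - l| <= `|c| * (L * eps ^+ 2) by rewrite ler_wpM2l.
  have h4 : `|mu| * 2^-1 <= `|mu| * b u ubar by rewrite ler_wpM2l.
  have : `|mu| * 2^-1 <= `|c| * (L * eps ^+ 2) by rewrite (le_trans h4)// -h1.
  by rewrite ler_pdivrMr// mulrC mulrA.
pose T := fnorm a t; have T0 : 0 <= T by exact: fnorm_ge0.
have emb := @fnorm_embed R V a b ha Cp hCp Cp0.
have dtk : `|b d t| <= Cp * (eps * T).
  rewrite (le_trans (fnorm_CS hb d t))// (le_trans (ler_pM (fnorm_ge0 b d) (fnorm_ge0 b t) (emb d) (emb t)))//.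
  by rewrite -/k -/eps -/T -kk le_eqVlt; apply/orP; left; apply/eqP; ring.
have T1 : T <= M * Cp * (`|mu| * eps).
  have [->|Tn] := eqVneq T 0; first by rewrite !mulr_ge0// ltW.
  have Tp : 0 < T by rewrite lt0r Tn.
  rewrite -(ler_pM2r Tp) -expr2 (fnorm_sqr ha) (le_trans attM)//.
  have -> : M * Cp * (`|mu| * eps) * T = M * (`|mu| * (Cp * (eps * T))) by ring.
  rewrite ler_pM2l// qE (le_trans (ler_norm _))// normrM ler_wpM2l//.
have T2 : T <= N * (`|c| * eps ^+ 3).
  apply: le_trans T1 _.
  have -> : N * (`|c| * eps ^+ 3) = M * Cp * (2 * `|c| * (L * eps ^+ 2) * eps) by rewrite /N; ring.
  by rewrite ler_pM2l ?mulr_gt0// ler_wpM2r.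
have bcd : c * b u ubar + b d t = 1.
  have -> : b d t = b u t by rewrite dE (formDl sb) (formNl sb) but subr0.
  by rewrite -bhu (formC sb uhat) uhE (formDr sb) (formZr sb).
have bdt : `|b d t| <= `|c| / 4.
  have e1 : eps <= 1 by exact: le_trans htau' tau1.
  have h1 : eps * T <= eps * (N * (`|c| * eps ^+ 3)) by rewrite ler_wpM2l.
  have h2 : eps * (N * (`|c| * eps ^+ 3)) <= tau * (N * (`|c| * 1)).
    apply: ler_pM => //; first by rewrite !mulr_ge0 ?exprn_ge0// ltW.
    by rewrite ler_pM2l// ler_wpM2l// exprn_ile1.
  rewrite (le_trans dtk)// (@le_trans _ _ (Cp * (tau * (N * (`|c| * 1)))))//.
    by rewrite ler_pM2l// (le_trans h1).
  have -> : Cp * (tau * (N * (`|c| * 1))) = tau * (4 * (Cp * N)) * (`|c| / 4) by field.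
  by rewrite ler_piMl// divr_ge0.
(* With [t] negligible, the constraint [b uhat u = 1] excludes [c <= 0], so normalisation preserves
   the sign. *)
have c0 : 0 < c.
  rewrite ltNge; apply/negP => cn; move: bdt; rewrite (ler0_norm cn) ler_norml => /andP[_ h].
  have : c * b u ubar <= c * 2^-1 by rewrite ler_wnM2l.
  by move: h bcd cn; clra.
have [t1 t1E] : exists t1, t1 = c^-1 *: t by exists (c^-1 *: t).
have uhE1 : uhat = c *: (ubar + t1).
  by rewrite t1E scalerDr scalerA mulfV ?gt_eqF// scale1r.
have T3 : fnorm a t1 <= N * eps ^+ 3.
  rewrite t1E fnormZ// ger0_norm ?invr_ge0 ?(ltW c0)// -/T ler_pdivrMl//.
  by rewrite (le_trans T2)// (ger0_norm (ltW c0)) le_eqVlt; apply/orP; left; apply/eqP; ring.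
pose y := fnorm b t1; have y0 : 0 <= y by exact: fnorm_ge0.
(* [nu] is the b-norm of [ubar + t1], since [t1] is b-orthogonal to the unit vector [ubar]; it
   differs from 1 by at most [y]. *)
pose nu := Num.sqrt (1 + y ^+ 2).
have nu1 : 1 <= nu by rewrite -[leLHS]sqrtr1 ler_wsqrtr// lerDl sqr_ge0.
have nup : 0 < nu by exact: lt_le_trans nu1.
have nuy : nu <= 1 + y.
  rewrite -[leRHS]ger0_norm ?addr_ge0// -sqrtr_sqr ler_wsqrtr// sqrrD expr1n mul1r.
  by rewrite lerD2r lerDl mulrn_wge0.
have nuh : fnorm b uhat = c * nu.
  rewrite uhE1 fnormZ// ger0_norm ?(ltW c0)//; congr (_ * _); rewrite /fnorm /nu; congr Num.sqrt.
  by rewrite (form_sqrD sb) bub t1E (formZr sb) but !mulr0 addr0 -t1E /y (fnorm_sqr hb).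
split; first by rewrite nuh mulr_gt0.
have -> : (fnorm b uhat)^-1 *: uhat - ubar = (nu^-1 - 1) *: ubar + nu^-1 *: t1.
  rewrite nuh uhE1 scalerA invfM mulrAC mulVf ?gt_eqF// mul1r scalerDr scalerBl scale1r.
  by rewrite addrAC.
have ni1 : nu^-1 <= 1 by rewrite invf_le1.
have ni0 : 0 <= nu^-1 by rewrite invr_ge0 ltW.
have ky : y <= k * fnorm a t1 by exact: emb.
have a1 : `|nu^-1 - 1| <= k * fnorm a t1.
  rewrite distrC ger0_norm ?subr_ge0// (le_trans _ ky)//.
  have h : nu * nu^-1 = 1 by rewrite mulfV// gt_eqF.
  have : (nu - 1) * nu^-1 <= nu - 1 by rewrite ler_piMr// subr_ge0.
  by rewrite mulrBl h mul1r; move: nuy; clra.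
have a2 : fnorm a ubar <= lam + 2.
  apply: fnorm_le; first by rewrite addr_ge0// ltW.
  rewrite -lbE (le_trans lb1)// sqrrD.
  by have := sqr_ge0 lam; move: lam0; rewrite mulr_natr -mulrnA; clra.
have a3 : fnorm a (nu^-1 *: t1) <= fnorm a t1.
  by rewrite fnormZ// ger0_norm// ler_piMl ?fnorm_ge0.
rewrite (le_trans (fnormD ha _ _))// fnormZ// -mulrA.
apply: (@le_trans _ _ ((1 + k * (lam + 2)) * fnorm a t1)); last first.
  by rewrite ler_pM2l// addr_gt0// mulr_gt0// addr_gt0.
have : `|nu^-1 - 1| * fnorm a ubar <= k * fnorm a t1 * (lam + 2) by rewrite ler_pM ?fnorm_ge0.
by move: a3; clra.
Qed.
End rayleigh.

(** * Distance to a trial space and the multilevel iteration *)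

Definition fdist (R : realType) (V : lmodType R) (a : V -> V -> R) (W : set V) (x : V) : R :=
  inf [set fnorm a (x - v) | v in W].

(** Compactness as an inequality of Ehrling type: up to [eps], [b] sees only finitely many bounded
    functionals. Averages over cells provide such functionals directly, and their Riesz representers
    are what a duality argument has to approximate. *)
Definition compact_embedding (R : realType) (V : lmodType R) (a b : V -> V -> R) : Prop :=
  forall eps : R, 0 < eps -> exists (m : nat) (l : 'I_m -> V -> R),
    [/\ forall i c u v, l i (c *: u + v) = c * l i u + l i v,
        exists K, forall i v, l i v ^+ 2 <= K * a v v &
        forall v, b v v <= eps * a v v + \sum_i l i v ^+ 2].

Section duality.
Context (R : realType) (V : lmodType R) (a : V -> V -> R) (ha : psd a).
Local Notation sa := ha.1.

Lemma fdist_lbound (W : set V) x : has_lbound [set fnorm a (x - v) | v in W].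
Proof. by exists 0 => _ [v _ <-]; exact: fnorm_ge0. Qed.

Lemma fdist_lt (W : set V) x (e : R) : W 0 -> fdist a W x < e ->
  exists2 v, W v & fnorm a (x - v) < e.
Proof.
move=> W0 h; have [||_ [v Wv <-] hv] := @inf_adherent _ [set fnorm a (x - v) | v in W] (e - fdist a W x).
- by rewrite subr_gt0.
- by split; [exists (fnorm a (x - 0)), 0|exact: fdist_lbound].
by exists v => //; move: hv; rewrite -/(fdist a W x) subrKC.
Qed.

Lemma fdist_le (W : set V) x v : W v -> fdist a W x <= fnorm a (x - v).
Proof. by move=> Wv; apply: ge_inf; [exact: fdist_lbound|exists v]. Qed.

Lemma fdist_projection (W : set V) x p : subspace W -> form_closure a W p ->
  (forall v, W v -> a (x - p) v = 0) -> fdist a W x = fnorm a (x - p).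
Proof.
move=> hW cp hp; apply/le_anti/andP; split.
  apply/ler_addgt0Pr => e e0.
  have [w Ww hw] := cp (e ^+ 2) ltac:(by rewrite exprn_gt0).
  rewrite (le_trans (fdist_le x Ww))// (le_trans (fnorm_dist3 ha x p w))// lerD2l.
  by apply: fnorm_le; exact: ltW.
apply: lb_le_inf => [|_ [w Ww <-]]; first by exists (fnorm a (x - 0)), 0 => //; exact: hW.1.
have app : a (x - p) p = 0.
  apply: (form_closure_eq0 ha (K := a (x - p) (x - p))) hp _ cp => [u v|v].
    by rewrite (formDr sa) (formNr sa).
  exact: form_CS.
rewrite /fnorm ler_wsqrtr//.
have -> : x - w = (x - p) + (p - w) by rewrite addrA subrK.
rewrite (form_sqrD sa (x - p) (p - w)) (formDr sa (x - p) p) (formNr sa) app (hp w)// subr0 mulr0 addr0.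
by rewrite lerDl ha.2.
Qed.

(* Aubin-Nitsche: the projection error is a-orthogonal to the trial space, so
   each functional of the compact embedding is small on it by duality. *)
Lemma aubin_nitsche b (th : R) : form_complete a -> compact_embedding a b -> 0 < th ->
  exists (m : nat) (g : 'I_m -> V) (del : R), 0 < del /\
  forall (W : set V) x p, subspace W -> form_closure a W p ->
    (forall v, W v -> a (x - p) v = 0) -> (forall i, fdist a W (g i) < del) ->
    b (x - p) (x - p) <= th ^+ 2 * a (x - p) (x - p).
Proof.
move=> cpl cpt th0.
have t2 : 0 < th ^+ 2 / 2 by rewrite divr_gt0// exprn_gt0.
have [m [l [hl [K lK] hb]]] := cpt _ t2.
(* The representers depend on [th] but not on the trial space. Only these finitely many functions
   have to be approximated, so pointwise convergence of the trial spaces is enough and no rate is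
   required. *)
have /choice[g hg] i : exists g, forall v, l i v = a g v.
  by apply: (riesz ha cpl (hl i) (lK i)).
pose del := Num.min 1 (th ^+ 2 / (2 * (m%:R + 1))).
have m1 : 0 < 2 * (m%:R + 1) :> R by rewrite mulr_gt0// ltr_wpDl.
have del0 : 0 < del by rewrite lt_min ltr01 divr_gt0// exprn_gt0.
exists m, g, del; split=> // W x p hW cp hp hd.
set r := x - p in hp *.
have lr i : l i r ^+ 2 <= del * a r r.
  have [v Wv /ltW hv] := fdist_lt hW.1 (hd i).
  have -> : l i r = a (g i - v) r by rewrite hg (formDl sa) (formNl sa) (formC sa v) hp// subr0.
  rewrite (le_trans (form_CS ha _ _))// ler_wpM2r ?ha.2// -(fnorm_sqr ha).
  have d1 : del <= 1 by rewrite ge_min lexx.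
  have : fnorm a (g i - v) ^+ 2 <= del ^+ 2 by rewrite lerXn2r// nnegrE ?fnorm_ge0// ltW.
  by move/le_trans; apply; rewrite expr2 ler_piMl// ltW.
rewrite (le_trans (hb r))//.
have h1 : \sum_(i < m) l i r ^+ 2 <= \sum_(i < m) del * a r r by exact: ler_sum.
have h2 : del * (2 * (m%:R + 1)) <= th ^+ 2 by rewrite -ler_pdivlMr// ge_min lexx orbT.
have h3 : (del * (2 * (m%:R + 1))) * a r r <= th ^+ 2 * a r r by rewrite ler_wpM2r// ha.2.
have h4 : 0 <= del * a r r by rewrite mulr_ge0 ?ha.2// ltW.
have h5 : \sum_(i < m) del * a r r = m%:R * (del * a r r) by rewrite sumr_const card_ord mulr_natl.
by move: h1; rewrite h5; move: h3 h4; clear; lra.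
Qed.
End duality.

(** * Induction over the mesh hierarchy *)

Section multilevel.
Context (R : realType) (V : lmodType R) (a b : V -> V -> R).
Context (ha : psd a) (hb : psd b) (Cp : R) (hCp : forall v, b v v <= Cp * a v v).
Context (Cp0 : 0 < Cp) (cpl : form_complete a) (cpt : compact_embedding a b).
Local Notation sa := ha.1. Local Notation sb := hb.1.
Context (lam gam : R) (e : V) (lam0 : 0 < lam) (gam0 : 0 < gam) (bee : b e e = 1).
Context (he : forall v, a e v = lam * b e v).
Context (gap : forall v, b e v = 0 -> gam * b v v <= a v v - lam * b v v).
Context (I : Type) (good : I -> Prop) (size : I -> R) (W : I -> set V).
Context (hW : forall T, subspace (W T)).
Context (happrox : forall w eps, 0 < eps -> exists2 h0 : R, 0 < h0 &
   forall T, good T -> size T < h0 -> fdist a (W T) w < eps).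
Context (B C : R) (B0 : 0 <= B) (C0 : 0 <= C).

(** This is [delta]: the eigenspace is the line of [e] up to null vectors, and [a e e = lam]
    accounts for the normalisation. *)
Let dlt T : R := fdist a (W T) e / Num.sqrt lam.

Definition multilevel_data n (T : nat -> I) (lm lambar lamhat : nat -> R)
    (u ubar uhat : nat -> V) : Prop :=
  [/\ forall k, (1 <= k <= n)%N -> [/\ W (T k) (ubar k), b (ubar k) (ubar k) = 1 &
        forall v, W (T k) v -> a (ubar k) v = lambar k * b (ubar k) v],
      ubar 1%N = u 1%N /\ lm 1%N = a (u 1%N) (u 1%N),
      forall k, (1 <= k < n)%N -> [/\ W (T k) `<=` W (T k.+1),
        dlt (T k) <= B * dlt (T k.+1) & fnorm a (ubar k - ubar k.+1) <= C * dlt (T k)] &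
      forall k, (1 <= k < n)%N ->
        [/\ W (T k.+1) (uhat k.+1),
            forall v, W (T k.+1) v -> a (uhat k.+1) v - lm k * b (uhat k.+1) v
              - lamhat k.+1 * b (u k) v = - (lm k * b (u k) v),
            b (uhat k.+1) (u k) = b (u k) (u k),
            u k.+1 = (fnorm b (uhat k.+1))^-1 *: uhat k.+1 &
            lm k.+1 = a (u k.+1) (u k.+1) / b (u k.+1) (u k.+1)]].

Let sq0 : 0 < Num.sqrt lam. Proof. by rewrite sqrtr_gt0. Qed.

Let dlt_ge0 T : 0 <= dlt T.
Proof.
apply: divr_ge0; last exact: sqrtr_ge0.
apply: lb_le_inf => [|_ [v _ <-]]; last exact: fnorm_ge0.
by exists (fnorm a (e - 0)), 0 => //; exact: (hW T).1.
Qed.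

Local Ltac clra := clear -ha hb hCp Cp0 cpl cpt lam0 gam0 bee he gap hW happrox B0 C0 sq0 dlt_ge0; lra.

(** The threshold is a finite minimum: one mesh size for [e] itself and one for each Riesz
    representer of the duality argument. *)
Lemma approximation_threshold (th rho : R) : 0 < th -> 0 < rho -> exists2 h0 : R, 0 < h0 &
  forall T, good T -> size T < h0 -> dlt T <= rho /\
    exists p, [/\ form_closure a (W T) p, forall v, W T v -> a (e - p) v = 0,
      b (e - p) (e - p) <= th ^+ 2 * a (e - p) (e - p) &
      fnorm a (e - p) = Num.sqrt lam * dlt T].
Proof.
move=> th0 rho0.
have [m [g [del [del0 hg]]]] := aubin_nitsche ha cpl cpt th0.
have [h1 h10 hh1] := happrox e (mulr_gt0 rho0 sq0).
have /choice[h2 hh2] i : exists h : R, 0 < h /\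
    forall T, good T -> size T < h -> fdist a (W T) (g i) < del.
  by have [h ? ?] := happrox (g i) del0; exists h.
exists (\big[Num.min/h1]_i h2 i).
  by apply: lt_bigmin => // i _; have [] := hh2 i.
move=> T gT sT; split.
  rewrite ler_pdivrMr// ltW// hh1// (lt_le_trans sT)// bigmin_le_id//.
have [p [cp hp]] := form_orthogonal_projection ha cpl (hW T) e.
exists p; split=> //.
  apply: (hg _ _ _ (hW T) cp hp) => i.
  by have [_] := hh2 i; apply=> //; rewrite (lt_le_trans sT)// bigmin_le_cond.
by rewrite /dlt (fdist_projection ha (hW T) cp hp) mulrC divfK// gt_eqF.
Qed.

(** Two invariants are propagated: [u k] is within order [dlt ^+ 3] of [ubar k], and [ubar k] is
    within [tau] of [e]. Quasi-optimality is available only under the second; in turn it improves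
    the distance to order [dlt], so that the move of size [C * dlt] to the next discrete eigenvector
    stays in the neighbourhood. *)
Lemma multilevel_near : exists h0 tau C9 : R, [/\ 0 < h0, 0 < tau, 0 < C9 &
  forall n T lm lambar lamhat u ubar uhat, (1 <= n)%N ->
    (forall k, (1 <= k <= n)%N -> good (T k) /\ size (T k) < h0) ->
    multilevel_data n T lm lambar lamhat u ubar uhat ->
    fnorm a (e - ubar 1%N) <= tau ->
    [/\ fnorm a (u n - ubar n) <= dlt (T n),
        `|lm n - lambar n| <= C9 * dlt (T n) ^+ 2,
        fnorm a (e - u n) <= 2 * Num.sqrt lam * dlt (T n),
        lam < 4 -> fnorm a (e - u n) <= 2 * dlt (T n) &
        `|lam - lm n| <= 4 * lam * dlt (T n) ^+ 2]].
Proof.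
have [K1 [tau1 [K10 tau10 approx]]] := eigen_approx ha hb hCp Cp0 lam0 gam0 bee he gap.
have [K2 [tau2 [K20 tau20 step]]] := rayleigh_step ha hb hCp Cp0 lam0 gam0 bee he gap.
pose x := Num.sqrt lam; have x0 : 0 < x by exact: sq0.
have xx : x ^+ 2 = lam by rewrite sqr_sqrtr ?ltW.
(* The final error will be at most [(x + eta) * dlt (T n)]. Here [eta <= x] gives the factor
   [2 * x], [eta <= 2 - x] the factor 2 when [lam < 4], and [eta <= 1] the first estimate. *)
pose eta := if lam < 4 then Num.min (Num.min x 1) (2 - x) else Num.min x 1.
have x2 : lam < 4 -> x < 2.
  by move=> l4; rewrite ltNge; apply/negP => h; move: l4; rewrite -xx; nra.
have eta0 : 0 < eta.
  by rewrite /eta; case: ifP => [/x2 h|_]; rewrite !lt_min x0 ltr01//= subr_gt0.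
have etax : eta <= x by rewrite /eta; case: ifP => _; rewrite !ge_min lexx.
have eta1 : eta <= 1 by rewrite /eta; case: ifP => _; rewrite !ge_min lexx !orbT.
have eta2 : lam < 4 -> eta <= 2 - x by move=> l4; rewrite /eta l4 !ge_min lexx !orbT.
(* Half of [eta] is spent on the discretisation error, as [x * kap], and half on the iteration
   error. *)
pose kap := Num.min 1 (eta / (2 * x)).
have kap0 : 0 < kap by rewrite lt_min ltr01 divr_gt0// mulr_gt0.
have kap1 : kap <= 1 by rewrite ge_min lexx.
have kapx : x * kap <= eta / 2.
  have : kap <= eta / (2 * x) by rewrite ge_min lexx orbT.
  by rewrite ler_pdivlMr ?mulr_gt0//; lra.
pose tau := Num.min tau1 tau2.
have tau0 : 0 < tau by rewrite lt_min tau10.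
pose th := kap / (2 * K1); have th0 : 0 < th by rewrite divr_gt0// mulr_gt0.
(* [M] bounds the distance from [u k] to the next discrete eigenvector in units of [dlt (T k.+1)];
   the [+ 1] keeps it positive. *)
pose M := (1 + C) * B + 1; have M0 : 0 < M by rewrite ltr_wpDl// mulr_ge0// addr_ge0.
have M30 : 0 < K2 * M ^+ 3 by rewrite mulr_gt0// exprn_gt0.
(* [rho2] keeps the iteration error below [eta / 2 * dlt], [rho3] makes the higher-order term of
   quasi-optimality fit into [kap], and [rho4] keeps all vectors within [tau]. *)
pose rho := Num.min (Num.min 1 (eta / (2 * (K2 * M ^+ 3))))
  (Num.min (kap / (2 * K1 * x)) (tau / (1 + C + 2 * x))).
have cx : 0 < 1 + C + 2 * x by rewrite addr_gt0// ?mulr_gt0// ltr_wpDr.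
have rho0 : 0 < rho by rewrite !lt_min ltr01 !divr_gt0// !mulr_gt0.
have rho1 : rho <= 1 by rewrite !ge_min lexx.
have rho2 : K2 * M ^+ 3 * rho <= eta / 2.
  have : rho <= eta / (2 * (K2 * M ^+ 3)) by rewrite !ge_min lexx !orbT.
  by rewrite ler_pdivlMr ?mulr_gt0//; move: (K2 * M ^+ 3) => y; clra.
have rho3 : K1 * (x * rho) <= kap / 2.
  have : rho <= kap / (2 * K1 * x) by rewrite !ge_min lexx !orbT.
  by rewrite ler_pdivlMr ?mulr_gt0//; clra.
have rho4 : (1 + C + 2 * x) * rho <= tau by rewrite mulrC -ler_pdivlMr// !ge_min lexx !orbT.
have [h0 h00 hh0] := approximation_threshold th0 rho0.
exists h0, tau, (1 + (x + tau) ^+ 2 * Cp); split=> //.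
  by rewrite addr_gt0// mulr_gt0// exprn_gt0// addr_gt0.
move=> n T lm lambar lamhat u ubar uhat n1 hT [hbar [hub1 hlm1] hnest hstep] hstart.
have hd k : (1 <= k <= n)%N -> dlt (T k) <= rho.
  by move=> /hT[gT sT]; have [] := hh0 _ gT sT.
have hquasi k : (1 <= k <= n)%N -> fnorm a (e - ubar k) <= tau ->
    fnorm a (e - ubar k) <= (x + x * kap) * dlt (T k).
  move=> kn hk; have [gT sT] := hT k kn; have [hdk [p [cp hp bp Dp]]] := hh0 _ gT sT.
  have [Wk bk ek] := hbar k kn.
  have ht1 : fnorm a (e - ubar k) <= tau1 by rewrite (le_trans hk)// ge_min lexx.
  have := approx _ _ _ _ _ cp (hW _) hp (ltW th0) bp Wk bk ek ht1.
  move=> /le_trans; apply; rewrite Dp -/x.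
  have h1 : K1 * ((th + x * dlt (T k)) * (x * dlt (T k))) <= kap * (x * dlt (T k)).
    rewrite [leLHS]mulrA ler_wpM2r//; first exact: mulr_ge0 (ltW x0) (dlt_ge0 _).
    have h2 : K1 * (x * dlt (T k)) <= K1 * (x * rho) by rewrite !ler_pM2l.
    have h3 : K1 * th = kap / 2 by rewrite /th; field; rewrite gt_eqF.
    by rewrite mulrDr h3; move: h2 rho3; clra.
  have -> : (x + x * kap) * dlt (T k) = x * dlt (T k) + kap * (x * dlt (T k)) by ring.
  by rewrite lerD2l.
have main k : (1 <= k <= n)%N ->
  [/\ W (T k) (u k), b (u k) (u k) = 1, lm k = a (u k) (u k),
      fnorm a (u k - ubar k) <= K2 * M ^+ 3 * dlt (T k) ^+ 3 & fnorm a (e - ubar k) <= tau].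
  elim: k => [//|k IH] kn; have [->|k1] := eqVneq k 0%N.
    have [W1 b1 _] := hbar 1%N n1; rewrite -hub1 hlm1 -hub1; split=> //.
    by rewrite subrr /fnorm (form0l sa) sqrtr0; exact: mulr_ge0 (ltW M30) (exprn_ge0 3 (dlt_ge0 _)).
  have kn' : (1 <= k < n)%N by rewrite lt0n k1; move: kn.
  have kn2 : (1 <= k <= n)%N by case/andP: kn' => -> /ltnW.
  have {IH}[Wu bu lmk huk hek] := IH kn2.
  have [nest dB hC] := hnest k kn'.
  have [Wh hh1 hh2 uE lmE] := hstep k kn'.
  have [Wb bb eb] := hbar _ kn.
  have dk := hd k kn2; have d0 := dlt_ge0 (T k).
  have hek2 : fnorm a (e - ubar k.+1) <= tau.
    rewrite (le_trans (fnorm_dist3 ha _ (ubar k) _))//.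
    have h1 := hquasi k kn2 hek.
    have h2 : x * kap <= x by rewrite ler_piMr// ltW.
    have h3 : (x + x * kap) * dlt (T k) <= (2 * x) * dlt (T k) by rewrite ler_wpM2r//; move: h2; clra.
    have h4 : (1 + C + 2 * x) * dlt (T k) <= (1 + C + 2 * x) * rho by rewrite ler_pM2l.
    by move: h1 h3 h4 rho4 hC d0; rewrite !mulrDl; clra.
  have huk1 : fnorm a (u k - ubar k) <= dlt (T k).
    rewrite (le_trans huk)//.
    have h1 : dlt (T k) ^+ 3 <= rho * dlt (T k).
      have h2 : dlt (T k) ^+ 2 <= rho.
        by rewrite expr2 (le_trans _ dk)// ler_piMr// (le_trans dk).
      by rewrite exprSr ler_wpM2r.
    rewrite (@le_trans _ _ (K2 * M ^+ 3 * (rho * dlt (T k))))//; first by rewrite ler_pM2l.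
    rewrite mulrA ler_piMl// (le_trans rho2)//; move: eta1; clra.
  have heps : fnorm a (u k - ubar k.+1) <= (1 + C) * dlt (T k).
    by rewrite (le_trans (fnorm_dist3 ha _ (ubar k) _))// mulrDl mul1r lerD.
  have heps2 : fnorm a (u k - ubar k.+1) <= tau2.
    rewrite (le_trans heps)// (@le_trans _ _ tau)//; last by rewrite ge_min lexx orbT.
    rewrite (le_trans _ rho4)// ler_pM ?addr_ge0//.
    by rewrite lerDl mulr_ge0// ltW.
  have ht1 : fnorm a (e - ubar k.+1) <= tau2 by rewrite (le_trans hek2)// ge_min lexx orbT.
  have hh1' v : W (T k.+1) v -> a (uhat k.+1) v - a (u k) (u k) * b (uhat k.+1) v -
      lamhat k.+1 * b (u k) v = - (a (u k) (u k) * b (u k) v) by rewrite -lmk; exact: hh1.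
  rewrite bu in hh2.
  have [nb0 hst] := step _ _ _ _ _ _ (hW _) (nest _ Wu) bu Wb bb eb Wh hh1' hh2 ht1 heps2.
  have bu1 : b (u k.+1) (u k.+1) = 1.
    by rewrite uE (formZl sb) (formZr sb) -(fnorm_sqr hb); field; rewrite gt_eqF.
  split=> //.
  - by rewrite uE -[_ *: _]addr0; apply: (hW _).2 => //; exact: (hW _).1.
  - by rewrite lmE bu1 divr1.
  rewrite uE (le_trans hst)// -mulrA ler_pM2l// -exprMn.
  rewrite lerXn2r// ?nnegrE ?fnorm_ge0//; first exact: mulr_ge0 (ltW M0) (dlt_ge0 _).
  rewrite (le_trans heps)//.
  have h1 : (1 + C) * dlt (T k) <= (1 + C) * (B * dlt (T k.+1)) by rewrite ler_wpM2l// addr_ge0.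
  by rewrite (le_trans h1)// /M mulrA ler_wpM2r ?dlt_ge0// lerDl.
have nn : (1 <= n <= n)%N by rewrite n1 leqnn.
have [Wu bu lmn hun hen] := main n nn.
have [Wb bb eb] := hbar n nn.
have d0 := dlt_ge0 (T n); have dr := hd n nn.
have hun2 : fnorm a (u n - ubar n) <= eta / 2 * dlt (T n).
  rewrite (le_trans hun)//.
  have h1 : dlt (T n) ^+ 3 <= rho * dlt (T n).
    have h2 : dlt (T n) ^+ 2 <= rho.
      by rewrite expr2 (le_trans _ dr)// ler_piMr// (le_trans dr).
    by rewrite exprSr ler_wpM2r.
  rewrite (@le_trans _ _ (K2 * M ^+ 3 * (rho * dlt (T n))))//; first by rewrite ler_pM2l.
  by rewrite mulrA ler_wpM2r.
have hun3 : fnorm a (u n - ubar n) <= dlt (T n).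
  by rewrite (le_trans hun2)// ler_piMl//; move: eta1; clra.
have err : fnorm a (e - u n) <= (x + eta) * dlt (T n).
  rewrite (le_trans (fnorm_dist3 ha _ (ubar n) _))// (fnormBC ha (ubar n)).
  have h1 := hquasi n nn hen.
  have h2 : (x + x * kap) * dlt (T n) <= (x + eta / 2) * dlt (T n) by rewrite ler_wpM2r// lerD2l.
  by move: h1 h2 hun2; rewrite !mulrDl; clra.
have err2 : fnorm a (e - u n) <= 2 * x * dlt (T n).
  by rewrite (le_trans err)// ler_wpM2r//; move: etax; clra.
have lray := @rayleigh_ge R V a b ha hb lam gam e gam0 bee he gap.
split=> //.
(* [lambar n] is the squared a-norm of [ubar n], which stays within [tau] of [e]; this makes [C9]
   independent of the mesh. *)
- have fu : fnorm a (ubar n) <= x + tau.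
    have -> : ubar n = e - (e - ubar n) by rewrite opprB addrC subrK.
    rewrite (le_trans (fnormB ha _ _))// lerD//.
    by rewrite /fnorm he bee mulr1.
  have lbE : lambar n = fnorm a (ubar n) ^+ 2 by rewrite (fnorm_sqr ha) eb// bb mulr1.
  have lb0 : 0 <= lambar n by rewrite lbE sqr_ge0.
  have lb1 : lambar n <= (x + tau) ^+ 2.
    by rewrite lbE lerXn2r// nnegrE ?fnorm_ge0// addr_ge0 ?(ltW x0) ?(ltW tau0).
  have hsub v : v = ubar n \/ v = u n -> a (ubar n) v = lambar n * b (ubar n) v.
    by case=> ->; exact: eb.
  have := @shifted_form_perturb R V a b ha hb (lambar n) (ubar n) (u n) hsub.
  rewrite bu -lmn mulr1 => <-.
  have ad : a (u n - ubar n) (u n - ubar n) <= dlt (T n) ^+ 2.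
    by rewrite -(fnorm_sqr ha) lerXn2r// nnegrE fnorm_ge0.
  have bd : lambar n * b (u n - ubar n) (u n - ubar n) <= (x + tau) ^+ 2 * Cp * dlt (T n) ^+ 2.
    rewrite -mulrA ler_pM ?hb.2// (le_trans (hCp _))// ler_pM2l//.
  have ad0 := ha.2 (u n - ubar n); have bd0 := mulr_ge0 lb0 (hb.2 (u n - ubar n)).
  have h1 : 0 <= (x + tau) ^+ 2 * Cp * dlt (T n) ^+ 2 by exact: le_trans bd.
  rewrite mulrDl mul1r ler_norml; apply/andP.
  by split; move: ad bd ad0 bd0 h1 (sqr_ge0 (dlt (T n))); clra.
- move=> l4; rewrite (le_trans err)// ler_wpM2r//.
  by move: (eta2 l4); clra.
have lml : lam <= lm n by have := lray (u n); rewrite bu mulr1 -lmn.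
have hsub v : v = e \/ v = u n -> a e v = lam * b e v by [].
have := @shifted_form_perturb R V a b ha hb lam e (u n) hsub.
rewrite bu -lmn mulr1 => h1.
(* [4 * lam] is the square of the factor [2 * x] in the eigenvector estimate. *)
have ad : a (u n - e) (u n - e) <= 4 * lam * dlt (T n) ^+ 2.
  rewrite -(fnorm_sqr ha) fnormBC// -xx.
  have -> : 4 * x ^+ 2 * dlt (T n) ^+ 2 = (2 * x * dlt (T n)) ^+ 2 by ring.
  by rewrite lerXn2r// nnegrE ?fnorm_ge0//; exact: le_trans (fnorm_ge0 a _) err2.
rewrite distrC ger0_norm ?subr_ge0// -h1 (le_trans _ ad)// gerBl mulr_ge0 ?hb.2// ltW//.
Qed.

(** If the coarse eigenvector is near [- e], all vectors are negated: the scheme is odd, its scalars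
    do not change, and the case reduces to the other one. *)
Lemma multilevel : exists h0 C9 : R, [/\ 0 < h0, 0 < C9 &
  forall n T lm lambar lamhat u ubar uhat, (1 <= n)%N ->
    (forall k, (1 <= k <= n)%N -> good (T k) /\ size (T k) < h0) ->
    multilevel_data n T lm lambar lamhat u ubar uhat ->
    (forall v, b (u 1%N) v = 0 -> 0 <= a v v - lm 1%N * b v v) ->
    [/\ fnorm a (u n - ubar n) <= dlt (T n),
        `|lm n - lambar n| <= C9 * dlt (T n) ^+ 2,
        `|lam - lm n| <= 4 * lam * dlt (T n) ^+ 2 &
        exists2 e', e' = e \/ e' = - e &
          fnorm a (e' - u n) <= 2 * Num.sqrt lam * dlt (T n) /\
          (lam < 4 -> fnorm a (e' - u n) <= 2 * dlt (T n))]].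
Proof.
have [h0 [tau [C9 [h00 tau0 C90 near]]]] := multilevel_near.
have [del del0 start] := rayleigh_start ha hb hCp Cp0 lam0 gam0 bee he gap tau0.
have [h1 h10 hh1] := happrox e del0.
exists (Num.min h0 h1), C9; split=> //; first by rewrite lt_min h00.
move=> n T lm lambar lamhat u ubar uhat n1 hT hdata hco.
have hT0 k : (1 <= k <= n)%N -> good (T k) /\ size (T k) < h0.
  by move=> /hT[gT]; rewrite lt_min => /andP[].
have [hbar [hub1 hlm1] hnest hstep] := hdata.
have [W1 b1 e1] := hbar 1%N n1.
have [v0 Wv0 /ltW hv0] : exists2 v, W (T 1%N) v & fnorm a (e - v) < del.
  apply: (fdist_lt (hW _).1); have [gT sT] := hT 1%N n1; apply: hh1 => //.
  by move: sT; rewrite lt_min => /andP[].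
have e1' v : W (T 1%N) v -> a (ubar 1%N) v = a (ubar 1%N) (ubar 1%N) * b (ubar 1%N) v.
  by move=> Wv; rewrite (e1 _ W1) b1 mulr1 e1.
rewrite -hub1 hlm1 -hub1 in hco.
have [hs|hs] := start _ _ _ (hW _) Wv0 hv0 W1 b1 e1' hco.
  have [c1 c2 c3 c4 c5] := near _ _ _ _ _ _ _ _ n1 hT0 hdata hs.
  by split=> //; exists e => //; left.
pose neg (f : nat -> V) k := - f k.
have negE := (formNl, formNr, opprK).
have hdata' : multilevel_data n T lm lambar lamhat (neg u) (neg ubar) (neg uhat).
  split=> [k kn||k kn|k kn].
  - have [Wk bk ek] := hbar k kn; rewrite /neg; split.
    + by rewrite -scaleN1r -[_ *: _]addr0; apply: (hW _).2 => //; exact: (hW _).1.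
    + by rewrite (formNl sb) (formNr sb) opprK.
    + by move=> v Wv; rewrite (formNl sb) (formNl sa) ek// mulrN.
  - by rewrite /neg hub1 (formNl sa) (formNr sa) opprK.
  - have [h2 h3 h4] := hnest k kn; split=> //.
    by rewrite /neg opprK addrC (fnormBC ha).
  have [h2 h3 h4 h5 h6] := hstep k kn; rewrite /neg; split.
  - by rewrite -scaleN1r -[_ *: _]addr0; apply: (hW _).2 => //; exact: (hW _).1.
  - move=> v Wv; have := h3 v Wv; rewrite !(formNl sa) !(formNl sb); lra.
  - by rewrite !(formNl sb) !(formNr sb) !opprK.
  - by rewrite h5 fnormN// scalerN.
  - by rewrite !(formNl sa) !(formNl sb) !(formNr sa) !(formNr sb) !opprK.
have hs' : fnorm a (e - neg ubar 1%N) <= tau.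
  by rewrite /neg opprK -fnormN// opprD.
have [c1 c2 c3 c4 c5] := near _ _ _ _ _ _ _ _ n1 hT0 hdata' hs'.
have E1 : fnorm a (u n - ubar n) = fnorm a (neg u n - neg ubar n).
  by rewrite -fnormN// opprB /neg opprK addrC.
have E2 : fnorm a (- e - u n) = fnorm a (e - neg u n).
  by rewrite -fnormN// opprB /neg !opprK addrC.
by split; rewrite ?E1//; exists (- e); [right|rewrite E2].
Qed.
End multilevel.

(** * Square integrable functions *)

Section subspace_lmod.
Context (R : realType) (E : lmodType R) (H : set E) (hH : subspace H).

(** The proof of [subspace H] is an argument so that the closure instance can be attached to the
    predicate itself. *)
Definition submod_pred of subspace H : {pred E} := [pred x | `[< H x >]].

Let submod_closed_pred : submod_closed (submod_pred hH).
Proof.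
split=> [|c u v]; rewrite !inE; first exact: hH.1.
exact: hH.2.
Qed.

HB.instance Definition _ := GRing.isSubmodClosed.Build R E (submod_pred hH) submod_closed_pred.

Record submod : Type := Submod { submod_val : E; _ : submod_val \in submod_pred hH }.
HB.instance Definition _ := [isSub for submod_val].
HB.instance Definition _ := [Choice of submod by <:].
HB.instance Definition _ := [SubChoice_isSubLmodule of submod by <:].

Lemma submodP (x : submod) : H (submod_val x).
Proof. by case: x => x /=; rewrite inE. Qed.

Lemma submod_ex x : H x -> exists y : submod, submod_val y = x.
Proof. move=> Hx; have h : x \in submod_pred hH by rewrite inE; exact: Hx.
by exists (Submod h). Qed.

Lemma submod_valP (c : R) (x y : submod) : submod_val (c *: x + y) = c *: submod_val x + submod_val y.
Proof. by []. Qed.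

Lemma submod_val0 : submod_val 0 = 0. Proof. by []. Qed.
Lemma submod_valB (x y : submod) : submod_val (x - y) = submod_val x - submod_val y.
Proof. by []. Qed.

Definition on_submod (q : E -> E -> R) (u v : submod) := q (submod_val u) (submod_val v).

(** Linearity is asked on [H] only: outside the function space, integrals and chosen weak
    derivatives take default values and linearity may fail. *)
Lemma psd_submod (q : E -> E -> R) : (forall u v, q u v = q v u) ->
  (forall c u v w, H u -> H v -> H w -> q (c *: u + v) w = c * q u w + q v w) ->
  (forall v, 0 <= q v v) -> psd (on_submod q).
Proof.
move=> qC ql q0; split=> [|v]; last exact: q0.
split=> [u v|c u v w]; first exact: qC.
by rewrite /on_submod submod_valP ql//; exact: submodP.
Qed.
End subspace_lmod.

Section square_integrable.
Context d (T : measurableType d) (R : realType) (mu : {measure set T -> \bar R}).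
Context (D : set T) (mD : measurable D).
Implicit Types f g h : T -> R.

(** Over Lebesgue measure this unfolds to [L2], and the two are used interchangeably. *)
Definition sqint f := measurable_fun D (f : T -> measurableTypeR R) /\
  mu.-integrable D (fun x => (f x ^+ 2)%:E).

Definition ip f g : R := \int[mu]_(x in D) (f x * g x).

Lemma le_integrable_real f g : measurable_fun D (f : T -> measurableTypeR R) ->
  (forall x, D x -> `|f x| <= g x) -> mu.-integrable D (EFin \o g) ->
  mu.-integrable D (EFin \o f).
Proof.
move=> mf fg; apply: le_integrable => //; first exact/measurable_EFinP.
by move=> x Dx; rewrite /= lee_fin (le_trans (fg x Dx))// ler_norm.
Qed.

Lemma sqint_integrableM f g : sqint f -> sqint g ->
  mu.-integrable D (EFin \o (fun x => f x * g x)).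
Proof.
move=> [mf if2] [mg ig2].
apply: (@le_integrable_real _ (fun x => f x ^+ 2 + g x ^+ 2)).
- exact: measurable_funM.
- move=> x _; rewrite normrM; have := sqr_ge0 (`|f x| - `|g x|).
  rewrite sqrrB !real_normK ?num_real// => h.
  have := normr_ge0 (f x); have := normr_ge0 (g x) => h1 h2.
  by have := mulr_ge0 h2 h1; lra.
- by apply: eq_integrable (integrableD mD if2 ig2) => //.
Qed.

Lemma sqint_lin (c : R) f g : sqint f -> sqint g -> sqint (fun x => c * f x + g x).
Proof.
move=> Hf Hg; have [mf if2] := Hf; have [mg ig2] := Hg; split.
  by apply: measurable_funD => //; exact: measurable_funM.
have h1 := integrableZl mD (c ^+ 2) if2.
have h2 := integrableZl mD (2 * c) (sqint_integrableM Hf Hg).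
apply: eq_integrable (integrableD mD (integrableD mD h1 h2) ig2) => // x _ /=.
rewrite -!EFinM -!EFinD; congr EFin; ring.
Qed.

Lemma sqint0 : sqint (fun=> 0).
Proof.
split; first exact: measurable_cst.
by under eq_fun do rewrite expr0n; exact: integrable0.
Qed.

Lemma sqintN f : sqint f -> sqint (fun x => - f x).
Proof.
move=> [mf i2]; split; first exact: measurableT_comp.
by under eq_fun do rewrite sqrrN.
Qed.

Lemma sqintD f g : sqint f -> sqint g -> sqint (fun x => f x + g x).
Proof.
by move=> Hf Hg; have := sqint_lin 1 Hf Hg; under eq_fun do rewrite mul1r.
Qed.

Lemma sqintB f g : sqint f -> sqint g -> sqint (fun x => f x - g x).
Proof. by move=> Hf Hg; exact: sqintD Hf (sqintN Hg). Qed.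

Lemma ipC f g : ip f g = ip g f.
Proof. by apply: eq_Rintegral => x _; rewrite mulrC. Qed.

Lemma ip_ge0 f : 0 <= ip f f.
Proof. by apply: Rintegral_ge0 => x _; rewrite -expr2 sqr_ge0. Qed.

Lemma ip_lin c f g h : sqint f -> sqint g -> sqint h ->
  ip (fun x => c * f x + g x) h = c * ip f h + ip g h.
Proof.
move=> Hf Hg Hh; rewrite /ip -RintegralZl//; last exact: sqint_integrableM.
rewrite -RintegralD//; last 2 first.
- apply: eq_integrable (integrableZl mD c (sqint_integrableM Hf Hh)) => //.
- exact: sqint_integrableM.
by apply: eq_Rintegral => x _; ring.
Qed.

Lemma ip_linE c f g h : sqint f -> sqint g -> sqint h ->
  ip (c *: f + g) h = c * ip f h + ip g h.
Proof. exact: ip_lin. Qed.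

Lemma ae_eq_Rintegral f g : measurable_fun D (f : T -> measurableTypeR R) ->
  measurable_fun D (g : T -> measurableTypeR R) ->
  {ae mu, forall x, D x -> f x = g x} -> \int[mu]_(x in D) f x = \int[mu]_(x in D) g x.
Proof.
move=> mf mg fg; congr fine; apply: ae_eq_integral => //.
- exact/measurable_EFinP.
- exact/measurable_EFinP.
by apply: filterS fg => x h Dx; rewrite h.
Qed.

Lemma ip_ae_eq f f' g : sqint f -> sqint f' -> sqint g ->
  {ae mu, forall x, D x -> f x = f' x} -> ip f g = ip f' g.
Proof.
move=> Hf Hf' Hg ff'; apply: ae_eq_Rintegral.
- by apply: measurable_funM => //; [exact: Hf.1|exact: Hg.1].
- by apply: measurable_funM => //; [exact: Hf'.1|exact: Hg.1].
by apply: filterS ff' => x h Dx; rewrite h.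
Qed.

Lemma sqint_subspace : subspace (sqint : set (T -> R)).
Proof. by split=> [|c u v]; [exact: sqint0|exact: sqint_lin]. Qed.

Lemma ip_CS f g : sqint f -> sqint g -> ip f g ^+ 2 <= ip f f * ip g g.
Proof.
move=> Hf Hg.
have hq : psd (on_submod (hH := sqint_subspace) ip).
  by apply: psd_submod; [exact: ipC|exact: ip_linE|exact: ip_ge0].
have [f' <-] := submod_ex sqint_subspace Hf.
have [g' <-] := submod_ex sqint_subspace Hg.
exact: form_CS hq f' g'.
Qed.

Lemma sqint_integral f : sqint f ->
  (\int[mu]_(x in D) (f x ^+ 2)%:E)%E = (ip f f)%:E.
Proof.
move=> [mf i2]; rewrite -[LHS]fineK; last exact: integrable_fin_num.
by congr (EFin (fine _)); apply: eq_integral => x _; rewrite expr2.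
Qed.
End square_integrable.

(** * Completeness of L2 *)

(** An increment [h] satisfies [|h| <= 2 ^+ k * h ^+ 2 + 2^-1 ^+ k], so the increments are
    absolutely summable. Sums of squares are preferred because they integrate to L2 norms. *)
Lemma weighted_increments_cvg (R : realType) (g : nat -> R) (M : R) :
  (forall n, \sum_(0 <= k < n) 2 ^+ k * (g k.+1 - g k) ^+ 2 <= M) -> cvgn g.
Proof.
move=> hM.
have gE : g = (fun n => g 0%N + series (telescope g) n).
  by apply/funext => n; rewrite [LHS](eq_sum_telescope g n).
rewrite gE; apply: is_cvgD; first exact: is_cvg_cst.
apply: normed_cvg; apply: nondecreasing_is_cvgn.
  by apply: nondecreasing_series => n _ _; exact: normr_ge0.
have geo n : \sum_(0 <= k < n) (2^-1 : R) ^+ k <= 2.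
  elim: n => [|n IH]; first by rewrite big_nil.
  by rewrite big_nat_recl// expr0; under eq_bigr do rewrite exprS; rewrite -big_distrr/=; lra.
exists (M + 2) => _ [n _ <-]; rewrite /normed_series_of/= /series/=.
apply: (@le_trans _ _ (\sum_(0 <= k < n) (2 ^+ k * (g k.+1 - g k) ^+ 2 + 2^-1 ^+ k))).
  apply: ler_sum => k _; rewrite /telescope/=.
  set h := g k.+1 - g k; have := sqr_ge0 (2 ^+ k * `|h| - 1).
  have p : 0 < 2 ^+ k :> R by rewrite exprn_gt0.
  rewrite -[h ^+ 2]real_normK ?num_real// exprVn => h1.
  rewrite -(ler_pM2l p) mulrDr mulfV ?gt_eqF//.
  by have := mulr_ge0 (ltW p) (normr_ge0 h); nra.
by rewrite big_split/= lerD.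
Qed.

Section L2_complete.
Context d (T : measurableType d) (R : realType) (mu : {measure set T -> \bar R}).
Context (D : set T) (mD : measurable D).

(** Riesz-Fischer: along a fast subsequence the weighted sum [G] is integrable, hence finite almost
    everywhere, which gives convergence almost everywhere; Fatou's lemma then upgrades it to
    convergence in norm of the whole sequence. *)
Lemma L2_complete (f : nat -> T -> R) : (forall n, sqint mu D (f n)) ->
  (forall e : R, 0 < e -> exists N, forall m n, (N <= m)%N -> (N <= n)%N ->
     ip mu D (fun x => f m x - f n x) (fun x => f m x - f n x) < e) ->
  exists2 g, sqint mu D g & forall e : R, 0 < e -> exists N, forall n, (N <= n)%N ->
     ip mu D (fun x => f n x - g x) (fun x => f n x - g x) < e.
Proof.
move=> Lf cf.
(* The factor [2 ^+ k] pays for the weight in [G], and [2 ^+ k.+1] makes the integrated series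
   summable. *)
pose w (k : nat) : R := (2 ^+ k * 2 ^+ k.+1)^-1.
have w0 k : 0 < w k by rewrite invr_gt0 mulr_gt0// exprn_gt0.
have /choice[N hN] k := cf (w k) (w0 k).
pose phi := fix phi k := if k is k'.+1 then maxn (phi k').+1 (N k) else N 0%N.
have phiN k : (N k <= phi k)%N by case: k => [|k] //=; rewrite leq_maxr.
have phiS k : (phi k < phi k.+1)%N by rewrite /= leq_maxl.
have phik k : (k <= phi k)%N.
  by elim: k => [//|k IH]; exact: leq_ltn_trans IH (phiS k).
pose h k x := f (phi k.+1) x - f (phi k) x.
have Lh k : sqint mu D (h k) by exact: sqintB.
have ih k : ip mu D (h k) (h k) <= w k.
  by apply/ltW/hN => //; rewrite (leq_trans (phiN k))// ltnW.
pose G x := (\sum_(k <oo) (2 ^+ k * h k x ^+ 2)%:E)%E.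
have p2 k : 0 < 2 ^+ k :> R by rewrite exprn_gt0.
have mh k : measurable_fun D (fun x => (2 ^+ k * h k x ^+ 2)%:E).
  apply/measurable_EFinP; apply: measurable_funM => //.
  by apply: measurable_funX; exact: (Lh k).1.
have h0 k x : (0 <= (2 ^+ k * h k x ^+ 2)%:E)%E by rewrite lee_fin mulr_ge0 ?sqr_ge0// ltW.
have iG : (\int[mu]_(x in D) G x < +oo)%E.
  rewrite /G integral_nneseries//.
  apply: (@le_lt_trans _ _ (\sum_(k <oo) (1 / (2 ^ k.+1)%:R)%:E)%E); last first.
    by apply: le_lt_trans (epsilon_trick0 xpredT ler01) (ltry _).
  apply: lee_nneseries => [k _ _|k _]; first exact: integral_ge0.
  under eq_integral do rewrite EFinM.
  rewrite ge0_integralZl_EFin//; last 2 first.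
  - by move=> x _; rewrite lee_fin sqr_ge0.
  - by apply/measurable_EFinP/measurable_funX; exact: (Lh k).1.
  rewrite (sqint_integral mD)// -EFinM lee_fin.
  apply: (@le_trans _ _ (2 ^+ k * w k)); first by rewrite ler_pM2l// ih.
  by rewrite /w invfM mulrA mulfV ?gt_eqF// natrX.
have mG : measurable_fun D G by apply: ge0_emeasurable_sum => // k x Dx _.
have G0 x : (0 <= G x)%E by apply: nneseries_ge0 => k _ _; exact: h0.
have aeG : {ae mu, forall x, D x -> G x \is a fin_num}.
  apply: integrable_ae => //; apply/integrableP; split=> //.
  by under eq_integral do rewrite gee0_abs//.
have aecvg : {ae mu, forall x, D x -> cvgn (fun k => f (phi k) x)}.
  apply: filterS aeG => x Gx Dx; apply: (@weighted_increments_cvg _ _ (fine (G x))) => n.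
  rewrite -lee_fin fineK ?Gx// -sumEFin.
  by apply: (@nneseries_lim_ge _ (fun k => (2 ^+ k * h k x ^+ 2)%:E) xpredT 0 n) => k _ _; exact: h0.
(* The upper limit is measurable on all of [D], so no exceptional set has to be cut out. *)
pose g x := fine (limn_esup (fun k => (f (phi k) x)%:E)).
have mg : measurable_fun D (g : T -> measurableTypeR R).
  apply: (@measurableT_comp _ _ _ _ _ _ fine) => //.
  apply: measurable_fun_limn_esup => k; apply/measurable_EFinP; exact: (Lf _).1.
have gE x : cvgn (fun k => f (phi k) x) -> (fun k => f (phi k) x) @ \oo --> g x.
  move=> cx; have /cvg_limn_einf_sup[_] : (fun k => (f (phi k) x)%:E) @ \oo --> (limn (fun k => f (phi k) x))%:E.
    by apply: cvg_EFin => //; exact: nearW.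
  by rewrite /g => ->.
have key n (e : R) : 0 < e -> (forall m, (n <= m)%N ->
     ip mu D (fun x => f n x - f m x) (fun x => f n x - f m x) <= e) ->
   (\int[mu]_(x in D) ((f n x - g x) ^+ 2)%:E <= e%:E)%E.
  move=> e0 hn.
  have mfk k : measurable_fun D (fun x => ((f n x - f (phi k) x) ^+ 2)%:E).
    by apply/measurable_EFinP/measurable_funX/measurable_funB; exact: (Lf _).1.
  apply: (@le_trans _ _ (\int[mu]_(x in D) limn_einf (fun k => ((f n x - f (phi k) x) ^+ 2)%:E))%E).
    apply: ae_ge0_le_integral => //.
    - by move=> x _; rewrite lee_fin sqr_ge0.
    - by apply/measurable_EFinP/measurable_funX/measurable_funB => //; exact: (Lf _).1.
    - move=> x _; rewrite limn_einf_lim; apply: lime_ge; first exact: is_cvg_einfs.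
      by apply: nearW => k; apply: le_ereal_inf_tmp => _ [m _ <-]; rewrite lee_fin sqr_ge0.
    - apply: measurableT_comp => //; apply: measurable_fun_limn_esup => k.
      exact: measurableT_comp.
    apply: filterS aecvg => x cx Dx.
    have : (fun k => ((f n x - f (phi k) x) ^+ 2)%:E) @ \oo --> ((f n x - g x) ^+ 2)%:E.
      apply: cvg_EFin; first exact: nearW.
      rewrite [X in X @ _ --> _](_ : _ = (fun k => (f n x - f (phi k) x) * (f n x - f (phi k) x))); last first.
        by apply/funext => k; rewrite /= expr2.
      by rewrite expr2; apply: cvgM; apply: cvgB; [exact: cvg_cst|exact/gE/cx|exact: cvg_cst|exact/gE/cx].
    by move/cvg_limn_einf_sup => [-> _].
  apply: (le_trans (fatou _ _ _ _)) => //.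
    by move=> k x _; rewrite lee_fin sqr_ge0.
  rewrite limn_einf_lim; apply: lime_le; first exact: is_cvg_einfs.
  (* The infimum over a tail is bounded by its single term [maxn n k], whose index in the original
     sequence is at least [n]. *)
  apply: nearW => k; apply: ereal_inf_le; exists (\int[mu]_(x in D) ((f n x - f (phi (maxn n k)) x) ^+ 2)%:E)%E.
    by exists (maxn n k) => //=; exact: leq_maxr.
  rewrite (sqint_integral mD); last exact: sqintB.
  by rewrite lee_fin hn// (leq_trans (leq_maxl n k))// phik.
have Lng n (e : R) : 0 < e -> (forall m, (n <= m)%N ->
     ip mu D (fun x => f n x - f m x) (fun x => f n x - f m x) <= e) ->
   sqint mu D (fun x => f n x - g x) /\
   ip mu D (fun x => f n x - g x) (fun x => f n x - g x) <= e.
  move=> e0 hn; have hk := key n e e0 hn.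
  have L : sqint mu D (fun x => f n x - g x).
    split; first by apply: measurable_funB => //; exact: (Lf n).1.
    have mfg : measurable_fun D (fun x => ((f n x - g x) ^+ 2)%:E).
      by apply/measurable_EFinP/measurable_funX/measurable_funB => //; exact: (Lf n).1.
    apply/integrableP; split=> //.
    rewrite (le_lt_trans _ (ltry e))//; apply: le_trans hk.
    under eq_integral do rewrite gee0_abs ?lee_fin ?sqr_ge0//.
    exact: lexx.
  by split=> //; rewrite -lee_fin -(sqint_integral mD).
have Lg : sqint mu D g.
  have [n hn] := cf 1 ltr01.
  have [L _] := Lng n 1 ltr01 (fun m nm => ltW (hn n m (leqnn n) nm)).
  have := sqintB mD (Lf n) L.
  by rewrite (_ : (fun x => _) = g)//; apply/funext => x; rewrite opprB addrC subrK.
exists g => // e e0.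
have e20 : 0 < e / 2 by rewrite divr_gt0.
have [n hn] := cf _ e20; exists n => m nm.
have [_ ] := Lng m _ e20 (fun k mk => ltW (hn m k nm (leq_trans nm mk))).
by move/le_lt_trans; apply; lra.
Qed.
End L2_complete.

(** * Lebesgue measure on row vectors *)

Section rowvec_borel.
Context {R : realType} (d : nat).
Local Notation Rd := 'rV[R]_d.
Local Notation leb := (lebesgue_rowvec d : {sigma_finite_measure set Rd -> \bar R}).

Definition obox (a b : Rd) : set Rd := [set x | forall i, a 0 i < x 0 i < b 0 i].
Definition cbox (a b : Rd) : set Rd := [set x | forall i, a 0 i <= x 0 i <= b 0 i].
Definition oboxes : set (set Rd) := [set B | exists a b, B = obox a b].

Lemma obox_cbox a b : obox a b `<=` cbox a b.
Proof. by move=> x h i; have /andP[/ltW-> /ltW->] := h i. Qed.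

Lemma measurable_coord_preimage (i : 'I_d) (B : set (measurableTypeR R)) :
  measurable B -> measurable [set x : Rd | B (x 0 i)].
Proof.
move=> mB; rewrite -[X in measurable X]setTI.
exact: (measurable_rowvec_coord i measurableT mB).
Qed.

Lemma measurable_forall_coord (B : 'I_d -> set (measurableTypeR R)) :
  (forall i, measurable (B i)) -> measurable [set x : Rd | forall i, B i (x 0 i)].
Proof.
move=> mB; rewrite (_ : [set _ | _] = \bigcap_(i in [set: 'I_d]) [set x : Rd | B i (x 0 i)]).
  apply: fin_bigcap_measurable; first exact: finite_finset.
  by move=> i _; exact: measurable_coord_preimage.
by apply/seteqP; split=> [x h i _|x h i]; [exact: h|exact: (h i Logic.I)].
Qed.

Lemma obox_itv a b : obox a b = [set x : Rd | forall i, `]a 0 i, b 0 i[%classic (x 0 i)].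
Proof. by apply/seteqP; split=> x h i; have := h i; rewrite /= in_itv. Qed.

Lemma cbox_itv a b : cbox a b = [set x : Rd | forall i, `[a 0 i, b 0 i]%classic (x 0 i)].
Proof. by apply/seteqP; split=> x h i; have := h i; rewrite /= in_itv. Qed.

Lemma measurable_obox a b : measurable (obox a b).
Proof. by rewrite obox_itv; apply: (@measurable_forall_coord (fun i => `]a 0 i, b 0 i[%classic)) => i; exact: measurable_itv. Qed.

Lemma compact_cbox a b : compact (cbox a b).
Proof.
rewrite cbox_itv; apply: (@rV_compact _ _ (fun i => `[a 0 i, b 0 i]%classic)) => i.
exact: segment_compact.
Qed.

Lemma oboxI a b a' b' : obox a b `&` obox a' b' =
  obox (\row_i Num.max (a 0 i) (a' 0 i)) (\row_i Num.min (b 0 i) (b' 0 i)).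
Proof.
apply/seteqP; split=> [x [h h'] i|x h].
  by rewrite !mxE gt_max lt_min; have /andP[-> ->] := h i; have /andP[-> ->] := h' i.
by split=> i; have := h i; rewrite !mxE gt_max lt_min => /andP[/andP[? ?] /andP[? ?]]; apply/andP.
Qed.

Lemma setI_closed_oboxes : setI_closed oboxes.
Proof.
by move=> _ _ [a [b ->]] [a' [b' ->]]; rewrite oboxI; do 2 eexists; reflexivity.
Qed.

Definition cube (r : R) : set Rd := obox (const_mx (- r)) (const_mx r).

Lemma cube_cover : \bigcup_n cube n%:R = setT.
Proof.
apply/seteqP; split=> // x _.
exists (Num.truncn (\sum_i `|x 0 i|)).+1 => // i; rewrite !mxE -ltr_norml.
apply: le_lt_trans (truncnS_gt _).
by rewrite (bigD1 i)//= lerDl sumr_ge0.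
Qed.

Lemma measurable_oboxes : @measurable _ Rd = <<s oboxes >>.
Proof.
apply/seteqP; split; last first.
  apply: smallest_sub; last by move=> _ [a [b ->]]; exact: measurable_obox.
  by split=> [|A mA|F mF]; [exact: measurable0|rewrite setTD; exact: measurableC|exact: bigcup_measurable].
apply: smallest_sub; first exact: smallest_sigma_algebra.
move=> A; rewrite -bigcup_seq => -[i _ [B mB <-]].
have : measurable_fun setT ((fun x => x 0 i) : g_sigma_algebraType oboxes -> measurableTypeR R).
  apply: (@measurability _ _ _ _ _ _ (@RGenOInfty.G R)); first exact: RGenOInfty.measurableE.
  move=> _ [_ [x ->] <-]; rewrite setTI.
  rewrite (_ : _ @^-1` _ = \bigcup_n obox (\row_j if j == i then x else - n%:R)
      (\row_j if j == i then x + n%:R else n%:R)).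
    by apply: bigcupT_measurable => n; apply: sub_sigma_algebra; do 2 eexists; reflexivity.
  apply/seteqP; split=> y /=; rewrite in_itv/= andbT.
    move=> xy; exists (Num.truncn (\sum_i `|y 0 i| + `|x|)).+1 => // j; rewrite !mxE.
    have h : `|y 0 j| + `|x| < (Num.truncn (\sum_i `|y 0 i| + `|x|)).+1%:R.
      apply: le_lt_trans (truncnS_gt _); rewrite lerD2r.
      by rewrite (bigD1 j)//= lerDl sumr_ge0.
    move: h; set N := _%:R => h.
    case: eqP => [ji|_]; first rewrite ji in h *.
      rewrite xy/=; have := ler_norm (y 0 i); have := ler_norm (- x); rewrite normrN.
      by move: h; clear; lra.
    by rewrite -ltr_norml; have := normr_ge0 x; lra.
  by move=> [n _ /(_ i)]; rewrite !mxE eqxx => /andP[].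
by move=> /(_ measurableT _ mB); rewrite setTI.
Qed.

(** Open boxes form a pi-system generating the sigma-algebra, and cubes of finite measure exhaust
    the space. *)
Lemma rowvec_measure_eq (m1 m2 : {measure set Rd -> \bar R}) :
  (forall a b, m1 (obox a b) = m2 (obox a b)) -> (forall n : nat, (m1 (cube n%:R) < +oo)%E) ->
  forall A, measurable A -> m1 A = m2 A.
Proof.
move=> m12 moo A mA.
apply: (measure_unique oboxes (fun n => cube n%:R)) => //.
- exact: measurable_oboxes.
- exact: setI_closed_oboxes.
- by move=> n; do 2 eexists; reflexivity.
- exact: cube_cover.
- by move=> _ [a [b ->]].
Qed.

Lemma lebesgue_obox a b :
  leb (obox a b) = (\prod_(i < d) if (a 0 i < b 0 i)%R then (b 0 i - a 0 i)%:E else 0)%E.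
Proof.
rewrite obox_itv; apply: etrans (lebesgue_rowvec_box (A := fun i => `]a 0 i, b 0 i[%classic) _) _.
  by move=> i; exact: measurable_itv.
apply: eq_bigr => i _; have := lebesgue_measure_itv `]a 0 i, b 0 i[; rewrite /= lte_fin => ->.
by case: ifP.
Qed.

Lemma lebesgue_obox_lty a b : (leb (obox a b) < +oo)%E.
Proof.
by rewrite lebesgue_obox ltey_eq prode_fin_num// => i _; case: ifP.
Qed.

(** * Translation invariance *)

Section translation.
Variable v : Rd.
Definition translate (x : Rd) : Rd := x + v.

Lemma measurable_translate : measurable_fun setT translate.
Proof.
apply: measurable_fun_rowvec => i.
rewrite (_ : _ \o _ = fun x => rowvec_coord i x + v 0 i); last first.
  by apply/funext => x; rewrite /rowvec_coord/= mxE.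
by apply: measurable_funD => //; exact: measurable_rowvec_coord.
Qed.

Lemma lebesgue_translate A : measurable A -> leb (translate @^-1` A) = leb A.
Proof.
pose pm : {measure set Rd -> \bar R} :=
  measure_function_pushforward__canonical__measure_function_Measure leb measurable_translate.
move=> mA; suff : leb A = pm A by move=> ->.
apply: (@rowvec_measure_eq leb pm) => // [a b|n]; last exact: lebesgue_obox_lty.
rewrite /pm/= /pushforward (_ : translate @^-1` obox a b = obox (a - v) (b - v)).
  rewrite !lebesgue_obox; apply: eq_bigr => i _; rewrite !mxE ltrD2r.
  by case: ifP => // _; congr EFin; ring.
by apply/seteqP; split=> x /= h i; have := h i; rewrite !mxE ltrBlDr ltrBrDr.
Qed.

Lemma ge0_integral_translate (f : Rd -> \bar R) : measurable_fun setT f ->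
  (forall x, (0 <= f x)%E) -> (\int[leb]_x f (x + v)%R = \int[leb]_x f x)%E.
Proof.
move=> mf f0.
have := @ge0_integral_pushforward _ _ _ _ R translate measurable_translate leb setT f measurableT mf.
rewrite preimage_setT => <- //; apply: eq_measure_integral; first exact: measurable_translate.
by move=> mt A mA _; exact: lebesgue_translate.
Qed.

Lemma integrable_translate (f : Rd -> \bar R) : leb.-integrable setT f ->
  leb.-integrable setT (fun x => f (x + v)).
Proof.
move=> /integrableP[mf fi]; apply/integrableP; split.
  exact: (measurableT_comp mf measurable_translate).
rewrite (ge0_integral_translate (f := fun x => `|f x|%E))//.
exact: measurableT_comp.
Qed.

Lemma Rintegral_translate (f : Rd -> R) : leb.-integrable setT (EFin \o f) ->
  \int[leb]_x f (x + v) = \int[leb]_x f x.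
Proof.
move=> fi; congr fine.
have mf := measurable_int _ fi.
have h := @integral_pushforward _ _ _ _ R translate measurable_translate leb setT (EFin \o f) mf.
rewrite preimage_setT in h.
rewrite -[LHS]h//; last exact: integrable_translate.
apply: eq_measure_integral; first exact: measurable_translate.
by move=> mt A mA _; exact: lebesgue_translate.
Qed.
End translation.

(** Rational corners make the family of boxes countable; the closed box inside [U] makes bumps on
    the open box test functions. *)
Lemma rat_box_between (U : set Rd) (x : Rd) : open U -> U x ->
  exists a b : 'rV[rat]_d, obox (map_mx ratr a) (map_mx ratr b) x /\
    cbox (map_mx ratr a) (map_mx ratr b) `<=` U.
Proof.
move=> oU Ux; have /nbhs_ballP[e /= e0 he] := open_nbhs_nbhs (conj oU Ux).
have /choice[a ha] (i : 'I_d) : exists q : rat, x 0 i - e < ratr q < x 0 i.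
  have [|q] := @rat_in_itvoo R (x 0 i - e) (x 0 i); first by rewrite ltrBlDr ltrDl.
  by rewrite in_itv => h; exists q.
have /choice[b hb] (i : 'I_d) : exists q : rat, x 0 i < ratr q < x 0 i + e.
  have [|q] := @rat_in_itvoo R (x 0 i) (x 0 i + e); first by rewrite ltrDl.
  by rewrite in_itv => h; exists q.
exists (\row_i a i), (\row_i b i); split=> [i|y hy].
  by rewrite !mxE; have /andP[_ ->] := ha i; have /andP[-> _] := hb i.
apply: he; split=> // i j; rewrite (ord1 i) /ball/= ltr_norml.
have := hy j; rewrite !mxE => /andP[h1 h2].
by have /andP[h3 h4] := ha j; have /andP[h5 h6] := hb j; apply/andP; split; lra.
Qed.

Lemma open_bigcup_box (U : set Rd) : open U -> U = \bigcup_(p in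
  [set p : 'rV[rat]_d * 'rV[rat]_d | cbox (map_mx ratr p.1) (map_mx ratr p.2) `<=` U])
  obox (map_mx ratr p.1) (map_mx ratr p.2).
Proof.
move=> oU; apply/seteqP; split=> [x Ux|x [[a b] /= h /obox_cbox]]; last exact: h.
by have [a [b [h1 h2]]] := rat_box_between oU Ux; exists (a, b).
Qed.

Lemma open_measurable_rowvec (U : set Rd) : open U -> measurable U.
Proof.
move=> oU; rewrite (open_bigcup_box oU) bigcup_mkcond.
apply: countable_bigcupT_measurable => [|p]; first exact: countableP.
by case: ifP => _; [exact: measurable_obox|exact: measurable0].
Qed.

Lemma continuous_measurable_rowvec (f : Rd -> R) : continuous f ->
  measurable_fun setT (f : Rd -> measurableTypeR R).
Proof.
move=> cf; apply: (@measurability _ _ _ _ _ _ (@RGenOInfty.G R)); first exact: RGenOInfty.measurableE.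
move=> _ [_ [x ->] <-]; rewrite setTI; apply: open_measurable_rowvec.
by apply: open_comp => // y _; exact: cf.
Qed.
End rowvec_borel.

(** * Rellich compactness for C1 functions *)

Section compactly_supported_C1.
Context {R : realType} (d : nat).
Local Notation Rd := 'rV[R]_d.
Local Notation leb := (lebesgue_rowvec d : {sigma_finite_measure set Rd -> \bar R}).
Local Notation e_ i := (delta_mx 0 i : Rd).
Implicit Types (f g : Rd -> R) (r s : R).

Definition supported_in r f := forall x, ~ cube r x -> f x = 0.

Definition C1c f := [/\ continuous f,
  forall i x, derivable (f : Rd -> R^o) x (e_ i),
  forall i, continuous (partial i f) & exists r, supported_in r f].

Lemma cubeP r (x : Rd) : cube r x <-> forall i, `|x 0 i| < r.
Proof. by split=> h i; have := h i; rewrite !mxE -ltr_norml. Qed.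

Lemma supported_inW r r' f : r <= r' -> supported_in r f -> supported_in r' f.
Proof.
by move=> rr' h x hx; apply: h => /cubeP h; apply: hx; apply/cubeP => i; exact: lt_le_trans rr'.
Qed.

Lemma measurable_cube r : measurable (cube r : set Rd).
Proof. exact: measurable_obox. Qed.

Lemma cube_cbox r : cube r `<=` cbox (const_mx (- r)) (const_mx r : Rd).
Proof. exact: obox_cbox. Qed.

Lemma continuous_bounded f r : continuous f -> supported_in r f -> exists2 M, 0 < M & forall x, `|f x| <= M.
Proof.
move=> cf sf; have K := @compact_cbox R d (const_mx (- r)) (const_mx r).
have cK : compact (f @` cbox (const_mx (- r)) (const_mx r : Rd)).
  by apply: continuous_compact => //; exact: continuous_subspaceT.
have [M [_ hM]] := compact_bounded cK.
exists (`|M| + 1) => [|x]; first by rewrite ltr_wpDl.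
have [cx|ncx] := pselect (cube r x); last by rewrite sf// normr0 addr_ge0.
apply: (hM (`|M| + 1)); first by rewrite (le_lt_trans (ler_norm _))// ltrDl.
by exists x => //; exact: cube_cbox.
Qed.

Lemma bounded_support_integrable f r M : measurable_fun setT (f : Rd -> measurableTypeR R) ->
  supported_in r f -> (forall x, `|f x| <= M) -> leb.-integrable setT (EFin \o f).
Proof.
move=> mf sf bf.
have -> : EFin \o f = (EFin \o f) \_ (cube r).
  apply/funext => x /=; rewrite patchE; case: ifPn => // /negP nx; rewrite sf//.
  by move=> cx; apply: nx; rewrite inE.
apply/(integrable_mkcond (EFin \o f) (measurable_cube r)).1.
apply: measurable_bounded_integrable.
- exact: measurable_cube.
- exact: lebesgue_obox_lty.
- exact: measurable_funTS.
- exists M; split; first exact: num_real.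
  by move=> y My x _; rewrite /= (le_trans (bf x))// ltW.
Qed.

Lemma continuous_support_integrable f r : continuous f -> supported_in r f ->
  leb.-integrable setT (EFin \o f).
Proof.
move=> cf sf; have [M _ hM] := continuous_bounded cf sf.
exact: bounded_support_integrable (continuous_measurable_rowvec cf) sf hM.
Qed.

Section line.
Variables (f : Rd -> R) (i : 'I_d) (df : forall x, derivable (f : Rd -> R^o) x (e_ i)).

Lemma is_derive_line x (t : R) :
  is_derive t 1 (fun h : R => f (x + h *: e_ i) : R^o) (partial i f (x + t *: e_ i)).
Proof.
pose g : R -> R^o := fun h => f (x + h *: e_ i); rewrite -/g.
have E : (fun h : R => h^-1 *: ((g \o shift t) (h *: (1 : R)) - g t)) =
    (fun h : R => h^-1 *: (((f : Rd -> R^o) \o shift (x + t *: e_ i)) (h *: e_ i) - (f : Rd -> R^o) (x + t *: e_ i))).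
  apply/funext => h; rewrite /g /=; congr (_ *: (f _ - _)).
  by rewrite [_ *: 1]mulr1 scalerDl addrCA.
apply: DeriveDef; first by rewrite /derivable E; exact: df.
by rewrite /derive E.
Qed.

Lemma partial_MVT x (s : R) : exists c : R, `|c| <= `|s| /\
  f (x + s *: e_ i) - f x = s * partial i f (x + c *: e_ i).
Proof.
pose g (h : R) : R^o := f (x + h *: e_ i).
have cg (a b : R) : {within `[a, b], continuous g}.
  apply: continuous_subspaceT => t; apply/differentiable_continuous/derivable1_diffP.
  exact: (@ex_derive _ _ _ _ _ _ _ (is_derive_line x t)).
have g0 : g 0 = f x by rewrite /g scale0r addr0.
have [s0|s0] := leP 0 s.
  have [c] := @MVT_segment R g (fun t => partial i f (x + t *: e_ i)) 0 s s0
    (fun t _ => is_derive_line x t) (cg 0 s).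
  rewrite in_itv/= => /andP[c0 cs]; rewrite g0 subr0 => h.
  by exists c; split; [rewrite !ger0_norm//; exact: le_trans cs|rewrite h mulrC].
have [c] := @MVT_segment R g (fun t => partial i f (x + t *: e_ i)) s 0 (ltW s0)
    (fun t _ => is_derive_line x t) (cg s 0).
rewrite in_itv/= => /andP[sc c0]; rewrite g0 sub0r => h.
exists c; split; first by rewrite (ltr0_norm s0) ler0_norm// lerN2.
by rewrite -opprB h mulrN opprK mulrC.
Qed.

Lemma diff_quotient_cvg x (s : R) : s != 0 ->
  (fun n : nat => (f (x + (s / n.+1%:R) *: e_ i) - f x) / (s / n.+1%:R)) @ \oo --> partial i f x.
Proof.
move=> s0.
have hl : (fun h : R => h^-1 *: (((f : Rd -> R^o) \o shift x) (h *: e_ i) - (f : Rd -> R^o) x)) @ 0^'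
  --> (partial i f x : R^o) by exact: df.
have hl' : (fun h : R => h^-1 * (f (x + h *: e_ i) - f x)) @ 0^' --> partial i f x.
  rewrite [X in X @ _ --> _](_ : _ = (fun h : R => h^-1 *: (((f : Rd -> R^o) \o shift x) (h *: e_ i) - (f : Rd -> R^o) x)))//.
  by apply/funext => h /=; rewrite [h *: _ + x]addrC.
have /cvgr_dnbhsP/(_ (fun n => s / n.+1%:R)) key := hl'.
rewrite (_ : (fun n : nat => _ / _) = (fun n : nat => (s / n.+1%:R)^-1 * (f (x + (s / n.+1%:R) *: e_ i) - f x))).
  apply: key; split=> [n|]; first by rewrite mulf_neq0// invr_eq0 pnatr_eq0.
  rewrite -(mulr0 s); apply: cvgM; [exact: cvg_cst|exact: cvg_harmonic].
by apply/funext => n; rewrite mulrC.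
Qed.

(** Some coordinate [j] of [x] has absolute value at least [r]. Steps along [e_ i] with the sign of
    [x 0 j] stay outside the cube, so a sequence of difference quotients vanishes identically. *)
Lemma partial_support r : supported_in r f -> supported_in r (partial i f).
Proof.
move=> sf x nx.
have /existsNP[j /negP] : ~ forall j, `|x 0 j| < r by move=> h; apply: nx; exact/cubeP.
rewrite -leNgt => rx.
have [s [s0 hs]] : exists s : R, s != 0 /\ forall n : nat, ~ cube r (x + (s / n.+1%:R) *: e_ i).
  exists (if 0 <= x 0 j then 1 else -1); split; first by case: ifP; rewrite ?oner_eq0// oppr_eq0 oner_eq0.
  move=> n /cubeP /(_ j); rewrite !mxE eqxx/=; apply/negP; rewrite -leNgt (le_trans rx)//.
  have h : 0 <= n.+1%:R^-1 * (j == i)%:R :> R by rewrite mulr_ge0 ?invr_ge0.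
  case: ifP => [x0|/negbT]; last rewrite -ltNge => x0.
    by rewrite !ger0_norm ?addr_ge0 ?mul1r// lerDl.
  rewrite (ltr0_norm x0) (_ : x 0 j + _ = x 0 j - n.+1%:R^-1 * (j == i)%:R); last by rewrite mulN1r mulNr.
  by move: h x0; move: (_ * _) => p p0 x0; rewrite ler0_norm; lra.
have := @diff_quotient_cvg x s s0.
rewrite [X in X @ _ --> _](_ : _ = (fun=> 0)); last first.
  by apply/funext => n; rewrite !sf// subrr mul0r.
by move/cvg_lim => <-//; apply: lim_cst.
Qed.
End line.

Lemma C1c_support f : C1c f -> exists r, supported_in r f /\ forall i, supported_in r (partial i f).
Proof. by move=> [_ df _ [r sf]]; exists r; split=> // i; exact: partial_support. Qed.

Lemma C1c_bounds f : C1c f -> exists r M, [/\ 0 < M, supported_in r f,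
  forall x, `|f x| <= M & forall i x, supported_in r (partial i f) /\ `|partial i f x| <= M].
Proof.
move=> Cf; have [r [sf spf]] := C1c_support Cf; have [cf df cpf _] := Cf.
have [M0 M00 hM0] := continuous_bounded cf sf.
have /choice[M1 hM1] i : exists M1, 0 < M1 /\ forall x, `|partial i f x| <= M1.
  by have [M1 ? ?] := continuous_bounded (cpf i) (spf i); exists M1.
have s0 : 0 <= \sum_j M1 j by apply: sumr_ge0 => j _; have [/ltW] := hM1 j.
exists r, (M0 + \sum_j M1 j); split=> //.
- by rewrite ltr_wpDr.
- by move=> x; rewrite (le_trans (hM0 x))// lerDl.
move=> i x; split=> //; have [_ h] := hM1 i; rewrite (le_trans (h x))//.
rewrite (bigD1 i)//= addrCA lerDl addr_ge0 ?(ltW M00)// sumr_ge0// => j _.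
by have [/ltW] := hM1 j.
Qed.

Lemma cube_shift r (x v : Rd) (s : R) : (forall i, `|v 0 i| <= s) -> cube r (x + v : Rd) -> cube (r + s) x.
Proof.
move=> hv /cubeP h; apply/cubeP => i; have := h i; rewrite mxE => hi.
have -> : x 0 i = (x 0 i + v 0 i) - v 0 i by rewrite addrK.
by rewrite (le_lt_trans (ler_normB _ _))// ltr_leD.
Qed.

Lemma translate_support f r (v : Rd) (s : R) : (forall i, `|v 0 i| <= s) -> supported_in r f ->
  supported_in (r + s) (fun x => f (x + v)).
Proof. by move=> hv sf x nx; apply: sf => /(cube_shift hv). Qed.

Lemma continuous_translate (v : Rd) : continuous (translate v).
Proof.
move=> y; have h : translate v @ y --> y + v.
  by apply: (@cvgD _ _ _ (nbhs y) _ id (cst v)); [exact: cvg_id|exact: cvg_cst].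
exact: h.
Qed.

(** The mean value theorem bounds the quotients by the bound of the partial derivative, and their
    supports stay in one cube, so convergence is dominated. It serves for [F] the identity and for
    [F] the square. *)
Lemma diff_quotient_dct f i (s : R) (F : R -> R) : C1c f -> s != 0 -> continuous F -> F 0 = 0 ->
  (forall M : R, exists K : R, forall y : R, `|y| <= M -> `|F y| <= K) ->
  (fun n : nat => \int[leb]_x F ((f (x + (s / n.+1%:R) *: e_ i) - f x) / (s / n.+1%:R))) @ \oo -->
    \int[leb]_x F (partial i f x).
Proof.
move=> Cf s0 cF F0 bF; have [r [M [M0 sf bf bp]]] := C1c_bounds Cf; have [cf df cpf _] := Cf.
have [K hK] := bF M.
have K0 : 0 <= K by rewrite (le_trans _ (hK 0 _))// normr0 ltW.
pose q (n : nat) x := (f (x + (s / n.+1%:R) *: e_ i) - f x) / (s / n.+1%:R).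
have sn n : s / n.+1%:R != 0 by rewrite mulf_neq0// invr_eq0 pnatr_eq0.
have snle n : `|s / n.+1%:R| <= `|s|.
  by rewrite normrM ler_piMr// ger0_norm ?invr_ge0// invf_le1 ?ler1n.
have bq n x : `|q n x| <= M.
  have [c [_ h]] := partial_MVT (df i) x (s / n.+1%:R).
  by rewrite /q h mulrC mulKf//; have [_] := bp i (x + c *: e_ i).
have sup n x : ~ cube (r + `|s|) x -> q n x = 0.
  move=> nx; have s1 : f (x + (s / n.+1%:R) *: e_ i) = 0.
    apply: sf => cx; apply: nx; apply: cube_shift cx => j; rewrite !mxE eqxx/= normrM (le_trans _ (snle n))//.
    by rewrite ler_piMr// normr_nat lern1 leq_b1.
  have s2 : f x = 0 by apply: sf => cx; apply: nx; apply: (@cube_shift _ _ 0) => [j|]; [rewrite mxE normr0|rewrite addr0].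
  by rewrite /q s1 s2 subrr mul0r.
have cq n : continuous (q n).
  have ct : continuous (fun y : Rd => y + (s / n.+1%:R) *: e_ i).
    exact: continuous_translate.
  have c1 : continuous (fun y : Rd => f (y + (s / n.+1%:R) *: e_ i)).
    by move=> y; apply: continuous_comp; [exact: ct|exact: cf].
  have c2 : continuous (fun y : Rd => f (y + (s / n.+1%:R) *: e_ i) - f y).
    by move=> y; exact: (@cvgB _ _ _ (nbhs y) _ _ _ _ _ (c1 y) (cf y)).
  by move=> x; exact: (@cvgM _ _ (nbhs x) _ _ (cst _) _ _ (c2 x) (cvg_cst _)).
have mF (g : Rd -> R) : continuous g -> measurable_fun setT (EFin \o (F \o g)).
  move=> cg; apply/measurable_EFinP; apply: continuous_measurable_rowvec => x.
  by apply: continuous_comp; [exact: cg|exact: cF].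
pose G (x : Rd) := K * \1_(cube (r + `|s|) : set Rd) x.
have iG : leb.-integrable setT (EFin \o G).
  apply: (@bounded_support_integrable _ (r + `|s|) K).
  - by apply: measurable_funM => //; exact: measurable_indic (measurable_cube _).
  - by move=> x nx; rewrite /G indicE memNset// mulr0.
  - by move=> x; rewrite /G normrM (ger0_norm K0) ler_piMr// indicE; case: (_ \in _); rewrite ?normr1 ?normr0.
have dom n x : `|F (q n x)| <= G x.
  rewrite /G indicE; have [cx|nx] := boolP (x \in _); first by rewrite mulr1 hK.
  by rewrite mulr0 sup ?F0 ?normr0// => cx; move/negP: nx; apply; rewrite inE.
have ae1 : {ae leb, forall x, setT x -> (fun n => (F (q n x))%:E) @ \oo --> (F (partial i f x))%:E}.
  apply: aeW => x _; apply: cvg_EFin; first exact: nearW.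
  have := @diff_quotient_cvg f i (df i) x s s0; rewrite -/(q ^~ x) => h.
  exact: (continuous_cvg _ (cF _) h).
have ae2 : {ae leb, forall x n, setT x -> (`|(F (q n x))%:E| <= (G x)%:E)%E}.
  by apply: aeW => x n _; rewrite lee_fin dom.
have [iF _ h] := @dominated_convergence _ _ _ leb setT measurableT (fun n x => (F (q n x))%:E)
  (fun x => (F (partial i f x))%:E) (EFin \o G) (fun n => mF _ (cq n)) (mF _ (cpf i)) ae1 iG ae2.
by apply: fine_cvg; rewrite fineK; [exact: h|exact: integrable_fin_num].
Qed.
End compactly_supported_C1.

Lemma sqr_sum_le (R : realFieldType) n (y : 'I_n -> R) : (\sum_i y i) ^+ 2 <= n%:R * \sum_i y i ^+ 2.
Proof.
elim: n y => [|n IH] y; first by rewrite !big_ord0 expr0n mul0r.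
rewrite !big_ord_recl; set S := \sum_(i < n) _; set Q := \sum_(i < n) _.
have h : S ^+ 2 <= n%:R * Q by exact: IH.
have Q0 : 0 <= Q by apply: sumr_ge0 => i _; exact: sqr_ge0.
move: h; case: n {IH} y S Q Q0 => [|n] y S Q Q0.
  rewrite mul0r mul1r => h; have -> : S = 0 by apply/eqP; rewrite -sqrf_eq0 eq_le h sqr_ge0.
  by rewrite addr0 lerDl.
move=> h; set x := y ord0.
have n0 : 0 < n.+1%:R :> R by [].
rewrite -[n.+2%:R]natr1 mulrDl mul1r mulrDr sqrrD.
have : 2 * (x * S) <= n.+1%:R * x ^+ 2 + Q.
  rewrite -(ler_pM2l n0); move: (n.+1%:R : R) n0 h => N N0 h.
  have := sqr_ge0 (N * x - S); rewrite sqrrB exprMn; nra.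
by move: h; move: (n.+1%:R : R) (x ^+ 2) (S ^+ 2) (x * S) => N X Y Z; lra.
Qed.

(** * Energy of shifts *)

Section shift_estimate.
Context {R : realType} (d : nat).
Local Notation Rd := 'rV[R]_d.
Local Notation leb := (lebesgue_rowvec d : {sigma_finite_measure set Rd -> \bar R}).
Local Notation e_ i := (delta_mx 0 i : Rd).
Implicit Types (f g : Rd -> R).

Lemma continuous_comp_translate f (v : Rd) : continuous f -> continuous (fun x : Rd => f (x + v) : R).
Proof. by move=> cf x; apply: (@continuous_comp _ _ _ (translate v) f); [exact: continuous_translate|exact: cf]. Qed.

Lemma continuousB_fct f g : continuous f -> continuous g -> continuous (fun x => f x - g x).
Proof. by move=> cf cg x; exact: (@cvgB _ _ _ (nbhs x) _ _ _ _ _ (cf x) (cg x)). Qed.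

Lemma continuousM_fct f g : continuous f -> continuous g -> continuous (fun x => f x * g x).
Proof. by move=> cf cg x; exact: (@cvgM _ _ (nbhs x) _ _ _ _ _ (cf x) (cg x)). Qed.

Lemma continuousX2_fct f : continuous f -> continuous (fun x => f x ^+ 2).
Proof. by move=> cf; under eq_fun do rewrite expr2; exact: continuousM_fct. Qed.

Lemma supported_translate f r (v : Rd) : supported_in r f -> exists r', supported_in r' (fun x : Rd => f (x + v) : R).
Proof.
move=> sf; exists (r + \sum_i `|v 0 i|); apply: translate_support sf => i.
by rewrite (bigD1 i)//= lerDl sumr_ge0.
Qed.

Definition shift_energy f (v : Rd) : R := \int[leb]_x (f (x + v) - f x) ^+ 2.

Lemma shift_integrable f r (v : Rd) : continuous f -> supported_in r f ->
  leb.-integrable setT (EFin \o (fun x => (f (x + v) - f x) ^+ 2)).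
Proof.
move=> cf sf; have [r' sf'] := supported_translate v sf.
apply: (@continuous_support_integrable _ _ _ (Num.max r r')).
  by apply/continuousX2_fct/continuousB_fct => //; exact: continuous_comp_translate.
move=> x nx; rewrite (supported_inW _ sf nx) ?le_max ?lexx//.
by rewrite (supported_inW _ sf' nx) ?le_max ?lexx ?orbT// subrr expr0n.
Qed.

(** The increment telescopes along the partial sums [w]; by translation invariance each piece has
    the energy of its own shift, and Cauchy-Schwarz costs the factor [n]. *)
Lemma shift_energy_sum f r n (v : 'I_n -> Rd) : continuous f -> supported_in r f ->
  shift_energy f (\sum_j v j) <= n%:R * \sum_j shift_energy f (v j).
Proof.
move=> cf sf.
pose w (k : nat) : Rd := \sum_(j < n | (j < k)%N) v j.
have w0 : w 0%N = 0 by rewrite /w big_pred0.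
have wn : w n = \sum_j v j by apply: eq_bigl => j; rewrite ltn_ord.
have wS (j : 'I_n) : w j.+1 = w j + v j.
  rewrite /w (bigD1 j)//= addrC; congr (_ + _); apply: eq_bigl => i.
  by rewrite ltnS ltn_neqAle andbC.
pose D (j : 'I_n) x := (f (x + w j + v j) - f (x + w j)) ^+ 2.
have iD j : leb.-integrable setT (EFin \o D j).
  exact: (integrable_translate (w j) (shift_integrable (v j) cf sf)).
have ED j : \int[leb]_x D j x = shift_energy f (v j).
  exact: (Rintegral_translate (w j) (shift_integrable (v j) cf sf)).
have tele x : f (x + \sum_j v j) - f x = \sum_(j < n) (f (x + w j + v j) - f (x + w j)).
  have fx : f x = f (x + w 0%N) by rewrite w0 addr0.
  rewrite {1}fx -wn -(telescope_sumr (fun k => f (x + w k)))// big_mkord.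
  by apply: eq_bigr => j _; rewrite wS addrA.
have isum : leb.-integrable setT (EFin \o (fun x => \sum_j D j x)).
  rewrite (_ : _ \o _ = (fun x => \sum_j (D j x)%:E)%E).
    by apply: integrable_sum => // j _; exact: iD.
  by apply/funext => x /=; rewrite -sumEFin.
have Esum : \int[leb]_x (\sum_j D j x) = \sum_j shift_energy f (v j).
  under [RHS]eq_bigr do rewrite -ED.
  rewrite /Rintegral sum_fine; last by move=> j _; exact: (integrable_fin_num measurableT (iD j)).
  congr fine; rewrite -integral_sum//.
  by apply: eq_integral => x _; rewrite -sumEFin.
rewrite -Esum -RintegralZl//; apply: le_Rintegral => //.
- exact: shift_integrable cf sf.
- by apply: eq_integrable (integrableZl measurableT n%:R isum).
by move=> x _; rewrite tele sqr_sum_le.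
Qed.

(** By translation invariance every difference quotient integrates to zero. *)
Lemma integral_partial0 f i : C1c f -> \int[leb]_x partial i f x = 0.
Proof.
move=> Cf; have [cf df cpf [r sf]] := Cf.
have cid : continuous (id : R -> R) by move=> x; exact: cvg_id.
have := @diff_quotient_dct _ _ f i 1 id Cf (oner_neq0 _) cid erefl (fun M => ex_intro _ M (fun y h => h)).
rewrite [X in X @ _ --> _](_ : _ = (fun=> 0)).
  by move/cvg_lim => <-//; exact: lim_cst.
apply/funext => n; rewrite RintegralZr//.
  have if1 := continuous_support_integrable cf sf.
  have if2 := integrable_translate ((1 / n.+1%:R) *: e_ i) if1.
  by rewrite RintegralB// (Rintegral_translate _ if1) subrr mul0r.
have if1 := continuous_support_integrable cf sf.
have if2 := integrable_translate ((1 / n.+1%:R) *: e_ i) if1.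
exact: (integrableB measurableT if2 if1).
Qed.

(** The shift is cut into [n.+1] equal ones, which bounds its energy by [n.+1 ^ 2] times that of one
    small shift. This is [s ^+ 2] times the integral of a squared difference quotient, and [n] tends
    to infinity. *)
Lemma shift_energy_axis f i (s : R) : C1c f ->
  shift_energy f (s *: e_ i) <= s ^+ 2 * \int[leb]_x (partial i f x) ^+ 2.
Proof.
move=> Cf; have [cf df cpf [r sf]] := Cf.
have [->|s0] := eqVneq s 0.
  rewrite scale0r expr0n mul0r /shift_energy.
  by under eq_Rintegral do rewrite addr0 subrr expr0n; rewrite Rintegral_cst// mul0r.
have csq : continuous (fun y : R => y ^+ 2).
  move=> x; under eq_fun do rewrite expr2.
  have h : (fun y : R => y * y) @ x --> x * x by apply: cvgM; exact: cvg_id.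
  exact: h.
have bsq (M : R) : exists K : R, forall y : R, `|y| <= M -> `|y ^+ 2| <= K.
  exists (M ^+ 2) => y h; rewrite normrX lerXn2r ?nnegrE//; exact: le_trans h.
have sq0 : (0 : R) ^+ 2 = 0 by rewrite expr0n.
have h := @diff_quotient_dct _ _ f i s (fun y => y ^+ 2) Cf s0 csq sq0 bsq.
have s2 : 0 < s ^+ 2 by rewrite exprn_even_gt0.
rewrite -ler_pdivrMl// -(cvg_lim (@norm_hausdorff _ _) h).
apply: limr_ge; first by apply/cvg_ex; eexists; exact: h.
apply: nearW => n /=.
pose h_ : R := s / n.+1%:R.
have h0 : h_ != 0 by rewrite mulf_neq0// invr_eq0 pnatr_eq0.
have E : \int[leb]_x ((f (x + h_ *: e_ i) - f x) / h_) ^+ 2 = shift_energy f (h_ *: e_ i) / h_ ^+ 2.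
  under eq_Rintegral do rewrite exprMn exprVn.
  by rewrite RintegralZr//; exact: shift_integrable cf sf.
rewrite E ler_pdivrMl//.
have := @shift_energy_sum f r n.+1 (fun=> h_ *: e_ i) cf sf.
rewrite !sumr_const card_ord scalerMnl.
have -> : h_ *+ n.+1 = s by rewrite -mulr_natr divfK ?pnatr_eq0.
rewrite -[shift_energy _ _ *+ _]mulr_natl => /le_trans; apply; rewrite /h_ le_eqVlt; apply/orP; left; apply/eqP.
have := pnatr_eq0 R n.+1 : _ = false; move: (n.+1%:R : R) => N /negbT N0; field; by rewrite N0 s0.
Qed.

Lemma shift_energy_le f (v : Rd) (s : R) : C1c f -> (forall i, `|v 0 i| <= s) ->
  shift_energy f v <= d%:R * (s ^+ 2 * \sum_i \int[leb]_x (partial i f x) ^+ 2).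
Proof.
move=> Cf hv; have [cf df cpf [r sf]] := Cf.
rewrite {1}(matrix_sum_delta v) big_ord1.
apply: le_trans (shift_energy_sum _ cf sf) _.
rewrite ler_wpM2l// mulr_sumr; apply: ler_sum => i _.
apply: le_trans (shift_energy_axis i _ Cf) _; rewrite ler_wpM2r//.
  by apply: Rintegral_ge0 => x _; exact: sqr_ge0.
by rewrite -[leLHS]real_normK ?num_real// lerXn2r ?nnegrE// (le_trans _ (hv i)).
Qed.
End shift_estimate.

(** * Variance and oscillation over cells *)

Section quadratic_cell.
Context d (T : measurableType d) (R : realType) (mu : {measure set T -> \bar R}).
Context (Q : set T) (mQ : measurable Q) (om : R) (muQ : mu Q = om%:E).
Context (f : T -> R) (if1 : mu.-integrable Q (EFin \o f))
  (if2 : mu.-integrable Q (EFin \o (fun x => f x ^+ 2))).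

Lemma integral_quadratic (A B C : R) :
  (\int[mu]_(x in Q) (A + B * f x + C * f x ^+ 2)%:E =
  (A * om + B * \int[mu]_(x in Q) f x + C * \int[mu]_(x in Q) f x ^+ 2)%R%:E)%E.
Proof.
have iA : mu.-integrable Q (EFin \o cst A) 
  by apply: measurable_bounded_integrable => //; [rewrite muQ ltry|exact: bounded_cst].
have iB : mu.-integrable Q (EFin \o (fun x => B * f x)).
  by apply: eq_integrable (integrableZl mQ B if1).
have iC : mu.-integrable Q (EFin \o (fun x => C * f x ^+ 2)).
  by apply: eq_integrable (integrableZl mQ C if2).
have iAB : mu.-integrable Q (EFin \o (fun x => A + B * f x)).
  by apply: eq_integrable (integrableD mQ iA iB).
have iABC : mu.-integrable Q (EFin \o (fun x => A + B * f x + C * f x ^+ 2)).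
  by apply: eq_integrable (integrableD mQ iAB iC).
rewrite -[LHS]fineK; last exact: integrable_fin_num.
congr EFin; rewrite -[LHS]/(\int[mu]_(x in Q) (A + B * f x + C * f x ^+ 2)).
by rewrite RintegralD// RintegralD// !RintegralZl// Rintegral_cst// muQ.
Qed.

Lemma integral_sqr_diff (c : R) : (\int[mu]_(y in Q) ((c - f y) ^+ 2)%:E =
   (\int[mu]_(y in Q) f y ^+ 2 + - 2 * (\int[mu]_(y in Q) f y) * c + om * c ^+ 2)%R%:E)%E.
Proof.
transitivity (\int[mu]_(y in Q) (c ^+ 2 + (- 2 * c) * f y + 1 * f y ^+ 2)%R%:E)%E.
  by apply: eq_integral => y _; congr EFin; ring.
by rewrite integral_quadratic; congr EFin; ring.
Qed.

Lemma double_integral_sqr_diff :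
  (\int[mu]_(x in Q) \int[mu]_(y in Q) ((f x - f y) ^+ 2)%:E =
   (2 * om * \int[mu]_(x in Q) f x ^+ 2 - 2 * (\int[mu]_(x in Q) f x) ^+ 2)%R%:E)%E.
Proof.
under eq_integral do rewrite integral_sqr_diff.
by rewrite integral_quadratic; congr EFin; ring.
Qed.
End quadratic_cell.

Section rellich_C1.
Context {R : realType} (d : nat).
Local Notation Rd := 'rV[R]_d.
Local Notation leb := (lebesgue_rowvec d : {sigma_finite_measure set Rd -> \bar R}).
Implicit Types (f g : Rd -> R).

Definition dirichlet f : R := \sum_i \int[leb]_x (partial i f x) ^+ 2.

Lemma dirichlet_ge0 f : 0 <= dirichlet f.
Proof. by apply: sumr_ge0 => i _; apply: Rintegral_ge0 => x _; exact: sqr_ge0. Qed.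

Lemma lebesgue_cube (s : R) : 0 < s -> leb (cube s) = ((2 * s) ^+ d)%:E.
Proof.
move=> s0; rewrite lebesgue_obox (eq_bigr (fun=> (2 * s)%:E)).
  by rewrite prodEFin prodr_const card_ord.
move=> i _; rewrite !mxE ifT; first by congr EFin; ring.
by rewrite (lt_trans _ s0)// oppr_lt0.
Qed.

Lemma measurable_shift_kernel f (s : R) : continuous f -> measurable_fun setT
  (fun p : Rd * Rd => (\1_(cube s) p.2 * (f (p.1 + p.2)%R - f p.1)%R ^+ 2)%:E).
Proof.
move=> cf; have mf := continuous_measurable_rowvec cf.
have msum : measurable_fun setT (fun p : Rd * Rd => p.1 + p.2).
  apply: measurable_fun_rowvec => i.
  rewrite (_ : _ \o _ = fun p : Rd * Rd => rowvec_coord i p.1 + rowvec_coord i p.2); last first.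
    by apply/funext => p; rewrite /rowvec_coord/= mxE.
  apply: measurable_funD.
    exact: (measurableT_comp (measurable_rowvec_coord i) measurable_fst).
  exact: (measurableT_comp (measurable_rowvec_coord i) measurable_snd).
  apply/measurable_EFinP; apply: measurable_funM.
    apply: (measurableT_comp _ measurable_snd).
    exact: measurable_indic (measurable_cube s).
  apply: measurable_funX; apply: measurable_funB.
    exact: (measurableT_comp mf msum).
  exact: (measurableT_comp mf measurable_fst).
Qed.

(** By Tonelli the integral over [x] becomes the energy of the shift [z], bounded uniformly on
    [cube s], whose volume is the remaining factor. *)
Lemma shift_double_integral f (s : R) : C1c f -> 0 < s ->
  (\int[leb]_x \int[leb]_z (\1_(cube s) z * (f (x + z) - f x)%R ^+ 2)%:E <=
   ((2 * s) ^+ d * (d%:R * (s ^+ 2 * dirichlet f)))%:E)%E.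
Proof.
move=> Cf s0; have [cf _ _ [r sf]] := Cf.
pose Psi (p : Rd * Rd) := (\1_(cube s) p.2 * (f (p.1 + p.2)%R - f p.1)%R ^+ 2)%:E.
have mPsi : measurable_fun setT Psi by exact: measurable_shift_kernel.
have Psi0 p : (0 <= Psi p)%E by rewrite lee_fin mulr_ge0 ?sqr_ge0.
have := @fubini_tonelli _ _ _ _ R leb leb Psi mPsi Psi0; rewrite {1}/Psi/= => ->.
have K0 : 0 <= d%:R * (s ^+ 2 * dirichlet f) by exact: mulr_ge0 (ler0n _ _) (mulr_ge0 (sqr_ge0 s) (dirichlet_ge0 f)).
have h z : (\int[leb]_x Psi (x, z) <= (d%:R * (s ^+ 2 * dirichlet f))%:E * (\1_(cube s) z)%:E)%E.
  rewrite /Psi/= indicE; have [cz|nz] := boolP (z \in _); last first.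
    by under eq_integral do rewrite mul0r; rewrite integral0 mule0.
  under eq_integral do rewrite mul1r.
  have -> : (\int[leb]_x ((f (x + z) - f x) ^+ 2)%:E)%E = (shift_energy f z)%:E.
    by rewrite /shift_energy /Rintegral fineK//; apply: integrable_fin_num => //; exact: shift_integrable cf sf.
  rewrite mule1 lee_fin; apply: shift_energy_le => // i.
  by apply: ltW; move: i; apply/cubeP; rewrite inE in cz.
apply: (@le_trans _ _ (\int[leb]_z ((d%:R * (s ^+ 2 * dirichlet f))%:E * (\1_(cube s) z)%:E))%E).
  apply: ge0_le_integral => //.
  - by move=> z _; apply: integral_ge0.
  - exact: measurable_fun_fubini_tonelli_G.
  - apply: emeasurable_funM => //; apply/measurable_EFinP; exact: measurable_indic (measurable_cube s).
rewrite ge0_integralZl//; last by apply/measurable_EFinP; exact: measurable_indic (measurable_cube s).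
rewrite integral_indic ?setIT//; last exact: measurable_cube.
rewrite muleC le_eqVlt; apply/orP; left; apply/eqP.
exact: (congr1 (fun x => x * _)%E (lebesgue_cube s0)).
Qed.
End rellich_C1.

Section cells.
Context {R : realType} (d N : nat) (r s : R) (s0 : 0 < s) (Ns : N%:R * s = 2 * r).
Local Notation Rd := 'rV[R]_d.
Local Notation leb := (lebesgue_rowvec d : {sigma_finite_measure set Rd -> \bar R}).
Implicit Types (k : {ffun 'I_d -> 'I_N}) (f : Rd -> R).

(** Half-open, so that distinct cells are disjoint and together cover the cube, with no correction
    by null sets. *)
Definition cell k : set Rd :=
  [set x | forall i, - r + (k i)%:R * s <= x 0 i < - r + (k i).+1%:R * s].

Lemma cell_itv k : cell k =
  [set x : Rd | forall i, `[- r + (k i)%:R * s, - r + (k i).+1%:R * s[%classic (x 0 i)].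
Proof. by apply/seteqP; split=> x h i; have := h i; rewrite /= in_itv. Qed.

Lemma measurable_cell k : measurable (cell k).
Proof.
rewrite cell_itv; apply: (@measurable_forall_coord R d
  (fun i => `[- r + (k i)%:R * s, - r + (k i).+1%:R * s[%classic)) => i.
exact: measurable_itv.
Qed.

Lemma lebesgue_cell k : leb (cell k) = (s ^+ d)%:E.
Proof.
rewrite cell_itv; apply: etrans (lebesgue_rowvec_box
  (A := fun i => `[- r + (k i)%:R * s, - r + (k i).+1%:R * s[%classic) _) _.
  by move=> i; exact: measurable_itv.
rewrite (eq_bigr (fun=> s%:E)); first by rewrite prodEFin prodr_const card_ord.
move=> i _; have := @lebesgue_measure_itv R `[- r + (k i)%:R * s, - r + (k i).+1%:R * s[.
rewrite /= lte_fin => ->; rewrite ifT; first by rewrite -EFinD -natr1; congr EFin; ring.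
by rewrite ltrD2l ltr_pM2r// ltr_nat.
Qed.

Lemma cell_inj k k' x : cell k x -> cell k' x -> k = k'.
Proof.
move=> h h'; apply/ffunP => i; apply: val_inj; apply/eqP.
have /andP[a1 a2] := h i; have /andP[b1 b2] := h' i.
have := le_lt_trans a1 b2; have := le_lt_trans b1 a2.
by rewrite !ltrD2l !ltr_pM2r// !ltr_nat !ltnS eqn_leq => -> ->.
Qed.

Lemma cell_cover x : cube r x -> exists k, cell k x.
Proof.
move=> hx.
have cov (i : 'I_d) : exists m : 'I_N, - r + m%:R * s <= x 0 i < - r + m.+1%:R * s.
  have := hx i; rewrite !mxE => /andP[h1 h2].
  have q0 : 0 <= (x 0 i + r) / s by rewrite divr_ge0 ?(ltW s0)//; lra.
  have /andP[t1 t2] := Num.Theory.truncn_itv q0; set m := Num.truncn _ in t1 t2.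
  have mN : (m < N)%N.
    rewrite -(ltr_nat R) (le_lt_trans t1)// ltr_pdivrMr// Ns; lra.
  exists (Ordinal mN) => /=; rewrite ler_pdivlMr// in t1; rewrite ltr_pdivrMr// in t2.
  by apply/andP; split; lra.
by have /choice[k hk] := cov; exists [ffun i => k i] => i; rewrite ffunE.
Qed.

Lemma cell_close k x y : cell k x -> cell k y -> cube s (y - x).
Proof.
move=> hx hy; apply/cubeP => i; rewrite !mxE.
have /andP[a1 a2] := hx i; have /andP[b1 b2] := hy i.
move: a2 b2; rewrite -natr1 ltr_norml => a2 b2.
by apply/andP; split; move: a1 a2 b1 b2; rewrite !mulrDl mul1r; lra.
Qed.

(** The left side is the sum over cells of the double integral of [(f x - f y) ^+ 2]. Two points of
    one cell differ by a vector of [cube s], and each [x] lies in at most one cell, so the sum is at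
    most the double integral over all shifts in [cube s]. *)
Lemma cells_oscillation f : C1c f ->
  \sum_k (2 * s ^+ d * \int[leb]_(x in cell k) f x ^+ 2 - 2 * (\int[leb]_(x in cell k) f x) ^+ 2) <=
  (2 * s) ^+ d * (d%:R * (s ^+ 2 * dirichlet f)).
Proof.
move=> Cf; have [cf _ _ [rho sf]] := Cf.
have if1 k : leb.-integrable (cell k) (EFin \o f).
  by apply: integrableS (continuous_support_integrable cf sf) => //; exact: measurable_cell.
have if2 k : leb.-integrable (cell k) (EFin \o (fun x => f x ^+ 2)).
  apply: (@integrableS _ _ _ _ setT) => //; first exact: measurable_cell.
  apply: (@continuous_support_integrable _ _ _ rho); first exact: continuousX2_fct.
  by move=> x nx; rewrite sf// expr0n.
pose Gk k x := (\int[leb]_(y in cell k) ((f x - f y) ^+ 2)%:E)%E.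
have GE k x := integral_sqr_diff (measurable_cell k) (lebesgue_cell k) (if1 k) (if2 k) (f x).
have G0 k x : (0 <= (Gk k \_ (cell k)) x)%E.
  by apply: erestrict_ge0 => y _; apply: integral_ge0 => z _; rewrite lee_fin sqr_ge0.
have mf := continuous_measurable_rowvec cf.
have mG k : measurable_fun setT (Gk k \_ (cell k)).
  suff mGk : measurable_fun (cell k) (Gk k) by exact: (measurable_restrictT (Gk k) (measurable_cell k)).1 mGk.
  rewrite /Gk; under eq_fun do rewrite GE.
  apply/measurable_EFinP; apply: measurable_funTS.
  apply: measurable_funD; last by apply: measurable_funM => //; exact: measurable_funX.
  by apply: measurable_funD => //; exact: measurable_funM.
rewrite -lee_fin -sumEFin; apply: le_trans (shift_double_integral Cf s0).
rewrite (eq_bigr (fun k => (\int[leb]_x (Gk k \_ (cell k)) x)%E)); last first.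
  move=> k _; rewrite -integral_mkcond.
  exact/esym/(double_integral_sqr_diff (measurable_cell k) (lebesgue_cell k) (if1 k) (if2 k)).
rewrite -ge0_integral_sum//.
apply: ge0_le_integral => //.
- by move=> x _; apply: sume_ge0.
- exact: emeasurable_sum.
- apply: (measurable_fun_fubini_tonelli_F _ (measurable_shift_kernel s cf)) => p.
  by rewrite lee_fin mulr_ge0 ?sqr_ge0.
move=> x _.
have [[k0 hk0]|nk] := pselect (exists k, cell k x); last first.
  rewrite big1 => [|k _]; first by apply: integral_ge0 => z _; rewrite lee_fin mulr_ge0 ?sqr_ge0.
  by rewrite patchE memNset// => hk; apply: nk; exists k.
rewrite (bigD1 k0)//= big1 ?adde0 => [|k kk0]; last first.
  by rewrite patchE memNset// => hk; move/eqP: kk0; apply; exact: cell_inj hk hk0.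
rewrite patchE mem_set// /Gk integral_mkcond.
pose F y := ((fun y => ((f x - f y) ^+ 2)%:E) \_ (cell k0)) y.
have mF : measurable_fun setT F.
  suff mg : measurable_fun (cell k0) (fun y => ((f x - f y) ^+ 2)%:E).
    exact: (measurable_restrictT _ (measurable_cell k0)).1 mg.
  apply/measurable_EFinP; apply: measurable_funTS.
  by apply: measurable_funX; apply: measurable_funB.
have F0 y : (0 <= F y)%E by apply: erestrict_ge0 => z _; rewrite lee_fin sqr_ge0.
(* Substitution [y = z + x], after extension of the integrand by zero outside the cell. *)
rewrite -(ge0_integral_translate x mF F0).
have mshift : measurable_fun setT (fun z => f (x + z) : measurableTypeR R).
  rewrite (_ : (fun z => _) = (fun z => f (z + x))).
    exact: (measurableT_comp mf (measurable_translate x)).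
  by apply/funext => z; rewrite addrC.
apply: ge0_le_integral => //.
- by apply: (measurableT_comp mF); exact: measurable_translate.
- apply/measurable_EFinP; apply: measurable_funM; first exact: measurable_indic (measurable_cube s).
  by apply: measurable_funX; apply: measurable_funB.
move=> z _; rewrite /F patchE indicE; case: ifPn => [|_]; last by rewrite lee_fin mulr_ge0 ?sqr_ge0.
rewrite inE => hz; rewrite mem_set ?mul1r; last by have := cell_close hk0 hz; rewrite addrK.
by rewrite lee_fin -sqrrN opprB [z + x]addrC.
Qed.

Lemma cells_energy f : C1c f -> supported_in r f ->
  \int[leb]_x f x ^+ 2 <= \sum_k \int[leb]_(x in cell k) f x ^+ 2.
Proof.
move=> Cf sf; have [cf _ _ _] := Cf.
have i2 : leb.-integrable setT (EFin \o (fun x => f x ^+ 2)).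
  apply: (@continuous_support_integrable _ _ _ r); first exact: continuousX2_fct.
  by move=> x nx; rewrite sf// expr0n.
have if2 k : leb.-integrable (cell k) (EFin \o (fun x => f x ^+ 2)).
  by apply: integrableS i2 => //; exact: measurable_cell.
have mf2 := measurable_int _ i2.
pose F2 : Rd -> \bar R := EFin \o (fun x => f x ^+ 2).
have fin D : measurable D -> leb.-integrable D (EFin \o (fun x => f x ^+ 2)) ->
    (\int[leb]_(x in D) f x ^+ 2)%:E = (\int[leb]_(x in D) (f x ^+ 2)%:E)%E.
  by move=> mD iD; rewrite /Rintegral fineK//; exact: integrable_fin_num.
rewrite -lee_fin -sumEFin fin//.
rewrite (eq_bigr (fun k => (\int[leb]_x (F2 \_ (cell k)) x)%E)); last first.
  by move=> k _; rewrite -integral_mkcond fin//; exact: measurable_cell.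
have p0 k x : (0 <= (F2 \_ (cell k)) x)%E.
  by apply: erestrict_ge0 => y _; rewrite /= lee_fin sqr_ge0.
have mp k : measurable_fun setT (F2 \_ (cell k)).
  apply: (measurable_restrictT _ (measurable_cell k)).1; exact: measurable_funTS.
rewrite -ge0_integral_sum//.
apply: ge0_le_integral => //; [by move=> x _; rewrite lee_fin sqr_ge0|exact: emeasurable_sum|].
move=> x _; have [cx|ncx] := pselect (cube r x); last first.
  by rewrite sf// expr0n; apply: sume_ge0.
have [k hk] := cell_cover cx.
rewrite (bigD1 k)//= patchE mem_set//=.
by rewrite leeDl// sume_ge0.
Qed.

Lemma rellich_cells f : C1c f -> supported_in r f ->
  \int[leb]_x f x ^+ 2 <= (2 ^+ d * d%:R * s ^+ 2) * dirichlet f +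
    \sum_k (s ^+ d)^-1 * (\int[leb]_(x in cell k) f x) ^+ 2.
Proof.
move=> Cf sf; apply: le_trans (cells_energy Cf sf) _.
have om0 : 0 < s ^+ d by rewrite exprn_gt0.
have := cells_oscillation Cf; rewrite big_split/= -mulr_sumr sumrN -mulr_sumr -[in X in _ -> X]mulr_sumr.
set S := \sum_k _; set I2 := \sum_k _ => h.
rewrite -(ler_pM2l om0) mulrDr mulrA [X in _ + X]mulrA mulfV ?gt_eqF// mul1r.
have := dirichlet_ge0 f; rewrite exprMn in h.
have p0 : 0 <= s ^+ d * (2 ^+ d * d%:R * s ^+ 2) * dirichlet f by rewrite !mulr_ge0 ?dirichlet_ge0 ?sqr_ge0// ltW// exprn_gt0.
have -> : s ^+ d * (2 ^+ d * d%:R * s ^+ 2) * dirichlet f = 2 ^+ d * s ^+ d * (d%:R * (s ^+ 2 * dirichlet f)) by ring.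
move: h p0; clear; lra.
Qed.
End cells.

Section rellich.
Context {R : realType} (d : nat).
Local Notation Rd := 'rV[R]_d.
Local Notation leb := (lebesgue_rowvec d : {sigma_finite_measure set Rd -> \bar R}).

Lemma rellich_C1 (r eps : R) : 0 < r -> 0 < eps -> exists (m : nat) (Q : 'I_m -> set Rd) (c : R),
  [/\ forall j, measurable (Q j), forall j, (leb (Q j) < +oo)%E, 0 <= c &
    forall f, C1c f -> supported_in r f -> \int[leb]_x f x ^+ 2 <=
      eps * dirichlet f + \sum_j c * (\int[leb]_(x in Q j) f x) ^+ 2].
Proof.
move=> r0 e0; pose K : R := 2 ^+ d * d%:R + 1.
have K0 : 0 < K by rewrite ltr_wpDl// mulr_ge0// exprn_ge0.
(* [N] is so large that the side [s] satisfies [s <= 1] and [K * s <= eps]; the coefficient of the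
   Dirichlet term, quadratic in [s], is then at most [eps]. *)
pose N := (Num.truncn (2 * r + 2 * r * K / eps)).+1.
have N0 : 0 < N%:R :> R by [].
pose s := 2 * r / N%:R.
have s0 : 0 < s by rewrite !divr_gt0// mulr_gt0.
have Ns : N%:R * s = 2 * r by rewrite /s mulrC divfK// gt_eqF.
have hN : 2 * r + 2 * r * K / eps < N%:R by exact: truncnS_gt.
have q0 : 0 < 2 * r * K / eps by rewrite divr_gt0// !mulr_gt0.
have s1 : s <= 1 by rewrite ler_pdivrMr// mul1r; move: hN q0; lra.
have s2 : K * s <= eps.
  have : 2 * r * K / eps <= N%:R by move: hN r0; lra.
  by rewrite ler_pdivrMr// /s mulrA ler_pdivrMr// [K * _]mulrC [eps * _]mulrC.
have sK : 2 ^+ d * d%:R * s ^+ 2 <= eps.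
  have a0 : 0 <= 2 ^+ d * d%:R :> R by rewrite mulr_ge0// exprn_ge0.
  apply: le_trans s2; apply: ler_pM => //; first by rewrite sqr_ge0.
    by rewrite /K lerDl.
  by rewrite expr2 ler_piMl// ltW.
exists #|{: {ffun 'I_d -> 'I_N}}|, (fun j => cell r s (enum_val j)), (s ^+ d)^-1; split.
- by move=> j; exact: measurable_cell.
- by move=> j; rewrite [X in (X < _)%E](lebesgue_cell r s0) ltry.
- by rewrite invr_ge0 exprn_ge0// ltW.
move=> f Cf sf; apply: le_trans (rellich_cells s0 Ns Cf sf) _.
rewrite lerD ?ler_wpM2r ?dirichlet_ge0//.
by rewrite (big_enum_val (fun k => (s ^+ d)^-1 * (\int[leb]_(x in cell r s k) f x) ^+ 2)).
Qed.
End rellich.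

(** * Test functions and weak derivatives *)

Section flat_functions.
Context {R : realType}.
Implicit Types (x y z : R) (k : nat).

Definition exp_inv k y : R := y^-1 ^+ k * expR (- y^-1).

(** The classical flat function times a power of [y^-1]; the powers arise by differentiation, and
    with them the linear span of the family is closed under it. *)
Definition flat k y : R := if 0 < y then exp_inv k y else 0.

Lemma flat_ge0 k y : 0 <= flat k y.
Proof.
by rewrite /flat; case: ifP => // y0; rewrite mulr_ge0 ?expR_ge0// exprn_ge0// invr_ge0 ltW.
Qed.

(** The term of order [k.+1] in the exponential series beats the pole of order [k] and leaves one
    factor [|y|]. *)
Lemma flat_le k y : flat k y <= k.+1`!%:R * `|y|.
Proof.
rewrite /flat; case: ifPn => [y0|_]; last by rewrite mulr_ge0.
rewrite /exp_inv; set z := y^-1; have z0 : 0 < z by rewrite invr_gt0.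
have f0 : 0 < k.+1`!%:R :> R by rewrite ltr0n fact_gt0.
have h := expR_ge1Dxn k (ltW z0).
rewrite ger0_norm ?(ltW y0)// -[y]invrK -/z expRN ler_pdivrMr ?expR_gt0//.
rewrite mulrAC ler_pdivlMr// -exprSr.
rewrite -ler_pdivrMl// mulrC; apply: le_trans h; by rewrite lerDr.
Qed.

Lemma flat0_le1 y : flat 0 y <= 1.
Proof.
rewrite /flat; case: ifPn => // y0; rewrite /exp_inv expr0 mul1r expR_le1.
by rewrite oppr_le0 invr_ge0 ltW.
Qed.

Lemma flat_le0 k y : y <= 0 -> flat k y = 0.
Proof. by rewrite /flat leNgt => /negbTE ->. Qed.

Lemma is_derive_inv y : y != 0 -> is_derive y 1 (fun t : R => t^-1) (- y^-1 ^+ 2).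
Proof.
move=> y0; have := @is_deriveV R id y 1 1 y0 (is_derive_id _ _).
by move=> h; apply: is_derive_eq h _; rewrite /GRing.scale/= mulr1 exprVn.
Qed.

Lemma is_derive_exp_inv k y : y != 0 ->
  is_derive y 1 (exp_inv k) (exp_inv k.+2 y - k%:R * exp_inv k.+1 y).
Proof.
move=> y0; have dz := is_derive_inv y0.
elim: k => [|k IH].
  have dN : is_derive y 1 (fun t : R => - t^-1) (y^-1 ^+ 2).
    by apply: is_derive_eq (is_deriveN dz) _; rewrite opprK.
  have -> : exp_inv 0 = (expR \o (fun t : R => - t^-1)).
    by apply/funext => t; rewrite /exp_inv expr0 mul1r.
  have dE : is_derive (- y^-1) 1 expR (expR (- y^-1)) by exact: is_derive_expR.
  apply: is_derive_eq (@is_derive1_comp R expR (fun t => - t^-1) y _ _ dE dN) _.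
  by rewrite /exp_inv mul0r subr0 mulrC.
have -> : exp_inv k.+1 = (fun t => t^-1) * exp_inv k.
  by apply/funext => t; rewrite /exp_inv exprS -mulrA.
apply: is_derive_eq (is_deriveM dz IH) _.
by rewrite /GRing.scale/= /exp_inv -[k.+1%:R]natr1 !exprS expr0; ring.
Qed.

Lemma is_derive_flat k y : is_derive y 1 (flat k) (flat k.+2 y - k%:R * flat k.+1 y).
Proof.
have [y0|y0|->] := ltgtP y 0.
- rewrite !flat_le0 ?ltW// mulr0 subr0.
  apply: (@near_eq_is_derive _ _ _ (cst 0)) => //.
  by apply: filterS (lt_nbhsl y0) => t /ltW t0; rewrite flat_le0.
- have -> : flat k.+2 y - k%:R * flat k.+1 y = exp_inv k.+2 y - k%:R * exp_inv k.+1 y.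
    by rewrite /flat y0.
  apply: (@near_eq_is_derive _ _ _ (exp_inv k)) => //; last by apply: is_derive_exp_inv; rewrite gt_eqF.
  by apply: filterS (lt_nbhsr y0) => t t0; rewrite /flat t0.
rewrite !flat_le0// mulr0 subr0.
(* At 0 the difference quotient of [flat k] is exactly [flat k.+1], which tends to 0 by
   [flat_le]. *)
have E : (fun h : R => h^-1 *: ((flat k \o shift 0) (h *: (1 : R)) - flat k 0)) = flat k.+1.
  apply/funext => h; rewrite /= addr0 [h *: 1]mulr1 (flat_le0 _ (lexx 0)) subr0 /GRing.scale/= /flat.
  by case: ifP => _; rewrite ?mulr0// /exp_inv exprS -mulrA.
have c0 : flat k.+1 @ 0^' --> (0 : R).
  apply: cvg_within_filter; apply: (@squeeze_cvgr _ _ _ _ (cst 0) (fun t => k.+2`!%:R * `|t|)).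
  - by apply: nearW => t; rewrite flat_ge0 flat_le.
  - exact: cvg_cst.
  have h : (fun t : R => k.+2`!%:R * `|t|) @ (0 : R) --> k.+2`!%:R * `|0 : R|.
    by apply: cvgMl_tmp; apply: cvg_norm; exact: cvg_id.
  by rewrite normr0 mulr0 in h; exact: h.
apply: DeriveDef; first by rewrite /derivable E; apply/cvg_ex; exists 0.
by rewrite /derive E; apply/cvg_lim; [exact: norm_hausdorff|exact: c0].
Qed.

Lemma flat_scale_cvg (y : R) : 0 < y -> (fun n : nat => flat 0 (n.+1%:R * y)) @ \oo --> (1 : R).
Proof.
move=> y0.
have E : (fun n : nat => flat 0 (n.+1%:R * y)) = (fun n => expR (- (n.+1%:R^-1 * y^-1))).
  by apply/funext => n; rewrite /flat ifT ?mulr_gt0// /exp_inv expr0 mul1r invfM.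
rewrite E.
have h : (fun n : nat => - (n.+1%:R^-1 * y^-1)) @ \oo --> - (0 * y^-1).
  by apply: cvgN; apply: cvgMr_tmp; exact: cvg_harmonic.
rewrite mul0r oppr0 in h.
by have := continuous_cvg _ (@continuous_expR R 0) h; rewrite expR0; apply.
Qed.
End flat_functions.

(** * Smooth bumps on boxes *)

Section smooth_bumps.
Context {R : realType} (d : nat).
Local Notation Rd := 'rV[R]_d.
Local Notation e_ i := (delta_mx 0 i : Rd).
Implicit Types (f g : Rd -> R) (a b x : Rd).

(* Stable under partial derivatives, which makes all its members smooth. *)
Inductive flat_alg : (Rd -> R) -> Prop :=
| flat_alg_flat k (c s : R) i : flat_alg (fun x => flat k (s * x 0 i + c))
| flat_alg_cst c : flat_alg (fun=> c)
| flat_alg_add f g : flat_alg f -> flat_alg g -> flat_alg (fun x => f x + g x)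
| flat_alg_mul f g : flat_alg f -> flat_alg g -> flat_alg (fun x => f x * g x).

Lemma is_derive_of_line f x (v : Rd) (l : R) :
  is_derive (0 : R) 1 (fun h : R => f (h *: v + x) : R^o) l -> is_derive x v (f : Rd -> R^o) l.
Proof.
pose g : R -> R^o := fun h => f (h *: v + x); rewrite -/g.
have E : (fun h : R => h^-1 *: ((g \o shift 0) (h *: (1 : R)) - g 0)) =
    (fun h : R => h^-1 *: (((f : Rd -> R^o) \o shift x) (h *: v) - (f : Rd -> R^o) x)).
  apply/funext => h; rewrite /g /=; congr (_ *: (f _ - f _)).
    by rewrite addr0 [_ *: 1]mulr1.
  by rewrite scale0r add0r.
move=> [h1 h2]; apply: DeriveDef; first by rewrite /derivable -E; exact: h1.
by rewrite /derive -E; exact: h2.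
Qed.

Lemma flat_alg_partial f : flat_alg f -> continuous f /\ forall j, exists2 g, flat_alg g &
  forall x, is_derive x (e_ j) (f : Rd -> R^o) (g x).
Proof.
elim=> {f} [k c s i|c|f g hf0 [cf hf] hg0 [cg hg]|f g hf0 [cf hf] hg0 [cg hg]].
- split.
    have cflat : continuous (flat k : R -> R).
      move=> y; apply/differentiable_continuous/derivable1_diffP.
      exact: (@ex_derive _ _ _ _ _ _ _ (is_derive_flat k y)).
    have clin : continuous (fun x : Rd => s * x 0 i + c).
      move=> x; have h : (fun x : Rd => s * x 0 i + c) @ x --> s * x 0 i + c.
        apply: (@cvgD _ _ _ (nbhs x) _ (fun x : Rd => s * x 0 i) (cst c)); last exact: cvg_cst.
        exact: (@cvgMl_tmp _ _ (nbhs x) _ (fun x : Rd => x 0 i) s _ (@coord_continuous R 1 d 0 i x)).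
      exact: h.
    by move=> x; apply: (@continuous_comp _ _ _ (fun x : Rd => s * x 0 i + c) (flat k)); [exact: clin|exact: cflat].
  move=> j; exists (fun x => (s * (i == j)%:R) * (flat k.+2 (s * x 0 i + c) + - k%:R * flat k.+1 (s * x 0 i + c))).
    apply: flat_alg_mul; first exact: flat_alg_cst.
    by apply: flat_alg_add; [exact: flat_alg_flat|apply: flat_alg_mul; [exact: flat_alg_cst|exact: flat_alg_flat]].
  move=> x; apply: is_derive_of_line.
  have dl : is_derive (0 : R) 1 (fun h : R => (s * (i == j)%:R) * h + (s * x 0 i + c)) (s * (i == j)%:R).
    have h1 := is_deriveD (is_deriveZ (s * (i == j)%:R) (is_derive_id (0 : R) 1)) (is_derive_cst (s * x 0 i + c) (0 : R) 1).
    by apply: is_derive_eq h1 _; rewrite addr0 /GRing.scale/= mulr1.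
  have E : (fun h : R => flat k (s * (h *: e_ j + x) 0 i + c)) =
      flat k \o (fun h : R => (s * (i == j)%:R) * h + (s * x 0 i + c)).
    by apply/funext => h /=; congr flat; rewrite !mxE eqxx/=; ring.
  rewrite E; have df := is_derive_flat k ((s * (i == j)%:R) * 0 + (s * x 0 i + c)).
  have := @is_derive1_comp R (flat k) (fun h : R => (s * (i == j)%:R) * h + (s * x 0 i + c)) 0 _ _ df dl; rewrite mulr0 add0r => h.
  rewrite [X in is_derive _ _ _ X](_ : _ = (flat k.+2 (s * x 0 i + c) - k%:R * flat k.+1 (s * x 0 i + c)) * (s * (i == j)%:R)).
    exact: h.
  by rewrite mulNr mulrC.
- split; first exact: cst_continuous.
  by move=> j; exists (fun=> 0); [exact: flat_alg_cst|move=> x; exact: is_derive_cst].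
- split; first by move=> x; exact: (@cvgD _ _ _ (nbhs x) _ _ _ _ _ (cf x) (cg x)).
  move=> j; have [f' hf' df] := hf j; have [g' hg' dg] := hg j.
  by exists (fun x => f' x + g' x); [exact: flat_alg_add|move=> x; exact: is_deriveD (df x) (dg x)].
split; first exact: continuousM_fct.
move=> j; have [f' hf' df] := hf j; have [g' hg' dg] := hg j.
exists (fun x => f x * g' x + g x * f' x); last by move=> x; exact: is_deriveM (df x) (dg x).
by apply: flat_alg_add; exact: flat_alg_mul.
Qed.

Lemma flat_alg_iter_partial f (s : seq 'I_d) : flat_alg f -> flat_alg (iter_partial s f).
Proof.
move=> hf; elim: s => [//|i s /flat_alg_partial[_ /(_ i)[g hg dg]]] /=.
rewrite (_ : partial i _ = g)//; apply/funext => x.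
by rewrite /partial; have [_ ->] := dg x.
Qed.

Lemma flat_alg_smooth f : flat_alg f -> smooth f.
Proof.
move=> hf s; have [cf df] := flat_alg_partial (flat_alg_iter_partial s hf).
by split=> // i x; have [g _ dg] := df i; have [] := dg x.
Qed.

Lemma flat_alg_prod (I : Type) (r : seq I) (F : I -> Rd -> R) :
  (forall i, flat_alg (F i)) -> flat_alg (fun x => \prod_(i <- r) F i x).
Proof.
move=> hF; elim: r => [|i r IH].
  by under eq_fun do rewrite big_nil; exact: flat_alg_cst.
by under eq_fun do rewrite big_cons; exact: flat_alg_mul.
Qed.

(** One flat factor for each face of the box; [n.+1] steepens them, so that the bumps converge to
    the indicator of the open box. *)
Definition bump (n : nat) a b x : R :=
  \prod_i (flat 0 (n.+1%:R * (x 0 i - a 0 i)) * flat 0 (n.+1%:R * (b 0 i - x 0 i))).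

Lemma bump_smooth n a b : smooth (bump n a b).
Proof.
apply: flat_alg_smooth; apply: flat_alg_prod => i.
rewrite (_ : (fun x => _) = (fun x : Rd => flat 0 (n.+1%:R * x 0 i + - (n.+1%:R * a 0 i)) *
   flat 0 (- n.+1%:R * x 0 i + n.+1%:R * b 0 i))).
  by apply: flat_alg_mul; exact: flat_alg_flat.
by apply/funext => x; congr (flat _ _ * flat _ _); ring.
Qed.

Lemma bump_ge0 n a b x : 0 <= bump n a b x.
Proof. by apply: prodr_ge0 => i _; rewrite mulr_ge0 ?flat_ge0. Qed.

Lemma bump_le1 n a b x : bump n a b x <= 1.
Proof.
apply: prodr_ile1 => i _; rewrite mulr_ge0 ?flat_ge0//=.
by rewrite mulr_ile1 ?flat_ge0 ?flat0_le1.
Qed.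

Lemma bump_out n a b x : ~ obox a b x -> bump n a b x = 0.
Proof.
move=> /existsNP[i /negP h]; rewrite /bump (bigD1 i)//=.
suff -> : flat 0 (n.+1%:R * (x 0 i - a 0 i)) * flat 0 (n.+1%:R * (b 0 i - x 0 i)) = 0 by rewrite mul0r.
move: h; rewrite negb_and -!leNgt => /orP[h|h]; [rewrite [X in X * _]flat_le0 ?mul0r//|rewrite [X in _ * X]flat_le0 ?mulr0//].
  by rewrite pmulr_rle0// subr_le0.
by rewrite pmulr_rle0// subr_le0.
Qed.

Lemma cvg_prod_seq (I : Type) (r : seq I) (F : I -> nat -> R) (l : I -> R) :
  (forall i, F i @ \oo --> l i) -> (fun n => \prod_(i <- r) F i n) @ \oo --> \prod_(i <- r) l i.
Proof.
move=> hF; elim: r => [|i r IH].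
  rewrite big_nil (_ : (fun n => _) = (fun=> 1)); first exact: cvg_cst.
  by apply/funext => n; rewrite big_nil.
rewrite big_cons (_ : (fun n => _) = (fun n => F i n * \prod_(j <- r) F j n)).
  exact: cvgM (hF i) IH.
by apply/funext => n; rewrite big_cons.
Qed.

Lemma bump_cvg a b x : (fun n => bump n a b x) @ \oo --> (\1_(obox a b) x : R).
Proof.
rewrite indicE; have [xab|nx] := boolP (x \in _); last first.
  rewrite (_ : (fun n => _) = (fun=> 0)); first exact: cvg_cst.
  by apply/funext => n; apply: bump_out => h; move/negP: nx; apply; rewrite inE.
rewrite inE in xab.
rewrite (_ : (true%:R : R) = \prod_(i < d) (1 * 1)); last by rewrite big1// => i _; rewrite mulr1.
apply: cvg_prod_seq => i; have /andP[ax xb] := xab i.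
by apply: cvgM; apply: flat_scale_cvg; rewrite subr_gt0.
Qed.

Lemma test_bump (Omega : set Rd) n a b : cbox a b `<=` Omega -> test_function Omega (bump n a b).
Proof.
move=> abO; split; first exact: bump_smooth.
exists (cbox a b); split => //; first exact: compact_cbox.
by move=> x nx; apply: bump_out => /obox_cbox.
Qed.
End smooth_bumps.

(** * The fundamental lemma of the calculus of variations *)

Lemma Rintegral_support d (T : measurableType d) (R : realType) (mu : {measure set T -> \bar R})
    (D E : set T) (f : T -> R) : D `<=` E -> (forall x, ~ D x -> f x = 0) ->
  \int[mu]_(x in D) f x = \int[mu]_(x in E) f x.
Proof.
move=> DE f0; rewrite Rintegral_mkcond [RHS]Rintegral_mkcond.
congr (fine (integral _ _ _)); apply/funext => x /=; rewrite !patchE.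
have [xD|xD] := boolP (x \in D).
  by rewrite inE in xD; rewrite mem_set//; exact: DE.
by rewrite f0 ?if_same// => Dx; move/negP: xD; apply; rewrite inE.
Qed.

Section fundamental_lemma.
Context {R : realType} (d : nat).
Local Notation Rd := 'rV[R]_d.
Local Notation leb := (lebesgue_rowvec d : {sigma_finite_measure set Rd -> \bar R}).
Context (Omega : set Rd) (oO : open Omega) (g : Rd -> R) (Lg : sqint leb Omega g).
Context (g0 : forall phi, test_function Omega phi -> \int[leb]_(x in Omega) (g x * phi x) = 0).

Let mO : measurable Omega. Proof. exact: open_measurable_rowvec. Qed.

Lemma sqintS (D E : set Rd) (f : Rd -> R) : measurable D -> measurable E -> D `<=` E ->
  sqint leb E f -> sqint leb D f.
Proof. by move=> mD mE DE [h1 h2]; split; [exact: measurable_funS h1|exact: integrableS h2]. Qed.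

Lemma box_integrable (a b : Rd) : cbox a b `<=` Omega -> leb.-integrable (obox a b) (EFin \o g).
Proof.
move=> abO; have mB := measurable_obox a b.
have bO : obox a b `<=` Omega by move=> x /obox_cbox; exact: abO.
have L1 : sqint leb (obox a b) (fun=> 1).
  split; first exact: measurable_cst.
  apply: (@measurable_bounded_integrable _ _ _ leb (fun=> 1 ^+ 2)) => //.
  - exact: lebesgue_obox_lty.
  - exact: bounded_cst.
have := sqint_integrableM mB (sqintS mB mO bO Lg) L1.
by apply: eq_integrable => // x _; rewrite /= mulr1.
Qed.

Lemma box_integral0 (a b : Rd) : cbox a b `<=` Omega -> \int[leb]_(x in obox a b) g x = 0.
Proof.
move=> abO; have mB := measurable_obox a b.
have bO : obox a b `<=` Omega by move=> x /obox_cbox; exact: abO.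
have ig := box_integrable abO.
have mg : measurable_fun (obox a b) (g : Rd -> measurableTypeR R).
  exact: (sqintS mB mO bO Lg).1.
have h0 n : \int[leb]_(x in obox a b) (g x * bump n a b x) = 0.
  rewrite (Rintegral_support leb bO) ?g0//; first exact: test_bump.
  by move=> x nx; rewrite bump_out// mulr0.
have mbump n : measurable_fun setT (bump n a b : Rd -> measurableTypeR R).
  by apply: continuous_measurable_rowvec; exact: (bump_smooth n a b [::]).1.
have mgb n : measurable_fun (obox a b) (fun x => (g x * bump n a b x)%:E).
  apply/measurable_EFinP; apply: measurable_funM => //; apply: measurable_funTS; exact: mbump.
have ae1 : {ae leb, forall x, obox a b x -> (fun n => (g x * bump n a b x)%:E) @ \oo --> (g x)%:E}.
  apply: aeW => x bx; apply: cvg_EFin; first exact: nearW.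
  have h := @bump_cvg R d a b x; rewrite indicE mem_set// in h.
  have h2 : (fun n => g x * bump n a b x) @ \oo --> g x * 1 by exact: cvgMl_tmp.
  by rewrite mulr1 in h2; exact: h2.
have ae2 : {ae leb, forall x n, obox a b x -> (`|(g x * bump n a b x)%:E| <= (abse \o (EFin \o g)) x)%E}.
  apply: aeW => x n _ /=; rewrite lee_fin normrM (ger0_norm (bump_ge0 _ _ _ _)).
  by rewrite ler_piMr// bump_le1.
have mgE : measurable_fun (obox a b) (EFin \o g) by exact/measurable_EFinP.
have [_ _ h] := @dominated_convergence _ _ _ leb _ mB (fun n x => (g x * bump n a b x)%:E)
  (EFin \o g) (abse \o (EFin \o g)) mgb mgE ae1 (integrable_abse ig) ae2.
have hf : (fun n => \int[leb]_(x in obox a b) (g x * bump n a b x)) @ \oo --> \int[leb]_(x in obox a b) g x.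
  by apply: fine_cvg; rewrite fineK; [exact: h|exact: integrable_fin_num].
move/cvg_lim: hf => <-//; rewrite (_ : (fun n => _) = (fun=> 0)); first exact: lim_cst.
by apply/funext.
Qed.

(** Open boxes form a pi-system, so by Dynkin's theorem the vanishing of integrals over sub-boxes
    spreads to all measurable subsets, and [g] vanishes almost everywhere. *)
Lemma box_ae0 (a b : Rd) : cbox a b `<=` Omega -> {ae leb, forall x, obox a b x -> g x = 0}.
Proof.
move=> abO; have mB := measurable_obox a b.
have ig := box_integrable abO.
have boxE a' b' : cbox a' b' `<=` Omega -> (\int[leb]_(x in obox a' b') (g x)%:E = 0)%E.
  move=> h; rewrite -[LHS]fineK; last by apply: integrable_fin_num; [exact: measurable_obox|exact: box_integrable].
  by congr EFin; exact: box_integral0.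
have igS A : measurable A -> leb.-integrable (A `&` obox a b) (EFin \o g).
  move=> mA; apply: integrableS ig => //; exact: measurableI.
have key A : measurable A -> (\int[leb]_(x in A `&` obox a b) (g x)%:E = 0)%E.
  have := @dynkin_induction _ Rd (@oboxes R d) (fun A => (\int[leb]_(x in A `&` obox a b) (g x)%:E = 0)%E)
    (measurable_oboxes d) (@setI_closed_oboxes _ _).
  rewrite -measurable_oboxes; apply.
  - by rewrite setTI boxE.
  - move=> _ [a' [b' ->]]; rewrite setIC oboxI boxE// => x hx; apply: abO => i.
    by have := hx i; rewrite !mxE ge_max le_min => /andP[/andP[-> _] /andP[-> _]].
  - move=> S mS hS; have := boxE a b abO.
    rewrite -[X in integral _ X _ = _ -> _](setIidr (@subsetT _ (obox a b))) -(setUv S) setIUl.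
    rewrite integral_setU//; first by rewrite hS add0e.
    + exact: measurableI.
    + by apply: measurableI => //; exact: measurableC.
    + rewrite -setIUl setUv setTI; exact: (measurable_int leb).
    + by rewrite disj_set2E setIACA setICr set0I.
  move=> F mF tF hF; rewrite setI_bigcupl integral_bigcup//.
  - by rewrite eseries0// => i _ _; exact: hF.
  - by move=> i j _ _ [x [[Fi _] [Fj _]]]; apply: tF => //; exists x.
  - by move=> k; exact: measurableI.
  by rewrite -setI_bigcupl; apply: igS; exact: bigcupT_measurable.
have h := @integral_ae_eq _ _ _ leb (obox a b) mB (cst 0%E) (EFin \o g) ig (measurable_cst _).
apply: filterS (h _) => [x hx bx|E EB mE]; first by have [] := hx bx.
by rewrite integral0 -[X in integral _ X _](setIidl EB); exact: key.
Qed.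

(** Countably many rational boxes cover [Omega], so their exceptional sets still form a null set;
    [unpickle] enumerates the pairs of corners. *)
Lemma fundamental_lemma : {ae leb, forall x, Omega x -> g x = 0}.
Proof.
pose P (n : nat) (x : Rd) := if unpickle n is Some p then
   cbox (map_mx ratr (p : 'rV[rat]_d * 'rV[rat]_d).1) (map_mx ratr p.2) `<=` Omega ->
   obox (map_mx ratr p.1) (map_mx ratr p.2) x -> g x = 0 else True.
have /ae_foralln : forall n, {ae leb, forall x, P n x}.
  move=> n; rewrite /P; case: unpickle => [[a b]/=|]; last exact: aeW.
  have [h|h] := pselect (cbox (map_mx ratr a) (map_mx ratr b) `<=` Omega); last by apply: aeW => x /h.
  by apply: filterS (box_ae0 h) => x hx _; exact: hx.
apply: filterS => x hx Ox.
have [a [b [h1 h2]]] := rat_box_between oO Ox.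
by have := hx (pickle (a, b)); rewrite /P pickleK; apply.
Qed.
End fundamental_lemma.

(** * Test functions and integration by parts *)

Section test_functions.
Context {R : realType} (d : nat).
Local Notation Rd := 'rV[R]_d.
Local Notation leb := (lebesgue_rowvec d : {sigma_finite_measure set Rd -> \bar R}).
Local Notation e_ i := (delta_mx 0 i : Rd).
Implicit Types (f g u v phi psi : Rd -> R) (Omega : set Rd).

Lemma coord_le_norm (x : Rd) i : `|x 0 i| <= `|x|.
Proof. by rewrite /Num.norm/= mx_normrE; apply: (@le_bigmax _ _ _ _ (fun ij => `|x ij.1 ij.2|) (0, i)). Qed.

Lemma bounded_cube (K : set Rd) : bounded_set K -> exists2 r : R, 0 < r & K `<=` cube r.
Proof.
move=> [M [_ hM]]; exists (`|M| + 2) => [|x Kx]; first by rewrite ltr_wpDl.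
apply/cubeP => i; apply: (@le_lt_trans _ _ (`|M| + 1)); last by rewrite ltrD2l ltr1n.
rewrite (le_trans (coord_le_norm x i))//; apply: hM => //.
by rewrite (le_lt_trans (ler_norm M))// ltrDl.
Qed.

Lemma test_C1c Omega phi : test_function Omega phi -> C1c phi.
Proof.
move=> [sm [K [cK KO K0]]]; split.
- exact: (sm [::]).1.
- by move=> i x; exact: (sm [::]).2.
- by move=> i; exact: (sm [:: i]).1.
have [r _ Kr] := bounded_cube (compact_bounded cK).
by exists r => x nx; apply: K0 => /Kr.
Qed.

Lemma test_out Omega phi x : test_function Omega phi -> ~ Omega x -> phi x = 0.
Proof. by move=> [_ [K [_ KO K0]]] nx; apply: K0 => /KO. Qed.

Lemma C1cM f g : C1c f -> C1c g -> C1c (fun x => f x * g x) /\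
  forall i x, partial i (fun x => f x * g x) x = f x * partial i g x + g x * partial i f x.
Proof.
move=> [cf df cpf [r sf]] [cg dg cpg _].
have pE i x : partial i (fun x => f x * g x) x = f x * partial i g x + g x * partial i f x.
  by have := @deriveM _ _ (f : Rd -> R^o) g x (e_ i) (df i x) (dg i x).
split; last exact: pE.
split.
- exact: continuousM_fct.
- by move=> i x; exact: derivableM.
- move=> i x; rewrite (_ : partial i _ = fun x => f x * partial i g x + g x * partial i f x); last exact/funext.
  apply: (@cvgD _ _ _ (nbhs x)); [exact: (continuousM_fct cf (cpg i))|exact: (continuousM_fct cg (cpf i))].
by exists r => x nx; rewrite sf// mul0r.
Qed.

Lemma C1c_sqint f D : C1c f -> measurable D -> sqint leb D f.
Proof.
move=> [cf _ _ [r sf]] mD; have mf := continuous_measurable_rowvec cf.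
split; first exact: measurable_funTS.
apply: (@integrableS _ _ _ _ setT) => //.
apply: (@continuous_support_integrable _ _ _ r); first exact: continuousX2_fct.
by move=> x nx; rewrite sf// expr0n.
Qed.

Lemma C1c_partial_sqint f D i : C1c f -> measurable D -> sqint leb D (partial i f).
Proof.
move=> Cf mD; have [cf _ cpf _] := Cf; have [r [_ sp]] := C1c_support Cf.
have mp := continuous_measurable_rowvec (cpf i).
split; first exact: measurable_funTS.
apply: (@integrableS _ _ _ _ setT) => //.
apply: (@continuous_support_integrable _ _ _ r); first exact: continuousX2_fct.
by move=> x nx; rewrite sp// expr0n.
Qed.

Lemma C1c_integration_by_parts f g i : C1c f -> C1c g ->
  \int[leb]_x (f x * partial i g x) = - \int[leb]_x (partial i f x * g x).
Proof.
move=> Cf Cg; have [Cfg pE] := C1cM Cf Cg.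
have := integral_partial0 i Cfg; under eq_Rintegral do rewrite pE.
rewrite RintegralD//; last 2 first.
- by apply: sqint_integrableM => //; [exact: C1c_sqint|exact: C1c_partial_sqint].
- by apply: sqint_integrableM => //; [exact: C1c_sqint|exact: C1c_partial_sqint].
by under [X in _ + X = _ -> _]eq_Rintegral do rewrite mulrC; move/eqP; rewrite addr_eq0 => /eqP.
Qed.

Lemma smooth_lin (c : R) f g : smooth f -> smooth g -> smooth (fun x => c * f x + g x).
Proof.
move=> hf hg.
have E s : iter_partial s (fun x => c * f x + g x) = (fun x => c * iter_partial s f x + iter_partial s g x).
  elim: s => [//|i s /= ->]; apply/funext => x; rewrite /partial.
  have dcf : derivable ((fun x => c * iter_partial s f x) : Rd -> R^o) x (e_ i).
    by have := @derivableZ _ _ _ (iter_partial s f : Rd -> R^o) c x (e_ i) ((hf s).2 i x).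
  have := @deriveD _ _ _ ((fun x => c * iter_partial s f x) : Rd -> R^o) (iter_partial s g) x (e_ i) dcf ((hg s).2 i x).
  move=> ->; congr (_ + _).
  by have := @deriveZ _ _ _ (iter_partial s f : Rd -> R^o) c x (e_ i) ((hf s).2 i x).
move=> s; rewrite E; split.
  move=> x; apply: (@cvgD _ _ _ (nbhs x)); last exact: (hg s).1.
  by apply: (@cvgMl_tmp _ _ (nbhs x)); exact: (hf s).1.
move=> i x; apply: (@derivableD _ _ _ ((fun x => c * iter_partial s f x) : Rd -> R^o)); last exact: (hg s).2.
by have := @derivableZ _ _ _ (iter_partial s f : Rd -> R^o) c x (e_ i) ((hf s).2 i x).
Qed.

Lemma test_lin Omega (c : R) f g : test_function Omega f -> test_function Omega g ->
  test_function Omega (fun x => c * f x + g x).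
Proof.
move=> [sf [K [cK KO K0]]] [sg [L [cL LO L0]]]; split; first exact: smooth_lin.
exists (K `|` L); split; first exact: compactU.
  by move=> x [/KO|/LO].
by move=> x /not_orP[nk nl]; rewrite K0// L0// mulr0 addr0.
Qed.

Lemma test_cst0 Omega : test_function Omega (fun=> 0).
Proof.
split; last by exists set0; split=> //; exact: compact0.
have E s : iter_partial s (fun=> 0) = (fun=> 0) :> (Rd -> R).
  elim: s => [//|i s /= ->]; apply/funext => x.
  by rewrite /partial; exact: derive_cst.
by move=> s; rewrite E; split=> [|i x]; [exact: cst_continuous|exact: derivable_cst].
Qed.
End test_functions.

(** * Weak derivatives and the forms on H1 *)

Section sobolev_forms.
Context {R : realType} (d : nat).
Local Notation Rd := 'rV[R]_d.
Local Notation leb := (lebesgue_rowvec d : {sigma_finite_measure set Rd -> \bar R}).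
Context (Omega : set Rd) (oO : open Omega).
Implicit Types (f g u v w phi psi : Rd -> R) (c : R).

Local Notation mO := (open_measurable_rowvec oO).
Local Notation ipO := (ip leb Omega).

Lemma bformE u v : bform Omega u v = ipO u v. Proof. by []. Qed.

Lemma test_partial_sqint phi i : test_function Omega phi -> sqint leb Omega (partial i phi).
Proof. by move=> /test_C1c Cp; exact: C1c_partial_sqint Cp mO. Qed.

Lemma test_sqint phi : test_function Omega phi -> sqint leb Omega phi.
Proof. by move=> /test_C1c Cp; exact: C1c_sqint Cp mO. Qed.

Lemma weak_partial_unique i u g h : L2 Omega g -> L2 Omega h ->
  weak_partial Omega i u g -> weak_partial Omega i u h -> {ae leb, forall x, Omega x -> g x = h x}.
Proof.
move=> Lg Lh hg hh.
have := @fundamental_lemma R d Omega oO (fun x => g x - h x) (sqintB mO Lg Lh).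
have H phi : test_function Omega phi -> \int[leb]_(x in Omega) ((g x - h x) * phi x) = 0.
  move=> tp; have Lp := test_sqint tp.
  under eq_Rintegral do rewrite mulrBl.
  rewrite RintegralB; [|exact: mO|exact: (sqint_integrableM mO)|exact: (sqint_integrableM mO)].
  by apply/eqP; rewrite subr_eq0 -eqr_opp -hg// -hh.
move/(_ H); apply: filterS => x hx Ox; apply/eqP; rewrite -subr_eq0; apply/eqP; exact: hx.
Qed.

Lemma weak_partial_lin i c u v g h : L2 Omega u -> L2 Omega v -> L2 Omega g -> L2 Omega h ->
  weak_partial Omega i u g -> weak_partial Omega i v h ->
  weak_partial Omega i (fun x => c * u x + v x) (fun x => c * g x + h x).
Proof.
move=> Lu Lv Lg Lh hg hh phi tp.
have Lp := test_sqint tp; have Ldp := test_partial_sqint i tp.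
rewrite -/(ipO (fun x => c * u x + v x) (partial i phi)) -/(ipO (fun x => c * g x + h x) phi).
rewrite (ip_lin mO)// (ip_lin mO)// /ip hg// hh//; ring.
Qed.

Lemma test_weak_partial phi i : test_function Omega phi -> weak_partial Omega i phi (partial i phi).
Proof.
move=> tp psi ts.
rewrite (Rintegral_support leb (@subsetT _ Omega)); last by move=> x nx; rewrite (test_out tp nx) mul0r.
rewrite [in RHS](Rintegral_support leb (@subsetT _ Omega)); last by move=> x nx; rewrite (test_out ts nx) mulr0.
exact: C1c_integration_by_parts (test_C1c tp) (test_C1c ts).
Qed.

Lemma test_H1 phi : test_function Omega phi -> H1 Omega phi.
Proof.
move=> tp; split; first exact: test_sqint.
by move=> i; exists (partial i phi); split; [exact: test_partial_sqint|exact: test_weak_partial].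
Qed.

Lemma wgradP i u : H1 Omega u -> L2 Omega (wgrad Omega i u) /\ weak_partial Omega i u (wgrad Omega i u).
Proof.
by move=> [_ /(_ i)]; exact: (@xgetPex _ (fun=> 0) [set g | L2 Omega g /\ weak_partial Omega i u g]).
Qed.

Lemma aformE u v : H1 Omega u -> H1 Omega v ->
  aform Omega u v = \sum_i ipO (wgrad Omega i u) (wgrad Omega i v).
Proof.
move=> Hu Hv; rewrite /aform /ip.
have ii i : leb.-integrable Omega (EFin \o (fun x => wgrad Omega i u x * wgrad Omega i v x)).
  by apply: sqint_integrableM; [exact: mO|exact: (wgradP i Hu).1|exact: (wgradP i Hv).1].
rewrite /Rintegral sum_fine; last by move=> i _; exact: (integrable_fin_num mO (ii i)).
by congr fine; rewrite -integral_sum//; [apply: eq_integral => x _; rewrite -sumEFin|exact: mO].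
Qed.

(** [wgrad] is a choice and respects linear combinations only almost everywhere. By uniqueness of
    weak derivatives any family of them computes the form; bilinearity comes from here. *)
Lemma aform_weak u v (g h : 'I_d -> Rd -> R) : H1 Omega u -> H1 Omega v ->
  (forall i, L2 Omega (g i) /\ weak_partial Omega i u (g i)) ->
  (forall i, L2 Omega (h i) /\ weak_partial Omega i v (h i)) ->
  aform Omega u v = \sum_i ipO (g i) (h i).
Proof.
move=> Hu Hv hg hh; rewrite aformE//; apply: eq_bigr => i _.
have [Lu wu] := wgradP i Hu; have [Lv wv] := wgradP i Hv.
have [Lg wg] := hg i; have [Lh wh] := hh i.
rewrite (ip_ae_eq mO Lu Lg Lv (weak_partial_unique Lu Lg wu wg)).
by rewrite ipC (ip_ae_eq mO Lv Lh Lg (weak_partial_unique Lv Lh wv wh)) ipC.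
Qed.

Lemma aformC u v : aform Omega u v = aform Omega v u.
Proof. by apply: eq_Rintegral => x _; apply: eq_bigr => i _; rewrite mulrC. Qed.

Lemma aform_ge0 u : 0 <= aform Omega u u.
Proof. by apply: Rintegral_ge0 => x _; apply: sumr_ge0 => i _; rewrite -expr2 sqr_ge0. Qed.

Lemma H1_lin c u v : H1 Omega u -> H1 Omega v -> H1 Omega (fun x => c * u x + v x).
Proof.
move=> Hu Hv; split; first exact: (sqint_lin mO c Hu.1 Hv.1).
move=> i; have [Lu wu] := wgradP i Hu; have [Lv wv] := wgradP i Hv.
exists (fun x => c * wgrad Omega i u x + wgrad Omega i v x); split; first exact: (sqint_lin mO c Lu Lv).
exact: weak_partial_lin Hu.1 Hv.1 Lu Lv wu wv.
Qed.

Lemma aform_lin c u v w : H1 Omega u -> H1 Omega v -> H1 Omega w ->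
  aform Omega (fun x => c * u x + v x) w = c * aform Omega u w + aform Omega v w.
Proof.
move=> Hu Hv Hw.
rewrite (@aform_weak _ _ (fun i x => c * wgrad Omega i u x + wgrad Omega i v x) (fun i => wgrad Omega i w)) //.
- rewrite !aformE// mulr_sumr -big_split/=; apply: eq_bigr => i _.
  by rewrite (ip_lin mO)//; [exact: (wgradP i Hu).1|exact: (wgradP i Hv).1|exact: (wgradP i Hw).1].
- exact: H1_lin.
- move=> i; have [Lu wu] := wgradP i Hu; have [Lv wv] := wgradP i Hv; split; first exact: (sqint_lin mO c Lu Lv).
  exact: weak_partial_lin Hu.1 Hv.1 Lu Lv wu wv.
- by move=> i; exact: wgradP.
Qed.

Lemma bform_lin c u v w : L2 Omega u -> L2 Omega v -> L2 Omega w ->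
  bform Omega (fun x => c * u x + v x) w = c * bform Omega u w + bform Omega v w.
Proof. by move=> Lu Lv Lw; exact: (ip_lin mO). Qed.
End sobolev_forms.

(** Both seminorms are continuous for [h], so they may be compared on the dense set [S]. This
    extends the inequalities of Poincare and Rellich from test functions to all of [H01]. *)
Lemma form_le_dense (R : realType) (V : lmodType R) (h q1 q2 : V -> V -> R) (S : set V) (K : R) :
  psd h -> psd q1 -> psd q2 -> (forall v, q1 v v <= K * h v v) -> (forall v, q2 v v <= K * h v v) ->
  (forall u e, 0 < e -> exists2 s, S s & h (u - s) (u - s) < e) ->
  (forall s, S s -> q1 s s <= q2 s s) -> forall u, q1 u u <= q2 u u.
Proof.
move=> ph p1 p2 h1 h2 dS le12 u.
suff le12u : fnorm q1 u <= fnorm q2 u.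
  by rewrite -(fnorm_sqr p1) -(fnorm_sqr p2) lerXn2r ?nnegrE ?fnorm_ge0.
apply/ler_addgt0Pr => e e0.
pose K' := Num.max K 0 + 1; have K0 : 0 < K' by rewrite ltr_wpDl// le_max lexx orbT.
have [s Ss hs] := dS u ((e / 2) ^+ 2 / K') ltac:(by rewrite divr_gt0// exprn_gt0// divr_gt0).
have small q : (forall v, q v v <= K * h v v) -> fnorm q (u - s) <= e / 2.
  move=> hq; apply: fnorm_le; first by rewrite divr_ge0// ltW.
  apply: le_trans (hq _) _; apply: (@le_trans _ _ (K' * h (u - s) (u - s))).
    by rewrite ler_wpM2r ?ph.2// (@le_trans _ _ (Num.max K 0)) ?le_max ?lexx// lerDl.
  by rewrite mulrC -ler_pdivlMr// ltW.
have s1 := small q1 h1; have s2 := small q2 h2.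
have t1 : fnorm q1 u <= fnorm q1 (u - s) + fnorm q1 s by rewrite -{1}[u](subrK s) fnormD.
have t2 : fnorm q2 s <= fnorm q2 u + fnorm q2 (u - s).
  by rewrite -{1}[s](subKr u) fnormB.
have t3 : fnorm q1 s <= fnorm q2 s by rewrite ler_wsqrtr// le12.
by move: s1 s2 t1 t2 t3; lra.
Qed.

(** * The space H01 *)

Section H01_space.
Context {R : realType} (d : nat).
Local Notation Rd := 'rV[R]_d.
Local Notation leb := (lebesgue_rowvec d : {sigma_finite_measure set Rd -> \bar R}).
Context (Omega : set Rd) (oO : open Omega).
Implicit Types (f g u v w phi psi : Rd -> R) (c : R).

Local Notation mO := (open_measurable_rowvec oO).

Lemma H1_subspace : subspace (H1 Omega : set (Rd -> R)).
Proof.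
split=> [|c u v]; first exact: (test_H1 oO (test_cst0 Omega)).
exact: (H1_lin oO).
Qed.

Definition hform u v := bform Omega u v + aform Omega u v.

Lemma aformZD c u v w : H1 Omega u -> H1 Omega v -> H1 Omega w ->
  aform Omega (c *: u + v) w = c * aform Omega u w + aform Omega v w.
Proof. exact: (aform_lin oO). Qed.

Lemma bformZD c u v w : H1 Omega u -> H1 Omega v -> H1 Omega w ->
  bform Omega (c *: u + v) w = c * bform Omega u w + bform Omega v w.
Proof. by move=> [Lu _] [Lv _] [Lw _]; exact: (bform_lin oO). Qed.

Lemma hformZD c u v w : H1 Omega u -> H1 Omega v -> H1 Omega w ->
  hform (c *: u + v) w = c * hform u w + hform v w.
Proof. 
move=> Hu Hv Hw; rewrite /hform (bformZD c Hu Hv Hw) (aformZD c Hu Hv Hw).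
move: (bform _ u w) (bform _ v w) (aform _ u w) (aform _ v w) => p q r s.
ring.
Qed.

Lemma hform_psd : psd (on_submod (hH := H1_subspace) hform).
Proof.
apply: psd_submod => [u v|c u v w Hu Hv Hw|v].
- by rewrite /hform (ipC leb Omega u v : bform Omega u v = bform Omega v u) aformC.
- exact: hformZD.
- by rewrite /hform addr_ge0 ?aform_ge0//; exact: ip_ge0.
Qed.

Lemma norm_H1_triangle u v w : H1 Omega u -> H1 Omega v -> H1 Omega w ->
  norm_H1 Omega (u - w) <= norm_H1 Omega (u - v) + norm_H1 Omega (v - w).
Proof.
move=> Hu Hv Hw.
have [x <-] := submod_ex H1_subspace Hu.
have [y <-] := submod_ex H1_subspace Hv.
have [z <-] := submod_ex H1_subspace Hw.
exact: (fnorm_dist3 hform_psd x y z).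
Qed.

Lemma norm_H1_lin c u v : H1 Omega u -> H1 Omega v ->
  norm_H1 Omega (c *: u + v) <= `|c| * norm_H1 Omega u + norm_H1 Omega v.
Proof.
move=> Hu Hv.
have [x <-] := submod_ex H1_subspace Hu.
have [y <-] := submod_ex H1_subspace Hv.
rewrite -submod_valP; have := fnormD hform_psd (c *: x) y.
by rewrite (fnormZ hform_psd).
Qed.

Lemma test_H01 phi : test_function Omega phi -> H01 Omega phi.
Proof.
move=> tp; split; first exact: (test_H1 oO tp).
move=> e e0; exists phi => //.
have [x <-] := submod_ex H1_subspace (test_H1 oO tp).
rewrite -[norm_H1 _ _]/(fnorm (on_submod (hH := H1_subspace) hform) (x - x)) subrr.
by rewrite /fnorm (form0l hform_psd.1) sqrtr0.
Qed.
End H01_space.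

Section H01_forms.
Context {R : realType} (d : nat).
Local Notation Rd := 'rV[R]_d.
Local Notation leb := (lebesgue_rowvec d : {sigma_finite_measure set Rd -> \bar R}).
Context (Omega : set Rd) (oO : open Omega).
Implicit Types (f g u v w phi psi : Rd -> R) (c : R).

Local Notation mO := (open_measurable_rowvec oO).

Lemma H01_subspace : subspace (H01 Omega : set (Rd -> R)).
Proof.
split=> [|c u v [Hu du] [Hv dv]]; first exact: (test_H01 oO (test_cst0 Omega)).
split; first exact: (H1_lin oO).
move=> e e0; pose K := 2 * (`|c| + 1); have K0 : 0 < K by rewrite mulr_gt0// ltr_wpDl.
have [phi tp hp] := du (e / K) ltac:(by rewrite divr_gt0).
have [psi ts hs] := dv (e / 2) ltac:(by rewrite divr_gt0).
exists (fun x => c * phi x + psi x); first exact: test_lin.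
have H1B w z : H1 Omega w -> H1 Omega z -> H1 Omega (w - z).
  move=> Hw Hz; have [x <-] := submod_ex (H1_subspace oO) Hw.
  have [y <-] := submod_ex (H1_subspace oO) Hz.
  by rewrite -submod_valB; exact: submodP.
have Hp := H1B _ _ Hu (test_H1 oO tp); have Hs := H1B _ _ Hv (test_H1 oO ts).
have -> : (c *: u + v) \- (fun x => c * phi x + psi x) = c *: (u - phi) + (v - psi).
  apply/funext => x; rewrite -[LHS]/(c * u x + v x - (c * phi x + psi x)) -[RHS]/(c * (u x - phi x) + (v x - psi x)).
  by move: (u x) (v x) (phi x) (psi x) => p q r s; ring.
apply: le_lt_trans (norm_H1_lin oO c Hp Hs) _.
have h1 : `|c| * norm_H1 Omega (u - phi) <= `|c| * (e / K) by rewrite ler_wpM2l// ltW.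
have h2 : `|c| * (e / K) <= e / 2.
  have -> : e / 2 = (`|c| + 1) * (e / K) by rewrite /K; field; rewrite gt_eqF// ltr_wpDl.
  by rewrite ler_wpM2r ?lerDl// divr_ge0// ltW.
have hs' : norm_H1 Omega (v - psi) < e / 2 by exact: hs.
by rewrite [ltRHS](splitr e) ler_ltD// (le_trans h1).
Qed.

Definition H01_space := submod H01_subspace.
HB.instance Definition _ := GRing.Lmodule.on H01_space.

Definition form_a (x y : H01_space) : R := aform Omega (submod_val x) (submod_val y).
Definition form_b (x y : H01_space) : R := bform Omega (submod_val x) (submod_val y).

Lemma H01_H1 (x : H01_space) : H1 Omega (submod_val x).
Proof. exact: (submodP x).1. Qed.

Lemma form_a_psd : psd form_a.
Proof.
apply: (psd_submod (H := H01 Omega)) => [u v|c u v w [Hu _] [Hv _] [Hw _]|v].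
- exact: aformC.
- exact: aformZD.
- exact: aform_ge0.
Qed.

Lemma form_b_psd : psd form_b.
Proof.
apply: (psd_submod (H := H01 Omega)) => [u v|c u v w [Hu _] [Hv _] [Hw _]|v].
- exact: (ipC leb Omega u v).
- exact: bformZD.
- exact: ip_ge0.
Qed.

Definition form_h (x y : H01_space) : R := form_b x y + form_a x y.

Lemma psdD (V : lmodType R) (q1 q2 : V -> V -> R) : psd q1 -> psd q2 -> psd (fun x y => q1 x y + q2 x y).
Proof.
move=> p1 p2; split=> [|v]; last by rewrite addr_ge0 ?p1.2 ?p2.2.
split=> [u v|c u v w]; first by rewrite (formC p1.1) (formC p2.1).
rewrite (p1.1.2 c u v w) (p2.1.2 c u v w).
by move: (q1 u w) (q1 v w) (q2 u w) (q2 v w) => p q r s; ring.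
Qed.

Lemma psdZ (V : lmodType R) (q : V -> V -> R) (k : R) : 0 <= k -> psd q -> psd (fun x y => k * q x y).
Proof.
move=> k0 p; split=> [|v]; last by rewrite mulr_ge0 ?p.2.
split=> [u v|c u v w]; first by rewrite (formC p.1).
by rewrite (p.1.2 c u v w); move: (q u w) (q v w) => r s; ring.
Qed.

Lemma psd_rank1 (V : lmodType R) (l : V -> R) : (forall c (u v : V), l (c *: u + v) = c * l u + l v) ->
  psd (fun x y => l x * l y).
Proof.
move=> hl; split=> [|v]; last by rewrite -expr2 sqr_ge0.
split=> [u v|c u v w]; first by rewrite mulrC.
by rewrite hl; move: (l u) (l v) (l w) => r s t; ring.
Qed.

Lemma psd_sum (V : lmodType R) (I : Type) (r : seq I) (q : I -> V -> V -> R) :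
  (forall i, psd (q i)) -> psd (fun x y => \sum_(i <- r) q i x y).
Proof.
move=> hq; elim: r => [|i r IH].
  split=> [|v]; last by rewrite big_nil.
  by split=> [u v|c u v w]; rewrite !big_nil// mulr0 addr0.
have -> : (fun x y => \sum_(j <- i :: r) q j x y) = (fun x y => q i x y + \sum_(j <- r) q j x y).
  by apply/funext => x; apply/funext => y; rewrite big_cons.
exact: psdD.
Qed.

Lemma form_h_psd : psd form_h.
Proof. exact: psdD form_b_psd form_a_psd. Qed.

Definition tests : set H01_space := [set x | test_function Omega (submod_val x)].

Lemma tests_dense (x : H01_space) (e : R) : 0 < e -> exists2 s, tests s & form_h (x - s) (x - s) < e.
Proof.
move=> e0; have [_ /(_ (Num.sqrt e))] := submodP x; rewrite sqrtr_gt0 => /(_ e0)[phi tp hp].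
have [s sE] := submod_ex H01_subspace (test_H01 oO tp).
exists s; first by rewrite /tests/= sE.
have E : submod_val x \- phi = submod_val (x - s) by rewrite submod_valB sE.
by move: hp; rewrite E /norm_H1 ltr_sqrt.
Qed.

Lemma test_partial phi i : test_function Omega phi -> test_function Omega (partial i phi).
Proof.
move=> [sm [K [cK KO K0]]]; split.
  by move=> s; rewrite -[iter_partial s _]/(iter_partial s (iter_partial [:: i] phi)) /iter_partial -foldr_cat; exact: sm.
exists K; split=> // x nx.
have cl : closed K by apply: compact_closed => //; exact: norm_hausdorff.
have nK : \forall y \near x, (cst 0 : Rd -> R^o) y = phi y.
  have : open_nbhs x (~` K) by split=> //; exact: closed_openC.
  by move/open_nbhs_nbhs; apply: filterS => y ny; rewrite K0.
by rewrite /partial -(near_eq_derive _ nK); exact: derive_cst.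
Qed.

Lemma form_a_test (x : H01_space) : tests x -> form_a x x = dirichlet (submod_val x).
Proof.
move=> tx; rewrite /form_a (aform_weak oO (H01_H1 x) (H01_H1 x) (g := fun i => partial i (submod_val x))
  (h := fun i => partial i (submod_val x))).
- apply: eq_bigr => i _; rewrite /ip (Rintegral_support leb (@subsetT _ Omega)).
    by apply: eq_Rintegral => y _; rewrite expr2.
  by move=> y ny; rewrite (test_out (test_partial i tx) ny) mul0r.
- by move=> i; split; [exact: (test_partial_sqint oO i tx)|exact: test_weak_partial].
- by move=> i; split; [exact: (test_partial_sqint oO i tx)|exact: test_weak_partial].
Qed.

Lemma form_b_test (x : H01_space) : tests x -> form_b x x = \int[leb]_y (submod_val x y) ^+ 2.
Proof.
move=> tx; rewrite /form_b bformE /ip (Rintegral_support leb (@subsetT _ Omega)).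
  by apply: eq_Rintegral => y _; rewrite expr2.
by move=> y ny; rewrite (test_out tx ny) mul0r.
Qed.

Section bounded_domain.
Context (r : R) (r0 : 0 < r) (Or : Omega `<=` cube r).

Lemma test_supported phi : test_function Omega phi -> supported_in r phi.
Proof. by move=> tp x nx; apply: (test_out tp) => /Or. Qed.

(* A translation by the diameter makes the supports disjoint. *)
Lemma C1c_poincare phi (i : 'I_d) : C1c phi -> supported_in r phi ->
  \int[leb]_x (phi x) ^+ 2 <= 2 * r ^+ 2 * dirichlet phi.
Proof.
move=> Cp sp; have [cp _ _ _] := Cp.
pose v : Rd := (2 * r) *: delta_mx 0 i.
have disj x : phi (x + v) * phi x = 0.
  have [/cubeP /(_ i)|nx] := pselect (cube r x); last by rewrite [X in _ * X]sp// mulr0.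
  rewrite ltr_norml => /andP[h1 h2]; rewrite sp ?mul0r// => /cubeP /(_ i).
  by rewrite !mxE !eqxx/= mulr1 ltr_norml => /andP[_]; lra.
have i2 : leb.-integrable setT (EFin \o (fun x => phi x ^+ 2)).
  apply: (@continuous_support_integrable _ _ _ r); first exact: continuousX2_fct.
  by move=> x nx; rewrite sp// expr0n.
have i3 := integrable_translate v i2.
have E : shift_energy phi v = 2 * \int[leb]_x (phi x) ^+ 2.
  rewrite /shift_energy; under eq_Rintegral do rewrite sqrrB disj mul0rn subr0.
  by rewrite RintegralD// (Rintegral_translate v i2); lra.
have h1 := shift_energy_axis i (2 * r) Cp; rewrite -/v E in h1.
have h2 : (2 * r) ^+ 2 * \int[leb]_x (partial i phi x) ^+ 2 <= (2 * r) ^+ 2 * dirichlet phi.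
  rewrite ler_wpM2l ?sqr_ge0// /dirichlet (bigD1 i)//= lerDl.
  by apply: sumr_ge0 => j _; apply: Rintegral_ge0 => x _; exact: sqr_ge0.
by move: h1 h2; rewrite exprMn; move: (r ^+ 2) => t; lra.
Qed.

Lemma poincare (i : 'I_d) (x : H01_space) : form_b x x <= (2 * r ^+ 2) * form_a x x.
Proof.
have r2 : 0 <= 2 * r ^+ 2 by rewrite mulr_ge0// sqr_ge0.
apply: (form_le_dense (h := form_h) (S := tests) (q2 := fun x y => (2 * r ^+ 2) * form_a x y) (K := 1 + 2 * r ^+ 2)).
- exact: form_h_psd.
- exact: form_b_psd.
- exact: psdZ r2 form_a_psd.
- move=> v; have := form_a_psd.2 v; have := form_b_psd.2 v; rewrite /form_h.
  by move: (form_a v v) (form_b v v) (2 * r ^+ 2) r2 => p q t *; nra.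
- move=> v; have := form_a_psd.2 v; have := form_b_psd.2 v; rewrite /form_h.
  by move: (form_a v v) (form_b v v) (2 * r ^+ 2) r2 => p q t *; nra.
- exact: tests_dense.
by move=> s ts; rewrite form_b_test// form_a_test// C1c_poincare//; [exact: test_C1c ts|exact: test_supported].
Qed.

Lemma indic_sqint (Q : set Rd) : measurable Q -> sqint leb Omega (\1_Q : Rd -> R).
Proof.
move=> mQ; split; first by apply: measurable_funTS; exact: measurable_indic.
apply: (@measurable_bounded_integrable _ _ _ leb (fun x => (\1_Q x : R) ^+ 2)).
- exact: mO.
- by apply: le_lt_trans (lebesgue_obox_lty (const_mx (- r)) (const_mx r)); apply: le_measure => //; rewrite inE; [exact: mO|exact: measurable_cube].
- by apply: measurable_funX; apply: measurable_funTS; exact: measurable_indic.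
exists 1; split=> // y y1 x _ /=; rewrite indicE normrX.
by case: (_ \in _); rewrite ?normr1 ?normr0 ?expr1n ?expr0n/= ltW// (lt_trans ltr01).
Qed.

(** The functionals are integrals over the cells, with the weight [Num.sqrt c] built in. They are
    bounded in L2, so both sides of the inequality for test functions are continuous and density
    applies. *)
Lemma rellich (i0 : 'I_d) : compact_embedding form_a form_b.
Proof.
move=> eps e0; have [m [Q [c [mQ Qoo c0 hQ]]]] := @rellich_C1 R d r eps r0 e0.
pose l (j : 'I_m) (x : H01_space) : R := Num.sqrt c * ip leb Omega (submod_val x) (\1_(Q j)).
have LV (x : H01_space) : sqint leb Omega (submod_val x) by exact: (H01_H1 x).1.
have llin j k (x y : H01_space) : l j (k *: x + y) = k * l j x + l j y.
  rewrite /l submod_valP (ip_linE mO k (LV x) (LV y) (indic_sqint (mQ j))).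
  by move: (ip _ _ _ _) (ip _ _ _ _) => p q; ring.
pose S := \sum_j ip leb Omega (\1_(Q j) : Rd -> R) \1_(Q j).
have lb j x : l j x ^+ 2 <= c * S * form_b x x.
  rewrite /l exprMn sqr_sqrtr// -mulrA ler_wpM2l// mulrC.
  apply: le_trans (ip_CS mO (LV x) (indic_sqint (mQ j))) _.
  rewrite ler_wpM2l ?form_b_psd.2// /S (bigD1 j)//= lerDl.
  by apply: sumr_ge0 => k _; exact: ip_ge0.
have S0 : 0 <= c * S by rewrite mulr_ge0//; apply: sumr_ge0 => k _; exact: ip_ge0.
exists m, l; split => //.
  exists (c * S * (2 * r ^+ 2)) => j x; apply: (le_trans (lb j x)); rewrite -[leRHS]mulrA; apply: ler_wpM2l S0 _ _ _.
  exact: poincare.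
move=> x.
pose q2 (x y : H01_space) := eps * form_a x y + \sum_j l j x * l j y.
have -> : eps * form_a x x + \sum_j l j x ^+ 2 = q2 x x.
  by rewrite /q2; congr (_ + _); apply: eq_bigr => j _; rewrite expr2.
apply: (form_le_dense (h := form_h) (S := tests) (q2 := q2) (K := 1 + eps + m%:R * (c * S))).
- exact: form_h_psd.
- exact: form_b_psd.
- apply: psdD; first exact: psdZ (ltW e0) form_a_psd.
  by apply: psd_sum => j; exact: psd_rank1.
- move=> v; have := form_a_psd.2 v; have := form_b_psd.2 v; rewrite /form_h.
  have : 0 <= m%:R * (c * S) by rewrite mulr_ge0.
  by move: (form_a v v) (form_b v v) (m%:R * (c * S)) => p q t t0 q0 p0; nra.
- move=> v; have h : \sum_j l j v * l j v <= m%:R * (c * S) * form_b v v.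
    apply: (@le_trans _ _ (\sum_(j < m) (c * S * form_b v v))); first by apply: ler_sum => j _; rewrite -expr2.
    by rewrite sumr_const card_ord -[leRHS]mulrA mulr_natl.
  have := form_a_psd.2 v; have := form_b_psd.2 v; rewrite /q2 /form_h.
  have : 0 <= m%:R * (c * S) by rewrite mulr_ge0.
  move: h; move: (form_a v v) (form_b v v) (m%:R * (c * S)) (\sum_j _) => p q t s h t0 q0 p0; nra.
- exact: tests_dense.
move=> s ts; rewrite form_b_test// /q2 form_a_test//.
apply: le_trans (hQ _ (test_C1c ts) (test_supported ts)) _.
rewrite lerD2l; apply: ler_sum => j _; rewrite /l -expr2 exprMn sqr_sqrtr// ler_wpM2l//.
rewrite le_eqVlt; apply/orP; left; apply/eqP; congr (_ ^+ 2).
rewrite /ip (Rintegral_support leb (@subsetT _ Omega)); last by move=> y ny; rewrite (test_out ts ny) mul0r.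
rewrite Rintegral_mkcond; apply: eq_Rintegral => y _; rewrite patchE indicE.
by case: ifP => _; rewrite ?mulr1 ?mulr0.
Qed.
End bounded_domain.
End H01_forms.

(** * Completeness of H01 *)

Section H01_completeness.
Context {R : realType} (d : nat).
Local Notation Rd := 'rV[R]_d.
Local Notation leb := (lebesgue_rowvec d : {sigma_finite_measure set Rd -> \bar R}).
Context (Omega : set Rd) (oO : open Omega).
Implicit Types (f g u v w phi psi : Rd -> R) (c : R).

Local Notation mO := (open_measurable_rowvec oO).

Lemma ipB u v w : L2 Omega u -> L2 Omega v -> L2 Omega w ->
  ip leb Omega (fun x => u x - v x) w = ip leb Omega u w - ip leb Omega v w.
Proof.
move=> Lu Lv Lw; have := ip_lin mO (-1) Lv Lu Lw.
have -> : (fun x => -1 * v x + u x) = (fun x => u x - v x).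
  by apply/funext => x; rewrite mulN1r addrC.
by move=> ->; rewrite mulN1r addrC.
Qed.

Lemma ip_distC u v :
  ip leb Omega (fun x => u x - v x) (fun x => u x - v x) =
  ip leb Omega (fun x => v x - u x) (fun x => v x - u x).
Proof.
by apply: eq_Rintegral => x _; move: (u x) (v x) => p q; ring.
Qed.

(** For a fixed test function, the defect in the integration by parts is L2-continuous in the
    function and its derivative, and it vanishes for the approximants. *)
Lemma weak_partial_closed i u g : L2 Omega u -> L2 Omega g ->
  (forall e : R, 0 < e -> exists v h, [/\ L2 Omega v, L2 Omega h, weak_partial Omega i v h,
    ip leb Omega (fun x => v x - u x) (fun x => v x - u x) < e &
    ip leb Omega (fun x => h x - g x) (fun x => h x - g x) < e]) ->
  weak_partial Omega i u g.
Proof.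
move=> Lu Lg happ phi tp.
have Lp := test_sqint oO tp; have Lq := test_partial_sqint oO i tp.
rewrite -[LHS]/(ip leb Omega u (partial i phi)) -[X in - X]/(ip leb Omega g phi).
have main e : 0 < e -> (ip leb Omega u (partial i phi) + ip leb Omega g phi) ^+ 2 <=
    2 * e * (ip leb Omega (partial i phi) (partial i phi) + ip leb Omega phi phi).
  move=> /happ[v [h [Lv Lh wv h1 h2]]].
  have E : ip leb Omega v (partial i phi) = - ip leb Omega h phi by exact: wv.
  have c1 := ip_CS mO (sqintB mO Lv Lu) Lq; have c2 := ip_CS mO (sqintB mO Lh Lg) Lp.
  rewrite ipB// in c1; rewrite ipB// in c2; rewrite E in c1.
  have p1 : 0 <= ip leb Omega (partial i phi) (partial i phi) by exact: ip_ge0.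
  have p2 : 0 <= ip leb Omega phi phi by exact: ip_ge0.
  move: c1 c2 h1 h2 p1 p2.
  move: (ip _ _ (fun x => v x - u x) _) (ip _ _ (fun x => h x - g x) _) => r s.
  move: (ip leb Omega u (partial i phi)) (ip leb Omega g phi) (ip leb Omega h phi)
    (ip leb Omega (partial i phi) (partial i phi)) (ip leb Omega phi phi).
  move=> x y z p q h1 h2 /ltW h3 /ltW h4 p0 q0.
  have k1 := ler_wpM2r p0 h3; have k2 := ler_wpM2r q0 h4.
 have k4 := sqr_ge0 (- z - x - (z - y)).
  have -> : (x + y) ^+ 2 = 2 * (- z - x) ^+ 2 + 2 * (z - y) ^+ 2 - (- z - x - (z - y)) ^+ 2 by ring.
  by move: ((- z - x) ^+ 2) ((z - y) ^+ 2) ((- z - x - (z - y)) ^+ 2) h1 h2 k4 => A B C h1 h2 C0; lra.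
move: main.
have p1 : 0 <= ip leb Omega (partial i phi) (partial i phi) by exact: ip_ge0.
have p2 : 0 <= ip leb Omega phi phi by exact: ip_ge0.
move: p1 p2; move: (ip leb Omega u (partial i phi)) (ip leb Omega g phi)
  (ip leb Omega (partial i phi) (partial i phi)) (ip leb Omega phi phi).
move=> x y p q p0 q0 main; apply/eqP; rewrite -addr_eq0 -sqrf_eq0 eq_le sqr_ge0 andbT leNgt; apply/negP => D0.
set D := (x + y) ^+ 2 in main D0; have S0 : 0 < 2 * (p + q) + 1 by lra.
(* With this tolerance the bound on the squared defect [D] is strictly smaller than [D]. *)
have /main : 0 < D / (2 * (p + q) + 1) by rewrite divr_gt0.
rewrite mulrAC [_ * (D / _)]mulrC -mulrA [X in D * X](_ : _ = 1 - (2 * (p + q) + 1)^-1).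
  have : 0 < (2 * (p + q) + 1)^-1 by rewrite invr_gt0.
  by move: (_ ^-1) => t t0; nra.
by field; rewrite gt_eqF.
Qed.

Lemma weak_partialB i u v g h : L2 Omega u -> L2 Omega v -> L2 Omega g -> L2 Omega h ->
  weak_partial Omega i u g -> weak_partial Omega i v h ->
  weak_partial Omega i (u - v) (fun x => g x - h x).
Proof.
move=> Lu Lv Lg Lh wu wv.
have E (p q : Rd -> R) : (fun x => -1 * q x + p x) = (fun x => p x - q x).
  by apply/funext => x; rewrite mulN1r addrC.
have := weak_partial_lin oO (-1) Lv Lu Lh Lg wv wu.
by rewrite !E.
Qed.

Lemma H1B u v : H1 Omega u -> H1 Omega v -> H1 Omega (u - v).
Proof.
move=> Hu Hv; have [x <-] := submod_ex (H1_subspace oO) Hu.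
have [y <-] := submod_ex (H1_subspace oO) Hv.
by rewrite -submod_valB; exact: submodP.
Qed.

Lemma aformB_weak u v (g h : 'I_d -> Rd -> R) : H1 Omega u -> H1 Omega v ->
  (forall i, L2 Omega (g i) /\ weak_partial Omega i u (g i)) ->
  (forall i, L2 Omega (h i) /\ weak_partial Omega i v (h i)) ->
  aform Omega (u - v) (u - v) =
  \sum_i ip leb Omega (fun x => g i x - h i x) (fun x => g i x - h i x).
Proof.
move=> Hu Hv hg hh; have wB i : L2 Omega (fun x => g i x - h i x) /\
    weak_partial Omega i (u - v) (fun x => g i x - h i x).
  split; first exact: (sqintB mO (hg i).1 (hh i).1).
  exact: (weak_partialB Hu.1 Hv.1 (hg i).1 (hh i).1 (hg i).2 (hh i).2).
exact: (aform_weak oO (H1B Hu Hv) (H1B Hu Hv) wB wB).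
Qed.

Lemma form_b_dist (x y : H01_space oO) : form_b (x - y) (x - y) =
  ip leb Omega (fun z => submod_val x z - submod_val y z) (fun z => submod_val x z - submod_val y z).
Proof. by rewrite /form_b submod_valB bformE. Qed.

Lemma form_a_dist (x y : H01_space oO) : form_a (x - y) (x - y) =
  \sum_i ip leb Omega (fun z => wgrad Omega i (submod_val x) z - wgrad Omega i (submod_val y) z)
    (fun z => wgrad Omega i (submod_val x) z - wgrad Omega i (submod_val y) z).
Proof.
rewrite /form_a submod_valB; apply: aformB_weak (H01_H1 x) (H01_H1 y) _ _ => i;
  apply: wgradP; exact: H01_H1.
Qed.

(** The Poincare inequality makes the functions Cauchy in L2 as well, so functions and derivatives
    converge separately and the closedness of weak derivatives matches their limits. A test function
    close to [f n] is close to the limit, which therefore stays in [H01]. *)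
Lemma H01_complete (K : R) : 0 < K ->
  (forall x : H01_space oO, form_b x x <= K * form_a x x) ->
  form_complete (form_a (oO := oO)).
Proof.
move=> K0 hK f cf.
pose F n := submod_val (f n).
have HF n : H1 Omega (F n) by exact: H01_H1.
have [u Lu hu] : exists2 u, L2 Omega u & forall e, 0 < e -> exists N, forall n, (N <= n)%N ->
    ip leb Omega (fun x => F n x - u x) (fun x => F n x - u x) < e.
  apply: (L2_complete mO (f := F)) => [n|e e0]; first exact: (HF n).1.
  have [N hN] := cf (e / K) ltac:(by rewrite divr_gt0).
  exists N => m n Nm Nn; have := hN m n Nm Nn; rewrite ltr_pdivlMr// mulrC => h.
  by have := le_lt_trans (hK _) h; rewrite form_b_dist.
have /choice[g hg] : forall i, exists g, L2 Omega g /\ forall e, 0 < e -> exists N, forall n, (N <= n)%N ->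
    ip leb Omega (fun x => wgrad Omega i (F n) x - g x) (fun x => wgrad Omega i (F n) x - g x) < e.
  move=> i; have [] := @L2_complete _ _ _ leb Omega mO (fun n => wgrad Omega i (F n)).
  - by move=> n; exact: (wgradP i (HF n)).1.
  - move=> e e0; have [N hN] := cf e e0; exists N => m n Nm Nn.
    apply: le_lt_trans (hN m n Nm Nn); rewrite form_a_dist (bigD1 i)//= lerDl.
    by apply: sumr_ge0 => j _; exact: ip_ge0.
  by move=> g Lg h; exists g.
have wu i : L2 Omega (g i) /\ weak_partial Omega i u (g i).
  have [Lg hgi] := hg i; split=> //; apply: weak_partial_closed => // e e0.
  have [N1 h1] := hu e e0; have [N2 h2] := hgi e e0.
  have [L w] := wgradP i (HF (maxn N1 N2)).
  exists (F (maxn N1 N2)), (wgrad Omega i (F (maxn N1 N2))).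
  by split=> //; [exact: (HF _).1|exact/h1/leq_maxl|exact/h2/leq_maxr].
have Hu : H1 Omega u by split=> // i; exists (g i).
have aE n : aform Omega (F n - u) (F n - u) =
    \sum_i ip leb Omega (fun x => wgrad Omega i (F n) x - g i x) (fun x => wgrad Omega i (F n) x - g i x).
  by apply: aformB_weak => // i; exact: wgradP.
have ca e : 0 < e -> exists N, forall n, (N <= n)%N -> aform Omega (F n - u) (F n - u) < e.
  (* [d] terms of size [e / d.+1%:R] add up to strictly less than [e]. *)
  move=> e0; have e1 : 0 < e / d.+1%:R by rewrite divr_gt0.
  have /choice[N hN] : forall i, exists N, forall n, (N <= n)%N ->
      ip leb Omega (fun x => wgrad Omega i (F n) x - g i x) (fun x => wgrad Omega i (F n) x - g i x)
        < e / d.+1%:R by move=> i; exact: (hg i).2.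
  exists (\max_i N i) => n hn; rewrite aE.
  apply: (@le_lt_trans _ _ (\sum_(i < d) (e / d.+1%:R))).
    by apply: ler_sum => i _; apply/ltW/hN/(leq_trans _ hn)/leq_bigmax.
  rewrite sumr_const card_ord -[_ *+ d]mulr_natr mulrAC -mulrA gtr_pMr//.
  by rewrite mulrC ltr_pdivrMl// mulr1 ltr_nat.
have H01u : H01 Omega u.
  split=> // e e0; have s0 : 0 < (e / 2) ^+ 2 / 2 by rewrite divr_gt0// exprn_gt0// divr_gt0.
  have [N1 h1] := hu _ s0; have [N2 h2] := ca _ s0.
  pose n := maxn N1 N2; have [_ hn] := submodP (f n).
  have [phi tp hp] := hn (e / 2) ltac:(by rewrite divr_gt0).
  exists phi => //; apply: le_lt_trans (norm_H1_triangle oO Hu (HF n) (test_H1 oO tp)) _.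
  rewrite [ltRHS](splitr e); apply: ltrD; last exact: hp.
  have k1 := h1 n (leq_maxl _ _); have := h2 n (leq_maxr _ _).
  rewrite aE; under eq_bigr do rewrite ip_distC.
  rewrite -(aformB_weak Hu (HF n) wu (fun i => wgradP i (HF n))) => k2.
  rewrite ip_distC in k1.
  have -> : e / 2 = Num.sqrt ((e / 2) ^+ 2) by rewrite sqrtr_sqr ger0_norm// divr_ge0// ltW.
  rewrite /norm_H1 ltr_sqrt ?exprn_gt0 ?divr_gt0//.
  by rewrite [ltRHS]splitr; apply: ltrD; [exact: k1|exact: k2].
have [y yE] := submod_ex (H01_subspace oO) H01u.
exists y => e /ca[N hN]; exists N => n /hN.
by rewrite /form_a submod_valB yE.
Qed.

End H01_completeness.

(** * The finite element spaces *)

Section eigenline.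
Context (R : realType) (V : lmodType R) (a b : V -> V -> R) (ha : psd a) (hb : psd b).
Local Notation sa := ha.1. Local Notation sb := hb.1.

Lemma fdist_null (W : set V) x y : a (x - y) (x - y) = 0 -> fdist a W x = fdist a W y.
Proof.
move=> xy; have E v : fnorm a (x - v) = fnorm a (y - v).
  have xy0 : fnorm a (x - y) = 0 by rewrite /fnorm xy sqrtr0.
  apply/le_anti; rewrite (le_trans (fnorm_dist3 ha x y v)) ?xy0 ?add0r//=.
  by rewrite (le_trans (fnorm_dist3 ha y x v))// (fnormBC ha) xy0 add0r.
rewrite /fdist; congr inf; apply/seteqP.
by split=> _ [v Wv <-]; exists v => //; rewrite E.
Qed.

Lemma fdistZ (W : set V) (c : R) x : subspace W -> c != 0 ->
  fdist a W (c *: x) = `|c| * fdist a W x.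
Proof.
have le (k : R) (z : V) : subspace W -> k != 0 -> fdist a W (k *: z) <= `|k| * fdist a W z.
  move=> hW k0; have kp : 0 < `|k| by rewrite normr_gt0.
  rewrite -ler_pdivrMl//; apply: lb_le_inf => [|_ [w Ww <-]].
    by exists (fnorm a (z - 0)), 0 => //; exact: hW.1.
  rewrite ler_pdivrMl// -(fnormZ ha) scalerBr; apply: fdist_le.
  by rewrite -[X in W X]addr0; apply: hW.2 => //; exact: hW.1.
move=> hW c0; apply/le_anti; rewrite le//= -ler_pdivlMl ?normr_gt0//.
by have := le c^-1 (c *: x) hW; rewrite invr_eq0 scalerK// normfV; exact.
Qed.

Context (lam gam : R) (e : V) (lam0 : 0 < lam) (gam0 : 0 < gam) (bee : b e e = 1).
Context (he : forall v, a e v = lam * b e v).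
Context (gap : forall v, b e v = 0 -> gam * b v v <= a v v - lam * b v v).

(** By the gap, the part of [x] that is b-orthogonal to [e] is null, so [x] is [c *: e] up to a null
    vector, and the normalisation gives [c ^+ 2 * lam = 1]. *)
Lemma fdist_eigenspace (W : set V) x : subspace W -> (forall v, a x v = lam * b x v) ->
  a x x = 1 -> fdist a W x = fdist a W e / Num.sqrt lam.
Proof.
move=> hW hx ax; set c := b e x; set y := x - c *: e.
have bey : b e y = 0 by rewrite /y (formDr sb) (formNr sb) (formZr sb) bee mulr1 subrr.
have hy v : a y v = lam * b y v.
  rewrite /y (formDl sa) (formNl sa) (formZl sa) hx he.
  by rewrite (formDl sb) (formNl sb) (formZl sb); move: (b x v) (b e v) => p q; ring.
have byy : b y y = 0.
  apply/le_anti; rewrite hb.2 andbT -(pmulr_rle0 _ gam0).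
  by have := gap bey; rewrite hy subrr.
have ayy : a y y = 0 by rewrite hy byy mulr0.
have c2 : c ^+ 2 * lam = 1.
  rewrite -[RHS]ax hx mulrC; congr (_ * _).
  have -> : b x x = b y y + c * b e y + c * b y e + c ^+ 2 * b e e.
    rewrite -[X in b X X](subrK (c *: e)) -/y !(formDl sb) !(formDr sb) !(formZl sb) !(formZr sb).
    by move: (b y y) (b y e) (b e y) (b e e) => p q r s; ring.
  by rewrite byy (formC sb y e) bey bee; ring.
have c0 : c != 0 by apply: contra_eq_neq c2 => ->; rewrite expr0n mul0r eq_sym oner_eq0.
rewrite (@fdist_null W x (c *: e))// fdistZ// mulrC; congr (_ * _).
apply: (@pexpIrn _ 2) => //; rewrite ?nnegrE ?invr_ge0 ?sqrtr_ge0//.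
rewrite real_normK ?num_real// exprVn sqr_sqrtr ?ltW//.
by rewrite -[LHS]mulr1 -(divff (lt0r_neq0 lam0)) mulrA c2 mul1r.
Qed.

End eigenline.

Section finite_elements.
Context {R : realType} (d : nat).
Local Notation Rd := 'rV[R]_d.
Context (Omega : set Rd) (oO : open Omega).

Lemma affine_on_lin (A : set Rd) (c : R) (u v : Rd -> R) :
  affine_on A u -> affine_on A v -> affine_on A (c *: u + v).
Proof.
move=> [cu [gu hu]] [cv [gv hv]]; exists (c * cu + cv), (c *: gu + gv) => x Ax.
rewrite -[LHS]/(c * u x + v x) (hu _ Ax) (hv _ Ax) mulmxDr -scalemxAr.
have -> : (c *: (x *m gu) + x *m gv) 0 0 = c * (x *m gu) 0 0 + (x *m gv) 0 0 by rewrite !mxE.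
by move: ((x *m gu) 0 0) ((x *m gv) 0 0) => p q; ring.
Qed.

Lemma fespace_subspace (T : mesh R d) : subspace (fespace Omega T : set (Rd -> R)).
Proof.
split=> [|c u v [Hu cu au] [Hv cv av]].
  split; first exact: (H01_subspace oO).1.
    by move=> x; exact: cst_continuous.
  by move=> K _; exists 0, 0 => x _; rewrite mulmx0 mxE addr0.
split; first exact: (H01_subspace oO).2.
  apply: within_continuousD => // x.
  exact: (continuous_comp (cu x) (@mulrl_continuous R c (u x))).
by move=> K KT; apply: affine_on_lin; [exact: au|exact: av].
Qed.

Lemma mesh_size_ge0 (T : mesh R d) : 0 <= mesh_size T.
Proof. by rewrite /mesh_size; elim: T => [|K T IH]; rewrite ?big_nil ?big_cons ?le_max ?IH ?orbT. Qed.

Lemma mesh_size_refinement (beta n : nat) (T : nat -> mesh R d) : (2 <= beta)%N ->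
  (forall k, (1 <= k < n)%N -> regular_refinement beta (T k) (T k.+1)) ->
  forall k, (1 <= k <= n)%N -> mesh_size (T k) <= mesh_size (T 1%N).
Proof.
move=> b2 hT; elim=> // -[_ _//|k] IH /andP[_ kn].
apply: le_trans (IH _); last exact: ltnW.
have [_ _ ->] := hT k.+1 kn.
have b0 : (0 < beta)%N by exact: leq_trans b2.
rewrite ler_pdivrMr ?ltr0n//; apply: ler_peMr; first exact: mesh_size_ge0.
by rewrite ler1n.
Qed.

(* The junk value is 0 when [f] is not in [H01 Omega]. *)
Definition H01_lift (f : Rd -> R) : H01_space oO := xget 0 [set x | submod_val x = f].

Lemma H01_liftE f : H01 Omega f -> submod_val (H01_lift f) = f.
Proof. by move=> Hf; apply: (@xgetPex _ 0 [set x | submod_val x = f]); exact: submod_ex. Qed.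

Lemma submod_valZ (c : R) (x : H01_space oO) : submod_val (c *: x) = c *: submod_val x.
Proof. by have := submod_valP c x 0; rewrite submod_val0 !addr0. Qed.

Definition H01_set (W : set (Rd -> R)) : set (H01_space oO) := [set x | W (submod_val x)].

Lemma H01_set_subspace (W : set (Rd -> R)) : subspace W -> subspace (H01_set W).
Proof.
move=> [W0 Wl]; split=> [|c x y Wx Wy]; first exact: W0.
exact: (Wl c _ _ Wx Wy).
Qed.

Lemma norm_a_form (x : H01_space oO) : norm_a Omega (submod_val x) = fnorm (form_a (oO := oO)) x.
Proof. by []. Qed.

Lemma norm_b_form (x : H01_space oO) : norm_b Omega (submod_val x) = fnorm (form_b (oO := oO)) x.
Proof. by []. Qed.

Lemma dist_a_form (W : set (Rd -> R)) (x : H01_space oO) : W `<=` H01 Omega ->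
  dist_a Omega W (submod_val x) = fdist (form_a (oO := oO)) (H01_set W) x.
Proof.
move=> WH; rewrite /dist_a /fdist; congr inf; apply/seteqP; split=> [_ [v Wv <-]|_ [y Wy <-]].
  exists (H01_lift v); first by rewrite /H01_set/= H01_liftE//; exact: WH.
  by rewrite -norm_a_form submod_valB H01_liftE//; exact: WH.
by exists (submod_val y) => //; rewrite -norm_a_form submod_valB.
Qed.

Context (lam gam : R) (e : H01_space oO) (lam0 : 0 < lam) (gam0 : 0 < gam).
Context (bee : form_b e e = 1) (he : forall v, form_a e v = lam * form_b e v).
Context (gap : forall v, form_b e v = 0 -> gam * form_b v v <= form_a v v - lam * form_b v v).

(** The supremum is taken over a single value, as all eigenfunctions of a-norm 1 have the same
    distance; the rescaled [e] shows that there is one. *)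
Lemma delta_form (W : set (Rd -> R)) : subspace W -> W `<=` H01 Omega ->
  delta Omega W lam = fdist (form_a (oO := oO)) (H01_set W) e / Num.sqrt lam.
Proof.
move=> sW WH; have sW' := H01_set_subspace sW.
have main (x : H01_space oO) : (forall v, form_a x v = lam * form_b x v) -> form_a x x = 1 ->
    dist_a Omega W (submod_val x) = fdist (form_a (oO := oO)) (H01_set W) e / Num.sqrt lam.
  move=> hx ax; rewrite dist_a_form//.
  exact: (fdist_eigenspace (form_a_psd oO) (form_b_psd oO) lam0 gam0 bee he gap sW' hx ax).
rewrite /delta -[RHS]sup1; congr sup; apply/seteqP; split=> [_ [w [[Hw hw] nw] <-]|_ ->].
  rewrite -(H01_liftE Hw); apply: main => [v|].
    by rewrite /form_a /form_b H01_liftE//; apply: hw; exact: submodP.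
  by rewrite -(fnorm_sqr (form_a_psd oO)) -norm_a_form H01_liftE// nw expr1n.
pose x := (Num.sqrt lam)^-1 *: e.
have hx v : form_a x v = lam * form_b x v.
  rewrite (formZl (form_a_psd oO).1) (formZl (form_b_psd oO).1) he.
  by move: (form_b e v) (_^-1) => p q; ring.
have ax : form_a x x = 1.
  rewrite hx (formZl (form_b_psd oO).1) (formZr (form_b_psd oO).1) bee mulr1 -expr2 exprVn sqr_sqrtr ?ltW//.
  by rewrite divff// gt_eqF.
exists (submod_val x); last exact: main.
split; last by rewrite norm_a_form /fnorm ax sqrtr1.
split; first exact: submodP.
by move=> v Hv; have := hx (H01_lift v); rewrite /form_a /form_b H01_liftE.
Qed.

Lemma eigenpair_form : eigenpair Omega (H01 Omega) lam (submod_val e).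
Proof.
split; [exact: submodP|exact: bee|move=> v Hv].
by have := he (H01_lift v); rewrite /form_a /form_b H01_liftE.
Qed.

(** Were [lam] missing from the list, the expansion of [e] would be an empty sum and [e] would have
    b-norm zero. It comes first because every listed eigenvalue is a Rayleigh quotient, hence at
    least [lam]. *)
Lemma first_eigenvalue (lambda : nat -> R) : eigenvalue_sequence Omega lambda -> lambda 0%N = lam.
Proof.
move=> [mono _ [ef [hef _ span]]].
have [j jl] : exists j, lambda j = lam.
  apply: contrapT => no; have [N] := span _ _ eigenpair_form.
  rewrite [X in norm_b _ X](_ : _ = submod_val e); last first.
    apply/funext => x; rewrite big1 ?subr0// => i /eqP h.
    by case: no; exists i.
  by rewrite norm_b_form /fnorm bee sqrtr1 => /eqP; rewrite oner_eq0.
have m0 : lambda 0%N <= lambda j.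
  elim: j {jl} => // j IH; exact: le_trans IH (mono j).
apply/le_anti; rewrite -{1}jl m0/=.
have [H0 b0 h0] := hef 0%N.
have := rayleigh_ge (form_a_psd oO) (form_b_psd oO) gam0 bee he gap (H01_lift (ef 0%N)).
by rewrite /form_a /form_b H01_liftE// b0 mulr1 (h0 _ H0) b0 mulr1.
Qed.

End finite_elements.

(** * From the abstract estimate to the finite element hierarchy *)

Theorem theorem4p1 (R : realType) (d : nat) (hd : d = 2%N \/ d = 3%N)
    (Omega : set 'rV[R]_d) (hOmega : bounded_domain Omega)
    (lambda : nat -> R) (hlambda : eigenvalue_sequence Omega lambda)
    (hsimple : lambda 0%N < lambda 1%N)
    (TT : set (mesh R d)) (kappa : R)
    (hTT : forall T, TT T -> is_mesh Omega T /\ shape_regular kappa T)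
    (happrox : forall w, H01 Omega w -> forall eps : R, 0 < eps ->
      exists2 h0 : R, 0 < h0 & forall T, TT T -> mesh_size T < h0 ->
        dist_a Omega (fespace Omega T) w < eps)
    (beta : nat) (hbeta : (2 <= beta)%N) (C7 C8 : R) :
  exists h0 C9 C10 : R, [/\ 0 < h0, 0 < C9, 0 < C10 &
  forall (n : nat) (T : nat -> mesh R d),
  let V := fun k => fespace Omega (T k) in
  let dlt := fun k => delta Omega (V k) (lambda 0%N) in
  let eta := fun k => eta_a Omega (V k) in
  (1 <= n)%N ->
  (forall k, (1 <= k <= n)%N -> TT (T k)) ->
  (forall k, (1 <= k < n)%N -> regular_refinement beta (T k) (T k.+1)) ->
  (forall k, (1 <= k < n)%N -> V k `<=` V k.+1) ->
  (forall k, (2 <= k <= n)%N -> beta%:R^-1 * eta k.-1 <= C7 * eta k) ->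
  (forall k, (2 <= k <= n)%N -> beta%:R^-1 * dlt k.-1 <= C7 * dlt k) ->
  mesh_size (T 1%N) < h0 ->
  forall (lam lambar lamhat : nat -> R) (u ubar uhat : nat -> 'rV[R]_d -> R),
  multilevel_scheme Omega n V lam u lamhat uhat ->
  (forall k, (1 <= k <= n)%N ->
    first_eigenpair Omega (V k) (lambar k) (ubar k)) ->
  ubar 1%N = u 1%N ->
  (forall k, (1 <= k < n)%N ->
    norm_a Omega (ubar k \- ubar k.+1) <= C8 * dlt k) ->
  (exists alpha sigma : R, [/\ 0 < alpha, 0 < sigma,
    forall v, H01 Omega v -> bform Omega (u 1%N) v = 0 ->
      alpha * norm_a Omega v ^+ 2
      <= aform Omega v v - lam 1%N * bform Omega v v &
    forall nu : R, sigma * `|nu| <=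
      sup [set - nu * bform Omega (u 1%N) v / norm_a Omega v | v in
        [set v | H01 Omega v /\ norm_b Omega v != 0]]]) ->
  [/\ norm_a Omega (u n \- ubar n) <= dlt n,
      `|lam n - lambar n| <= C9 * dlt n ^+ 2 &
      exists u1, [/\ eigenpair Omega (H01 Omega) (lambda 0%N) u1,
        (* delta is normalised by ||w||_a = 1, but u1 by ||u1||_b = 1; hence
           the factor ||u1||_a, which can be dropped when lambda_1 < 4 *)
        norm_a Omega (u1 \- u n) <= 2 * norm_a Omega u1 * dlt n,
        lambda 0%N < 4 -> norm_a Omega (u1 \- u n) <= 2 * dlt n &
        `|lambda 0%N - lam n| <= 2 * C10 * dlt n ^+ 2]]].
Proof.

have [oO _ _ bO] := hOmega; have [r r0 Or] := bounded_cube bO.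
have i0 : 'I_d by exists 0%N; case: hd => ->.
have sa := form_a_psd oO; have sb := form_b_psd oO.
have K0 : 0 < 2 * r ^+ 2 by rewrite mulr_gt0// exprn_gt0.
have hP := poincare Or i0 (oO := oO).
have cpl := H01_complete K0 hP; have cpt := rellich oO r0 Or i0.
pose L (f : 'rV[R]_d -> R) : H01_space oO := H01_lift oO f.
pose W (T : mesh R d) : set (H01_space oO) := H01_set (oO := oO) (fespace Omega T).
have sF T : subspace (fespace Omega T : set ('rV[R]_d -> R)) by exact: fespace_subspace.
have FH T : fespace Omega T `<=` H01 Omega by move=> v [].
have hW T : subspace (W T) by exact: H01_set_subspace.
(* The split concerns [Omega] alone, since the constants precede the meshes: eigenvector and gap
   come from this fixed [u0], not from the initial pair of a hierarchy. *)
have [[u0 [alpha [al0 bu0 hu0]]]|no] := pselect (exists (u : H01_space oO) (alpha : R),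
  [/\ 0 < alpha, form_b u u = 1 & forall v, form_b u v = 0 ->
      alpha * form_a v v <= form_a v v - form_a u u * form_b v v]); last first.
  exists 1, 1, 1; split=> [//|//|//|n T V dlt eta n1 _ _ _ _ _ _ lm lambar lamhat u ubar uhat].
  move=> [[[Vu bu au] _] _] _ _ _ [alpha [_ [al0 _ hal _]]]; exfalso; apply: no.
  have Hu : H01 Omega (u 1%N) by exact: FH Vu.
  exists (L (u 1%N)), alpha; split=> // [|v bv]; first by rewrite /form_b H01_liftE.
  have aE : lm 1%N = form_a (L (u 1%N)) (L (u 1%N)).
    by rewrite /form_a H01_liftE// au// bu mulr1.
  have := hal _ (submodP v); rewrite -aE norm_a_form (fnorm_sqr sa); apply.
  by move: bv; rewrite /form_b H01_liftE.
have [mu [e [mu0 bee he [gam gam0 gap]]]] := gap_from_coercivity sa sb hP cpl al0 bu0 hu0.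
have muE : lambda 0%N = mu by exact: (first_eigenvalue gam0 bee he gap hlambda).
have dE T : delta Omega (fespace Omega T) (lambda 0%N) = fdist (form_a (oO := oO)) (W T) e / Num.sqrt mu.
  by rewrite muE; exact: (delta_form mu0 gam0 bee he gap (sF T) (@FH T)).
have hap (w : H01_space oO) eps : 0 < eps -> exists2 h0 : R, 0 < h0 &
    forall T, TT T -> mesh_size T < h0 -> fdist (form_a (oO := oO)) (W T) w < eps.
  move=> eps0; have [h0 h00 hh] := happrox _ (submodP w) _ eps0.
  by exists h0 => // T TTT hT; rewrite -dist_a_form; [exact: hh|exact: FH].
(* [C7] and [C8] may have either sign, hence the absolute values; [beta%:R * C7] bounds the ratio of
   consecutive [dlt]. *)
have [h0 [C9 [h00 C90 key]]] := multilevel sa sb hP K0 cpl cpt mu0 gam0 bee he gap hW hap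
  (normr_ge0 (beta%:R * C7)) (normr_ge0 C8).
(* With this [C10], [2 * C10] is the constant [4 * lam] of the abstract eigenvalue estimate. *)
exists h0, C9, (2 * mu); split=> [//|//||n T V dlt eta n1 hT href hV _ hdlt hsz]; first by rewrite mulr_gt0.
move=> lm lambar lamhat u ubar uhat [[[Vu bu au] _] hs] hbar bar1 hstep [alpha' [_ [al'0 _ hal _]]].
have Hbar k : (1 <= k <= n)%N -> H01 Omega (ubar k) by move=> /hbar[[Vk _ _] _]; exact: FH Vk.
have Hhat k : (1 <= k < n)%N -> H01 Omega (uhat k.+1) by move=> /hs[Vk _ _ _ _]; exact: FH Vk.
have uE k : (1 <= k < n)%N ->
    u k.+1 = submod_val ((fnorm (form_b (oO := oO)) (L (uhat k.+1)))^-1 *: L (uhat k.+1)).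
  move=> hk; have Hk := Hhat k hk; have [_ _ _ -> _] := hs k hk.
  by rewrite submod_valZ -norm_b_form H01_liftE//; apply/funext => x; rewrite mulrC.
have Hu k : (1 <= k <= n)%N -> H01 Omega (u k).
  case: k => // -[_|k hk]; first exact: FH Vu.
  by rewrite uE//; exact: submodP.
have dlt_ge0 k : 0 <= dlt k.
  rewrite /dlt dE divr_ge0 ?sqrtr_ge0//; apply: lb_le_inf; last by move=> _ [v _ <-]; exact: fnorm_ge0.
  by exists (fnorm (form_a (oO := oO)) (e - 0)), 0 => //; exact: (hW _).1.
have E1 k : (1 <= k < n)%N -> (1 <= k <= n)%N by move=> /andP[-> /ltnW].
have E2 k : (1 <= k < n)%N -> (1 <= k.+1 <= n)%N by move=> /andP[].
have [||||c1 c2 c3 [e' ee' [c4 c5]]] := key n T lm lambar lamhat (fun k => L (u k)) (fun k => L (ubar k)) (fun k => L (uhat k)).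
- exact: n1.
- move=> k hk; split; first exact: hT.
  exact: le_lt_trans (mesh_size_refinement hbeta href hk) hsz.
- split.
  + move=> k hk; have [[Vk bk ak] _] := hbar k hk; have Hk := Hbar k hk.
    split; first by rewrite /W /H01_set/= H01_liftE.
      by rewrite /form_b H01_liftE.
    by move=> v Wv; rewrite /form_a /form_b H01_liftE//; exact: ak.
  + by rewrite bar1; split=> //; rewrite /form_a H01_liftE ?au ?bu ?mulr1//; exact: FH Vu.
  + move=> k hk; split.
    * by move=> v; exact: (hV k hk).
    * rewrite -!dE -/(dlt k) -/(dlt k.+1).
      have b0 : 0 < beta%:R :> R by rewrite ltr0n (leq_trans _ hbeta).
      have := hdlt k.+1 hk; rewrite /= ler_pdivrMl// mulrA => h.
      by rewrite (le_trans h)// ler_wpM2r// ler_norm.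
    * rewrite -dE -norm_a_form submod_valB !H01_liftE; [|exact/Hbar/E2|exact/Hbar/E1].
      by apply: le_trans (hstep k hk) _; rewrite ler_wpM2r ?ler_norm// dlt_ge0.
  + move=> k hk; have [V1 s1 s2 _ s3] := hs k hk.
    have Hk := Hhat k hk; have Huk := Hu k (E1 k hk); have Huk1 := Hu _ (E2 k hk).
    split.
    * by rewrite /W /H01_set/= H01_liftE.
    * by move=> v Wv; rewrite /form_a /form_b !H01_liftE//; exact: s1.
    * by rewrite /form_b !H01_liftE.
    * exact: val_inj (etrans (H01_liftE oO Huk1) (uE k hk)).
    * by rewrite /form_a /form_b !H01_liftE.
- move=> v bv; have Hu1 := FH _ _ Vu.
  have := hal _ (submodP v); rewrite norm_a_form (fnorm_sqr sa).
  move=> h; apply: le_trans (h _); first by rewrite mulr_ge0 ?sa.2// ltW.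
  by move: bv; rewrite /form_b H01_liftE.
have Hun : H01 Omega (u n) by apply: Hu; rewrite n1 leqnn.
have Hbn : H01 Omega (ubar n) by apply: Hbar; rewrite n1 leqnn.
split.
- by rewrite /dlt dE; move: c1; rewrite -norm_a_form submod_valB !H01_liftE.
- by rewrite /dlt dE.
have b' : form_b e' e' = 1 by case: ee' => ->; rewrite ?(formNl sb.1) ?(formNr sb.1) ?opprK.
have h' v : form_a e' v = mu * form_b e' v.
  by case: ee' => ->; rewrite ?(formNl sb.1) ?(formNl sa.1) he ?mulrN.
have n' : norm_a Omega (submod_val e') = Num.sqrt mu by rewrite norm_a_form /fnorm h' b' mulr1.
have d' : norm_a Omega (submod_val e' \- u n) = fnorm (form_a (oO := oO)) (e' - L (u n)).
  by rewrite -norm_a_form submod_valB H01_liftE.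
exists (submod_val e'); split.
- by rewrite muE; exact: eigenpair_form.
- by rewrite d' n' /dlt dE.
- by rewrite d' /dlt dE muE.
have -> : 2 * (2 * mu) = 4 * mu by ring.
by rewrite /dlt dE muE.
Qed.
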